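(* Let $a,b\in\mathbf{C}$ and consider the recurrence $$z_{n+1}=\frac{a+z_n}{b+z_{n-1}},$$ equivalently the rational map $$F(x,y)=\left(y,\ \frac{a+y}{b+x}\right)$$ of $\mathbf{C}^2$. Assume that all periodic points of $F$ are isolated, i.e. that for every $n\ge1$ each point of $Fix'_n$ is an isolated point of $Fix'_n$. Let $(\varphi_n)_{n\ge1}$ be the sequence defined by $\varphi_1=0$, $\varphi_2=2$, $\varphi_3=3$ and $\varphi_{n+3}=\varphi_n+\varphi_{n+1}$ for $n\ge1$. Then for every $n\ge1$, $$\#Fix'_n\le\varphi_n+2.$$ Moreover, for generic $(a,b)\in\mathbf{C}^2$, equality holds, i.e. $\#Fix'_n=\varphi_n+2$ for every $n\ge1$.
   Context: A point of $\mathbf{C}^2$ is in the indeterminacy set $Ind(F)$ if $F$, viewed as a map into a compactification of $\mathbf{C}^2$ such as $\mathbf{P}^2$ (with $\mathbf{C}^2\ni(x,y)\mapsto[1:x:y]$), cannot be extended continuously to that point; off $Ind(F)$ the map is holomorphic. For $n\ge1$, $$Fix'_n=\{z\in\mathbf{C}^2:\ F^jz\in\mathbf{C}^2- Ind(F)\ \text{for all } 1\le j\le n,\ \text{and } F^nz=z\}.$$ Thus $(x,y)\in Fix'_n$ if and only if the sequence generated by the recurrence from $z_0=x$, $z_1=y$ is well defined (stays finite) and periodic with some period dividing $n$. For $q\in Fix'_n$ isolated, $\mu_q\ge1$ denotes its algebraic multiplicity as a solution of the pair of equations $(x,y)-F^n(x,y)=(0,0)$ (the local intersection multiplicity, i.e.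 the dimension over $\mathbf{C}$ of the local ring of holomorphic germs at $q$ modulo the ideal generated by the two components of $(x,y)-F^n(x,y)$), and $$\#Fix'_n=\sum_{q\in Fix'_n}\mu_q .$$ ''Generic'' parameters means parameters outside a countable union of proper algebraic subvarieties of the parameter space. *)

(* Defs.v *)
From HB Require Import structures.
From mathcomp Require Import all_boot all_order all_algebra.
From mathcomp Require Import generic_quotient complex.
From mathcomp Require Import all_classical all_reals all_analysis.

Set Implicit Arguments.
Unset Strict Implicit.
Unset Printing Implicit Defensive.

Import Order.TTheory GRing.Theory Num.Theory.
Import numFieldNormedType.Exports.

Local Open Scope classical_set_scope.
Local Open Scope ring_scope.
Local Open Scope quotient_scope.

(* The library puts the usual norm topology of C on the alias R[i]^o, not on
   R[i]. *)
Notation CC R := (R[i]^o).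
Notation CC2 R := (CC R * CC R)%type.

Definition nzvec (R : realType) : set 'rV[CC R]_3 := [set v | v != 0].
Arguments nzvec : clear implicits.

Definition same_line (R : realType) (v w : nzvec R) : bool :=
  `[< exists2 c : CC R, c != 0 & val w = c *: val v >].

Lemma same_line_equiv (R : realType) : equiv_class_of (@same_line R).
Proof.
split.
- by move=> v; apply/asboolP; exists 1; rewrite ?oner_neq0 ?scale1r.
- have sym v w : @same_line R v w -> same_line w v.
    move=> /asboolP[c c0 e]; apply/asboolP; exists c^-1; rewrite ?invr_neq0//.
    by rewrite e scalerA mulVf// scale1r.
  by move=> v w; apply/idP/idP; exact: sym.
- move=> w v u /asboolP[c c0 e] /asboolP[d d0 e']; apply/asboolP.
  by exists (d * c); rewrite ?mulf_neq0// e' e scalerA.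
Qed.

Canonical same_line_equiv_rel (R : realType) :=
  EquivRelPack (same_line_equiv R).

Definition P2 (R : realType) := quotient_topology {eq_quot (@same_line R)}.

HB.instance Definition _ (R : realType) := Topological.on (P2 R).
HB.instance Definition _ (R : realType) := Quotient.on (P2 R).

Definition affine_vec (R : realType) (z : CC2 R) : 'rV[CC R]_3 :=
  \row_(i < 3) [:: 1; z.1; z.2]`_i.

Lemma affine_vec_neq0 (R : realType) (z : CC2 R) : affine_vec z \in nzvec R.
Proof.
apply/mem_set/eqP => /rowP/(_ ord0); rewrite !mxE /= => /eqP.
by rewrite oner_eq0.
Qed.

Definition affine (R : realType) (z : CC2 R) : P2 R :=
  \pi_(P2 R) (exist _ (affine_vec z) (affine_vec_neq0 z) : nzvec R).

Definition F (R : realType) (a b : CC R) (z : CC2 R) : CC2 R :=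
  (z.2, (a + z.2) / (b + z.1)).

(* Division by 0 yields 0 in the library, so F has to be used together with
   Fdom, the set on which its value is a point of C^2. *)
Definition Fdom (R : realType) (b : CC R) : set (CC2 R) :=
  [set z | b + z.1 != 0].

Definition Ind (R : realType) (a b : CC R) : set (CC2 R) :=
  [set p | ~ exists l : P2 R,
     affine (F a b z) @[z --> within (Fdom b) (nbhs p)] --> l].

(* The first clause says that F z, ..., F^n z all are points of C^2: at a point
   with b + x = 0, F either is indeterminate or takes the value [0 : 0 : 1],
   which lies on the line at infinity. *)
Definition Fix' (R : realType) (a b : CC R) (n : nat) : set (CC2 R) :=
  [set z | [/\ forall j, (j < n)%N -> Fdom b (iter j (F a b) z),
               forall j, (1 <= j <= n)%N -> ~ Ind a b (iter j (F a b) z) &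
               iter n (F a b) z = z]].

(* A germ at q is represented by any function on C^2 inducing it; only its
   values near q matter. In the order of R[i], 0 < r forces r to be real;
   likewise the bound M is real as soon as it bounds a real sum. *)
Definition holomorphic_at (R : realType) (q : CC2 R) (f : CC2 R -> CC R) :=
  exists (c : nat -> nat -> CC R) (r M : CC R),
    [/\ 0 < r,
        forall N, \sum_(i < N) \sum_(j < N) `|c i j| * r ^+ (i + j) <= M &
        forall z, ball q r z ->
          (\sum_(i < N) \sum_(j < N)
             c i j * (z.1 - q.1) ^+ i * (z.2 - q.2) ^+ j) @[N --> \oo]
            --> f z].

Definition in_ideal_at (R : realType) (q : CC2 R) (f g h : CC2 R -> CC R) :=
  exists u v : CC2 R -> CC R,
    [/\ holomorphic_at q u, holomorphic_at q v &
        \forall z \near q, h z = u z * f z + v z * g z].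

Definition free_mod_ideal_at (R : realType) (q : CC2 R) (f g : CC2 R -> CC R)
    (d : nat) (e : 'I_d -> CC2 R -> CC R) :=
  (forall i, holomorphic_at q (e i)) /\
  forall lam : 'I_d -> CC R,
    in_ideal_at q f g (fun z => \sum_i lam i * e i z) -> forall i, lam i = 0.

(* dim_C O_q / (f, g), as the supremum of the sizes of the families that are
   linearly independent modulo (f, g); it is +oo in infinite dimension. *)
Definition local_dim (R : realType) (q : CC2 R) (f g : CC2 R -> CC R)
    : \bar R :=
  ereal_sup [set d%:R%:E | d in
    [set d : nat | exists e : 'I_d -> CC2 R -> CC R,
                     free_mod_ideal_at q f g e]].

Definition mult (R : realType) (a b : CC R) (n : nat) (q : CC2 R) : \bar R :=
  local_dim q (fun z => z.1 - (iter n (F a b) z).1)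
              (fun z => z.2 - (iter n (F a b) z).2).

Definition numFix' (R : realType) (a b : CC R) (n : nat) : \bar R :=
  \esum_(q in Fix' a b n) mult a b n q.

Definition algebraic_subset (R : realType) (V : set (CC2 R)) :=
  exists S : set {poly {poly CC R}},
    V = [set ab | forall p, S p -> p.[ab.2%:P].[ab.1] = 0].

Definition generically (R : realType) (P : set (CC2 R)) :=
  exists V : nat -> set (CC2 R),
    (forall k, algebraic_subset (V k) /\ V k <> setT) /\
    forall ab, ~ (\bigcup_k V k) ab -> P ab.

(* Main.v *)
(* Fix n, write the points of period n as the solutions of two polynomial
   equations f = g = 0 with D <> 0 (the denominators), and let N be the number of
   closed itineraries of length n described below. They are the closed walks of a
   graph consisting of two loops and of a component with characteristic
   polynomial X^3 - X - 1, so that N = phi n + 2.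
   - If |b| is large compared with a, each coordinate of a periodic orbit is
     moderate, close to -b, or of order b^2, and solving each three-term relation
     for the right coordinate is a contraction: there is exactly one periodic
     orbit per itinerary, and the linearized recurrence has no periodic solution,
     so that the zeros are simple.
   - For arbitrary (a, b), a family of more than N polynomials is dependent modulo
     the ideal of the fibre over b + t for large t, hence over C(t). Polynomials
     that are independent modulo the local ideals at finitely many isolated
     points of the fibre t = 0 stay independent over C(t), because the Koszul
     relation allows a relation to be divided by t. Hence the multiplicities add
     up to at most N.
   - Every multiplicity is at least 1, and having exactly N points is a
     first-order condition on (a, b) satisfied on a Zariski dense set, hence it
     holds off a proper algebraic subset. *)
Require Import Defs.
From HB Require Import structures.
From mathcomp Require Import all_boot all_order all_algebra all_field.
From mathcomp Require Import complex.
From mathcomp Require Import all_classical all_reals all_analysis.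
From mathcomp Require Import ring lra zify.

Set Implicit Arguments.
Unset Strict Implicit.
Unset Printing Implicit Defensive.

Import Order.TTheory GRing.Theory Num.Theory.
Import numFieldNormedType.Exports.

Local Open Scope classical_set_scope.
Local Open Scope ring_scope.

(** * Polynomials in two variables *)

(** Clearing denominators creates spurious solutions where D vanishes, possibly whole curves.
    Everything is therefore localized: only an inequality is carried from the fibres over large t to
    the fibre t = 0, and polynomials that vanish at none of the chosen points are allowed as
    multipliers. The Koszul relation is the only syzygy once the common factor h of f and g has been
    removed; isolation makes h such a multiplier, since h = 0 at a point would let further fixed
    points accumulate there.

    Multiplicities concern rings of germs, whereas the deformation handles polynomials. Isolation
    gives the passage: powers of both coordinates lie in the local ideal, so every germ is a
    polynomial modulo the ideal, and a Chinese remainder argument treats all points at once.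

    For large t, vanishing at finitely many simple points has to become membership in an ideal.
    Uncountability of C serves twice: in the Nullstellensatz off D = 0, and in finding infinitely
    many t with a common exponent of D and a common degree bound for the cofactors. *)

Notation fib c := (map_poly (horner_eval c)).

Section BivariateEvaluation.
Variable K : comNzRingType.
Implicit Types (p : {poly {poly K}}) (x y c : K).

(** The inner variable of [{poly {poly K}}] is x and the outer one is y; [fib c] restricts a
    polynomial to the line x = c. *)
Definition ev2 x y p : K := p.[y%:P].[x].

Lemma ev2_is_additive x y : additive (ev2 x y).
Proof. by move=> p q; rewrite /ev2 !hornerE. Qed.

Lemma ev2_is_multiplicative x y : multiplicative (ev2 x y).
Proof. by split=> [p q|]; rewrite /ev2 !hornerE. Qed.

HB.instance Definition _ x y :=
  GRing.isAdditive.Build {poly {poly K}} K (ev2 x y) (ev2_is_additive x y).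
HB.instance Definition _ x y :=
  GRing.isMultiplicative.Build {poly {poly K}} K (ev2 x y)
    (ev2_is_multiplicative x y).

Lemma ev2N x y p : ev2 x y (- p) = - ev2 x y p.
Proof. by rewrite /ev2 !hornerN. Qed.

Lemma ev2B x y p q : ev2 x y (p - q) = ev2 x y p - ev2 x y q.
Proof. by rewrite /ev2 !hornerE. Qed.

Lemma ev2C x y (p : {poly K}) : ev2 x y p%:P = p.[x].
Proof. by rewrite /ev2 hornerC. Qed.

Lemma ev2X x y : ev2 x y 'X = y.
Proof. by rewrite /ev2 hornerX hornerC. Qed.

Lemma fibC c (p : {poly K}) : fib c p%:P = p.[c]%:P.
Proof. by rewrite map_polyC. Qed.

Lemma horner_fib c y p : (fib c p).[y] = ev2 c y p.
Proof.
by have := horner_map (horner_eval c) p y%:P; rewrite /= !horner_evalE hornerC.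
Qed.

End BivariateEvaluation.

(** * Common factors and syzygies of two polynomials *)

Section CommonFactor.
Variable K : closedFieldType.
Implicit Types (f g h e u v w : {poly {poly K}}) (x y c : K).

Lemma fib_eq0_factor c f : fib c f = 0 -> exists f', f = ('X - c%:P)%:P * f'.
Proof.
move=> f0; exists (map_poly (fun q => q %/ ('X - c%:P)) f).
apply/polyP => i; rewrite coefCM coef_map_id0 ?div0p// mulrC divpK//.
by rewrite dvdp_XsubCl; apply/rootP; move/polyP: f0 => /(_ i); rewrite coef_map coef0.
Qed.

Lemma fib_XsubC c f : fib c (('X - c%:P)%:P * f) = 0.
Proof. by rewrite rmorphM /= fibC hornerXsubC subrr mul0r. Qed.

Lemma XsubC_polyC_neq0 c : ('X - c%:P)%:P != 0 :> {poly {poly K}}.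
Proof. by rewrite polyC_eq0 polyXsubC_eq0. Qed.

(** Coprimality in K[x, y], split as in Gauss's lemma: a Bezout identity over K(x) with denominators
    cleared, and no common factor x - c. *)
Definition coprime_data f g :=
  exists al be (r : {poly K}), [/\ r != 0, al * f + be * g = r%:P &
    forall c, fib c f = 0 -> fib c g = 0 -> False].

Lemma XsubC_decomp (r : {poly K}) :
  r != 0 -> (exists2 k, k != 0 & r = k%:P) \/
  (exists c r', [/\ r' != 0, r = ('X - c%:P) * r' & size r = (size r').+1]).
Proof.
move=> r0; have [/size_poly1P[k k0 ->]|/closed_rootP[c]] := boolP (size r == 1).
  by left; exists k.
rewrite -dvdp_XsubCl => /dvdpP[r' rE]; right; exists c, r'.
have r'0 : r' != 0 by apply: contraNneq r0 => r'0; rewrite rE r'0 mul0r.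
split => //; first by rewrite rE mulrC.
by rewrite rE size_Mmonic ?monicXsubC// size_XsubC addn2.
Qed.

(** A common factor x - c of f and g also divides r, so cancelling it lowers the degree of r and the
    process stops. *)
Lemma common_factor_content f g al be (r : {poly K}) :
  r != 0 -> al * f + be * g = r%:P ->
  exists h f1 g1, [/\ f = h * f1, g = h * g1 & coprime_data f1 g1].
Proof.
have [n] := ubnP (size r); elim: n r f g => // n IH r f g rn r0 rE.
have [[c [f0 g0]]|nc] := pselect (exists c, fib c f = 0 /\ fib c g = 0); last first.
  exists 1, f, g; rewrite !mul1r; split => //; exists al, be, r; split => // c f0 g0.
  by apply: nc; exists c.
have [f' fE] := fib_eq0_factor f0; have [g' gE] := fib_eq0_factor g0.
have rc : r%:P = ('X - c%:P)%:P * (al * f' + be * g') by rewrite -rE fE gE; ring.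
have rc0 : root r c.
  move/(congr1 (fib c)): rc; rewrite fib_XsubC fibC => /eqP.
  by rewrite polyC_eq0.
move: rc0; rewrite -dvdp_XsubCl => /dvdpP[r' r'E].
have r'0 : r' != 0 by apply: contraNneq r0 => r'0; rewrite r'E r'0 mul0r.
have [|//||h [f1 [g1 [fE1 gE1 cop]]]] := IH r' f' g'.
- by move: rn; rewrite r'E size_Mmonic ?monicXsubC// size_XsubC addn2.
- by apply: (mulfI (XsubC_polyC_neq0 c)); rewrite -rc r'E -polyCM mulrC.
by exists (('X - c%:P)%:P * h), f1, g1; split => //; rewrite -mulrA -?fE1 -?gE1.
Qed.

(** Gauss's lemma, one linear factor x - c of w at a time: it divides e, or else both f2 and g2.
    When w has become constant, e divides f and g, and only common factors in x remain to be
    removed. *)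
Lemma common_factor_gauss f g e f2 g2 al be (w r : {poly K}) :
  w != 0 -> r != 0 -> e != 0 -> w%:P * f = e * f2 -> w%:P * g = e * g2 ->
  al * f + be * g = r%:P * e ->
  exists h f1 g1, [/\ f = h * f1, g = h * g1 & coprime_data f1 g1].
Proof.
have [n] := ubnP (size w); elim: n w r e f2 g2 => // n IH w r e f2 g2 wn w0 r0 e0 fE gE rE.
have [[k k0 wE]|[c [w' [w'0 wE sw]]]] := XsubC_decomp w0.
  have kU : k^-1%:P%:P * w%:P = 1 :> {poly {poly K}}.
    by rewrite wE -!polyCM mulVf.
  have fE' : f = e * (k^-1%:P%:P * f2) by rewrite mulrCA -fE mulrA kU mul1r.
  have gE' : g = e * (k^-1%:P%:P * g2) by rewrite mulrCA -gE mulrA kU mul1r.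
  have [|h [f1 [g1 [f1E g1E cop]]]] :=
    @common_factor_content (k^-1%:P%:P * f2) (k^-1%:P%:P * g2) al be r r0.
    by apply: (mulfI e0); rewrite [RHS]mulrC -rE [in RHS]fE' [in RHS]gE'; ring.
  by exists (e * h), f1, g1; rewrite {1}fE' f1E {1}gE' g1E -!mulrA.
have wn' : (size w' < n)%N by rewrite -ltnS -sw.
have [e00|e0'] := eqVneq (fib c e) 0.
  have [e' eE] := fib_eq0_factor e00.
  apply: (IH w' (r * ('X - c%:P)) e' f2 g2) => //.
  - by rewrite mulf_neq0 ?polyXsubC_eq0.
  - by apply: contraNneq e0 => e'0; rewrite eE e'0 mulr0.
  - by apply: (mulfI (XsubC_polyC_neq0 c)); rewrite mulrA -polyCM -wE fE eE mulrA.
  - by apply: (mulfI (XsubC_polyC_neq0 c)); rewrite mulrA -polyCM -wE gE eE mulrA.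
  - by rewrite rE eE polyCM mulrA.
have div (p p2 : {poly {poly K}}) : w%:P * p = e * p2 ->
    exists2 p', p2 = ('X - c%:P)%:P * p' & w'%:P * p = e * p'.
  move=> pE; have /fib_eq0_factor[p' p'E] : fib c p2 = 0.
    apply: (mulfI e0'); rewrite mulr0 -rmorphM /= -pE rmorphM /= fibC wE.
    by rewrite hornerM hornerXsubC subrr !mul0r.
  exists p' => //; apply: (mulfI (XsubC_polyC_neq0 c)).
  by rewrite mulrA -polyCM -wE pE p'E; ring.
have [f2' f2E f2'E] := div _ _ fE; have [g2' g2E g2'E] := div _ _ gE.
exact: (IH w' r e f2' g2').
Qed.

(** In the ideal (f, g), an element e of least degree in y divides every element up to a factor from
    K[x], by pseudo-division; [common_factor_gauss] removes these factors. *)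
Lemma common_factor f g :
  exists h f1 g1, [/\ f = h * f1, g = h * g1 & coprime_data f1 g1].
Proof.
have [[f0 g0]|fg0] := pselect (f = 0 /\ g = 0).
  exists 0, 1, 0; rewrite !mul0r f0 g0; split => //; exists 1, 0, 1.
  split; rewrite ?oner_neq0// ?mulr0 ?mulr1 ?addr0//.
  by move=> c; rewrite rmorph1 => /eqP; rewrite oner_eq0.
(* Sizes [n.+1] single out the non-zero combinations. *)
pose idl n := `[< exists al be, size (al * f + be * g) = n.+1 >].
have exn : exists n, idl n.
  have [f0|f0] := eqVneq f 0.
    have g0 : g != 0 by apply/eqP => g0; exact: fg0.
    exists (size g).-1; apply/asboolP; exists 0, 1.
    by rewrite mul0r add0r mul1r prednK// lt0n size_poly_eq0.
  exists (size f).-1; apply/asboolP; exists 1, 0.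
  by rewrite mul0r addr0 mul1r prednK// lt0n size_poly_eq0.
case: (ex_minnP exn) => m /asboolP[al [be em]] min.
set e := al * f + be * g in em.
have e0 : e != 0 by rewrite -size_poly_gt0 em.
have div p : (exists u v, p = u * f + v * g) ->
    exists (w : {poly K}) q, w != 0 /\ w%:P * p = e * q.
  move=> [u [v pE]]; exists (lead_coef e ^+ scalp p e), (p %/ e).
  split; first by rewrite expf_neq0// lead_coef_eq0.
  have := Pdiv.Idomain.divpE p e; have := Pdiv.Idomain.modpE p e.
  have /= dE := Pdiv.Idomain.divp_eq p e.
  suff m0 : p %% e = 0 by rewrite mul_polyC dE m0 addr0 mulrC.
  apply/eqP/contraT => mn0.
  have : idl (size (p %% e)).-1.
    apply/asboolP; rewrite prednK ?size_poly_gt0//.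
    set w := _ ^+ _ in dE; exists (w%:P * u - (p %/ e) * al), (w%:P * v - (p %/ e) * be).
    congr (size (polyseq _)); rewrite (_ : p %% e = w%:P * p - p %/ e * e); last first.
      by rewrite mul_polyC dE; ring.
    by rewrite pE /e; ring.
  move=> /min; rewrite leqNgt; have := ltn_modp p e; rewrite e0 em ltnS.
  by move: mn0; rewrite -size_poly_gt0; case: (size _) => //= k _; rewrite leqNgt => /negbTE;
    rewrite ltnS => ->.
have [|w [q [w0 fE]]] := div f; first by exists 1, 0; ring.
have [|w' [q' [w'0 gE]]] := div g; first by exists 0, 1; ring.
apply: (@common_factor_gauss f g e (w'%:P * q) (w%:P * q') al be (w * w') 1).
- by rewrite mulf_neq0.
- exact: oner_neq0.
- exact: e0.
- by rewrite mulrCA -fE polyCM; ring.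
- by rewrite mulrCA -gE polyCM; ring.
- by rewrite mul1r.
Qed.

(* The Koszul relation is the only syzygy. *)
Lemma coprime_syzygy f g u v : coprime_data f g -> u * f + v * g = 0 ->
  exists w, u = w * g /\ v = - w * f.
Proof.
move=> [al [be [r [r0 rE nc]]]] uv0.
(* Cramer's rule yields the syzygy up to the factor r. For each root c of r, [w0] vanishes on the
   line x = c, because f and g do not both vanish identically on it, so x - c cancels. *)
pose w0 := be * u - al * v.
have ug : r%:P * u = w0 * g.
  have -> : w0 * g = r%:P * u - al * (u * f + v * g) by rewrite -rE /w0; ring.
  by rewrite uv0 mulr0 subr0.
have vf : r%:P * v = - w0 * f.
  have -> : - w0 * f = r%:P * v - be * (u * f + v * g) by rewrite -rE /w0; ring.
  by rewrite uv0 mulr0 subr0.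
clear rE uv0; move: r0 ug vf; move: w0; have [n] := ubnP (size r).
elim: n r => // n IH r rn w0 r0 ug vf.
have [[k k0 rE]|[c [r' [r'0 rE sr]]]] := XsubC_decomp r0.
  have kU : k^-1%:P%:P * r%:P = 1 :> {poly {poly K}}.
    by rewrite rE -!polyCM mulVf.
  exists (k^-1%:P%:P * w0); split.
    by rewrite -mulrA -ug mulrA kU mul1r.
  by rewrite -mulrN -mulrA -vf mulrA kU mul1r.
have w00 : fib c w0 = 0.
  apply: contrapT => w00; have w00' : fib c w0 != 0 by apply/eqP.
  have rc : fib c r%:P = 0 by rewrite fibC rE hornerM hornerXsubC subrr mul0r.
  apply: (nc c); apply: (mulfI w00'); rewrite mulr0 -rmorphM /=.
    by rewrite -[w0 * f]opprK -mulNr -vf rmorphN rmorphM /= rc mul0r oppr0.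
  by rewrite -ug rmorphM /= rc mul0r.
have [w' wE] := fib_eq0_factor w00.
apply: (IH r' _ w') => //; first by rewrite -ltnS -sr.
- by apply: (mulfI (XsubC_polyC_neq0 c)); rewrite mulrA -polyCM -rE ug wE mulrA.
- by apply: (mulfI (XsubC_polyC_neq0 c)); rewrite mulrA -polyCM -rE vf wE; ring.
Qed.

End CommonFactor.

(** * Conservation of the intersection number *)

Section Conservation.
Variable K : closedFieldType.
Local Notation T := {poly {poly K}}.

Lemma horner0_factor (A : idomainType) (p : {poly A}) :
  p.[0] = 0 -> exists q, p = q * 'X.
Proof.
by move=> /eqP /factor_theorem[q ->]; exists q; rewrite polyC0 subr0.
Qed.

(** In [{poly T}] the outermost variable is the deformation parameter t; [lift] reads a polynomial
    in t alone as an element of this ring. *)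
Local Notation lift := (map_poly (fun k : K => k%:P%:P : T)).

(* If a relation vanishes to order n at t = 0, its coefficients (U, V) reduce to
   a Koszul syzygy there, which can be subtracted so as to divide by t. *)
Lemma conservation (S : T -> Prop) d (P : 'I_d -> T) (F G : {poly T}) h f1 g1 :
  F.[0] = h * f1 -> G.[0] = h * g1 -> coprime_data f1 g1 -> S h ->
  (forall s s', S s -> S s' -> S (s * s')) ->
  (forall s (lam : 'I_d -> K) u v, S s ->
    s * (\sum_j (lam j)%:P%:P * P j) = u * F.[0] + v * G.[0] ->
    forall j, lam j = 0) ->
  forall (c : 'I_d -> {poly K}) s U V, S s.[0] ->
    s * (\sum_j lift (c j) * (P j)%:P) = U * F + V * G -> forall j, c j = 0.
Proof.
move=> F0 G0 cop Sh SM indep.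
suff main n : forall (c : 'I_d -> {poly K}) s U V, S s.[0] ->
    s * (\sum_j lift (c j) * (P j)%:P) = U * F + V * G -> forall j, (c j)`_n = 0.
  by move=> c s U V Ss e j; apply/polyP => n; rewrite coef0; apply: main e j.
have base (c : 'I_d -> {poly K}) s U V : S s.[0] ->
    s * (\sum_j lift (c j) * (P j)%:P) = U * F + V * G -> forall j, (c j)`_0 = 0.
  move=> Ss /(congr1 (horner^~ 0)); rewrite hornerD !hornerM horner_sum => e.
  apply: (indep s.[0] (fun j => (c j)`_0) U.[0] V.[0]) => //.
  rewrite -e; congr (_ * _); apply: eq_bigr => j _.
  by rewrite hornerM hornerC !horner_coef0 coef_map_id0.
elim: n => // n IH c s U V Ss e j.
have c0 := base _ _ _ _ Ss e.
have /choice[c' cE] : forall j, exists c', c j = c' * 'X.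
  by move=> i; apply: horner0_factor; rewrite horner_coef0.
have liftE i : lift (c i) = lift (c' i) * 'X.
  rewrite cE; apply/polyP => k; rewrite coef_map_id0// !coefMX.
  by case: k => [|k] //=; rewrite coef_map_id0.
have eX : s * (\sum_j lift (c' j) * (P j)%:P) * 'X = U * F + V * G.
  rewrite -e -mulrA mulr_suml; congr (_ * _); apply: eq_bigr => i _.
  by rewrite liftE mulrAC.
have : h * (U.[0] * f1 + V.[0] * g1) = 0.
  move/(congr1 (horner^~ 0)): eX; rewrite hornerMX mulr0 hornerD !hornerM F0 G0.
  by move=> e0; rewrite [RHS]e0; ring.
move=> /eqP; rewrite mulf_eq0 => /orP[/eqP h0|/eqP uv0].
  (* If h = 0, the multiplier h in S kills every combination, against [indep]. *)
  suff : (1 : K) = 0 by move/eqP; rewrite oner_eq0.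
  apply: (indep h (fun=> 1) 0 0 Sh _ j).
  by rewrite h0 !mul0r addr0.
have [w [uE vE]] := coprime_syzygy cop uv0.
(* Multiplied by h, the relation has at t = 0 the coefficients [w * G.[0]] and [- w * F.[0]];
   subtracting w times the Koszul relation of F and G makes it divisible by t. *)
have [U' U'E] : exists U', h%:P * U - w%:P * G = U' * 'X.
  by apply: horner0_factor; rewrite hornerD hornerN !hornerM !hornerC G0 uE; ring.
have [V' V'E] : exists V', h%:P * V + w%:P * F = V' * 'X.
  by apply: horner0_factor; rewrite hornerD !hornerM !hornerC F0 vE; ring.
rewrite cE coefMX /=; apply: (IH c' (h%:P * s) U' V').
  by rewrite hornerM hornerC; apply: SM.
apply: (mulIf (_ : 'X != 0)); first by rewrite polyX_eq0.
rewrite -!mulrA [X in _ * X]mulrA eX mulrDl.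
rewrite -[U' * F * 'X]mulrAC -[V' * G * 'X]mulrAC -U'E -V'E; ring.
Qed.

End Conservation.

(** * Nullstellensatz over an uncountable algebraically closed field *)

Definition many (K : Type) (A : K -> Prop) :=
  forall L, exists s : 'I_L -> K, injective s /\ forall i, A (s i).

(** Uncountability in the form of a pigeonhole principle: any map to a countable type has an
    infinite fibre on A. *)
Definition unctbl (K : Type) (A : K -> Prop) :=
  forall (I : countType) (phi : K -> I), exists i, many (fun x => A x /\ phi x = i).

Section Nullstellensatz.
Variable K : closedFieldType.
Hypothesis unctblK : unctbl (fun _ : K => True).
Local Notation T := {poly {poly K}}.

(** At a common zero, the values of [al], [be], [ga], [de] are the partial derivatives of f and g,
    so the determinant is the Jacobian. *)
Definition simple_zero (f g : T) x y := forall al be ga de,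
  f = ('X - x%:P)%:P * al + ('X - y%:P%:P) * be ->
  g = ('X - x%:P)%:P * ga + ('X - y%:P%:P) * de ->
  ev2 x y (al * de - be * ga) != 0.

Lemma ev2_eq0_decomp (p : T) x y : ev2 x y p = 0 ->
  exists al be, p = ('X - x%:P)%:P * al + ('X - y%:P%:P) * be.
Proof.
move=> p0.
have /factor_theorem[be beE] : root (p - p.[y%:P]%:P) y%:P.
  by rewrite rootE !hornerE subrr.
have /factor_theorem[al alE] : root p.[y%:P] x by rewrite rootE; apply/eqP.
exists al%:P, be; transitivity ((al * ('X - x%:P))%:P + be * ('X - y%:P%:P)).
  by rewrite -alE -beE addrC subrK.
by rewrite polyCM; ring.
Qed.

Definition bdeg n (p : T) := forall i j, (n <= i)%N || (n <= j)%N -> p`_j`_i = 0.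

Lemma bdegW n m p : (n <= m)%N -> bdeg n p -> bdeg m p.
Proof.
move=> nm np i j /orP ij; apply: np; apply/orP.
by case: ij => ij; [left|right]; exact: leq_trans ij.
Qed.

Lemma bdeg_ex p : exists n, bdeg n p.
Proof.
exists (maxn (size p) (\max_(j < size p) size (p`_j)%R)%N) => i j.
rewrite !geq_max => /orP[|] /andP[h1 h2]; last by rewrite (nth_default 0 h1) coef0.
have [jp|jp] := ltnP j (size p); last by rewrite (nth_default 0 jp) coef0.
by apply/nth_default/(leq_trans _ h2)/(leq_bigmax (Ordinal jp)).
Qed.

Lemma bdeg_ex_fam (I : finType) (p : I -> T) : exists n, forall i, bdeg n (p i).
Proof.
have /choice[n nP] i := bdeg_ex (p i).
by exists (\max_i n i)%N => i; apply: bdegW (nP i); exact: leq_bigmax.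
Qed.

Lemma bdeg_dep n L (s : 'I_L -> T) : (n * n < L)%N -> (forall i, bdeg n (s i)) ->
  exists lam : 'I_L -> K, (exists i, lam i != 0) /\
    \sum_i (lam i)%:P%:P * s i = 0.
Proof.
move=> nL sn.
pose M : 'M[K]_(L, n * n) := \matrix_(i < L) mxvec (\matrix_(k < n, l < n) (s i)`_l`_k).
have : kermx M != 0.
  rewrite kermx_eq0 /row_free neq_ltn (leq_ltn_trans _ nL)//.
  exact: rank_leq_col.
move=> /rowV0Pn[v /sub_kermxP vM v0]; exists (v 0); split.
  apply/existsP; apply: contraNT v0; rewrite negb_exists => /forallP v0.
  by apply/eqP/rowP => i; rewrite mxE; move: (v0 i); rewrite negbK => /eqP.
apply/polyP => l; apply/polyP => k; rewrite !coef0 !coef_sum.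
under eq_bigr do rewrite !coefCM.
have [|] := boolP ((n <= k) || (n <= l))%N.
  by move=> nkl; apply: big1 => i _; rewrite sn ?mulr0.
rewrite negb_or -!ltnNge => /andP[kn ln].
transitivity (vec_mx (v *m M) (Ordinal kn) (Ordinal ln)); last first.
  by rewrite vM linear0 mxE.
rewrite mulmx_sum_row linear_sum summxE; apply: eq_bigr => i _.
by rewrite rowK linearZ /= mxvecK !mxE.
Qed.

Section SaturatedIdeal.
Variables (D : T) (J : T -> Prop).
Hypothesis J_0 : J 0.
Hypothesis J_add : forall s s', J s -> J s' -> J (s + s').
Hypothesis J_mul : forall s s', J s -> J (s' * s).
Hypothesis J_sat : forall k s, J (D ^+ k * s) -> J s.
Hypothesis J1 : ~ J 1.

Let J_sum (I : finType) (s : I -> T) : (forall i, J (s i)) -> J (\sum_i s i).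
Proof. by move=> Js; apply: (big_ind J) => //; exact: J_add. Qed.

Let J_const k : k != 0 -> J k%:P%:P -> J 1.
Proof. by move=> k0 /(@J_mul _ (k^-1)%:P%:P); rewrite -!polyCM mulVf. Qed.

(** If no line x = c worked, every x - c would be invertible modulo J after localizing at D.
    Infinitely many of these inverses share a power of D and a degree bound; a linear relation
    between them yields a non-zero r(x) in J, whose linear factors are then cancelled until 1 lies
    in J. *)
Let section_x : exists c, forall k s, ~ J (D ^+ k - ('X - c%:P)%:P * s).
Proof.
apply: contrapT => /forallNP noc.
have {}noc c : exists ks : nat * T, J (D ^+ ks.1 - ('X - c%:P)%:P * ks.2).
  have /existsNP[k /existsNP[s /contrapT]] := noc c.
  by exists (k, s).
have [ks ksP] := choice noc.
have [bd bdP] := choice (fun c => bdeg_ex (ks c).2).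
have [[k n] manyc] := unctblK (fun c => ((ks c).1, bd c)).
have [c [cinj cP]] := manyc (n * n).+1.
have kE i : (ks (c i)).1 = k by case: (cP i) => _ [].
have nE i : bd (c i) = n by case: (cP i) => _ [].
pose s i := (ks (c i)).2.
have [|lam [[i0 lam0] lamE]] := @bdeg_dep n _ s (ltnSn _).
  by move=> i; rewrite -(nE i).
(* The numerator of the sum of the [lam i / (x - c i)]; it is non-zero at [c i0]. *)
pose r : {poly K} := \sum_i (lam i)%:P * \prod_(j | j != i) ('X - (c j)%:P).
have r0 : r != 0.
  apply: contraNneq lam0 => /(congr1 (horner^~ (c i0))).
  rewrite horner0 horner_sum (bigD1 i0)//= [X in _ + X]big1 ?addr0.
    rewrite hornerM hornerC => /eqP; rewrite mulf_eq0 => /orP[/eqP->//|].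
    rewrite horner_prod prodf_seq_eq0 => /hasP[j _ /andP[ji]].
    by rewrite hornerXsubC subr_eq0 (inj_eq cinj) eq_sym (negbTE ji).
  move=> i ii0; rewrite hornerM horner_prod (bigD1 i0) 1?eq_sym//=.
  by rewrite hornerXsubC subrr mul0r mulr0.
have Jr : J r%:P.
  apply: (@J_sat k).
  pose pr i : T := (\prod_(j | j != i) ('X - (c j)%:P))%:P.
  have -> : D ^+ k * r%:P = \sum_i (((lam i)%:P%:P * pr i) *
       (D ^+ k - ('X - (c i)%:P)%:P * s i)).
    rewrite /r rmorph_sum /= mulr_sumr.
    transitivity (\sum_i D ^+ k * ((lam i)%:P * \prod_(j | j != i) ('X - (c j)%:P))%:P
      - (\prod_j ('X - (c j)%:P))%:P * \sum_i (lam i)%:P%:P * s i).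
      by rewrite lamE mulr0 subr0.
    rewrite mulr_sumr -sumrB; apply: eq_bigr => i _.
    have -> : \prod_j ('X - (c j)%:P) = ('X - (c i)%:P) * \prod_(j | j != i) ('X - (c j)%:P).
      by rewrite (bigD1 i).
    by rewrite !(polyCM, polyCB) /pr; ring.
  by apply: J_sum => i; apply: J_mul; rewrite -(kE i).
move: r0 Jr; have [m] := ubnP (size r); clearbody r; elim: m r => // m IH r rm r0 Jr.
have [[k' k'0 rE]|[a [r' [r'0 rE sr]]]] := XsubC_decomp r0.
  by apply: J1; apply: (J_const k'0); rewrite -rE.
apply: (IH r') => //; first by rewrite -ltnS -sr.
apply: (@J_sat (ks a).1).
have -> : D ^+ (ks a).1 * r'%:P = r'%:P * (D ^+ (ks a).1 - ('X - a%:P)%:P * (ks a).2)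
   + (ks a).2 * r%:P by rewrite rE polyCM; ring.
by apply: J_add; apply: J_mul => //; exact: ksP.
Qed.

(** On the line x = c the ideal localizes to a proper ideal [Jc] of K[y]. If [Jc] is zero, any y off
    the zeros of D will do. Otherwise y is a root of a generator, and D(c, y) is non-zero, for else
    saturation would put a proper divisor of the generator in [Jc]. *)
Lemma saturated_ideal_zero : exists x y, ev2 x y D != 0 /\ forall s, J s -> ev2 x y s = 0.
Proof.
have [c cP] := section_x; exists c.
pose Jc (e : {poly K}) :=
  exists k s, J (D ^+ k * map_poly polyC e - ('X - c%:P)%:P * s).
have fibK (q : T) : exists s, map_poly polyC (fib c q) = q + ('X - c%:P)%:P * s.
  have [|s sE] := @fib_eq0_factor K c (map_poly polyC (fib c q) - q).
    rewrite rmorphB /= -map_poly_comp map_poly_id ?subrr// => e _ /=.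
    by rewrite horner_evalE hornerC.
  by exists s; rewrite -sE addrC subrK.
have Jc1 : ~ Jc 1.
  by move=> [k [s]]; rewrite rmorph1 mulr1; exact: cP.
have Jc_mul e e' : Jc e -> Jc (e' * e).
  move=> [k [s Js]]; exists k, (map_poly polyC e' * s).
  by move/(@J_mul _ (map_poly polyC e')): Js; rewrite rmorphM /= mulrBr mulrCA [_ * (_ * s)]mulrCA.
have Jc_add e e' : Jc e -> Jc e' -> Jc (e + e').
  move=> [k [s Js]] [k' [s' Js']].
  exists (k + k')%N, (D ^+ k' * s + D ^+ k * s').
  rewrite (_ : _ - _ = D ^+ k' * (D ^+ k * map_poly polyC e - ('X - c%:P)%:P * s) +
    D ^+ k * (D ^+ k' * map_poly polyC e' - ('X - c%:P)%:P * s')); last first.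
    by rewrite rmorphD /= exprD; ring.
  by apply: J_add; exact: J_mul.
have Jc_sat e : Jc (fib c D * e) -> Jc e.
  move=> [k [s Js]]; have [s' s'E] := fibK D.
  exists k.+1, (s - D ^+ k * s' * map_poly polyC e).
  rewrite (_ : _ - _ = D ^+ k * map_poly polyC (fib c D * e) - ('X - c%:P)%:P * s)//.
  by rewrite rmorphM /= s'E exprS; ring.
have Jc_fib s : J s -> Jc (fib c s).
  move=> Js; have [s' s'E] := fibK s; exists 0%N, s'.
  by rewrite s'E expr0 mul1r addrK.
have Jc0 : Jc 0 by rewrite -[0](rmorph0 (fib c)); exact: Jc_fib.
suff [y [Dy yP]] : exists y, (fib c D).[y] != 0 /\ forall e, Jc e -> e.[y] = 0.
  exists y; rewrite -horner_fib; split => // s /Jc_fib/yP.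
  by rewrite horner_fib.
have [J0|/existsNP[e0 /not_implyP[Je0 /eqP e00]]] := pselect (forall e, Jc e -> e = 0).
  have /closed_nonrootP[y Dy] : fib c D != 0.
    by apply/eqP => D0; apply: Jc1; apply: Jc_sat; rewrite D0 mul0r.
  by exists y; split => // e /J0 ->; rewrite horner0.
pose Q n := `[< exists e, [/\ Jc e, e != 0 & size e = n] >].
have exQ : exists n, Q n by exists (size e0); apply/asboolP; exists e0.
case: (ex_minnP exQ) => m /asboolP[e [Je e0' em]] min.
have dvd_e q : Jc q -> e %| q.
  move=> Jq; rewrite /dvdp; apply: contraT => r0.
  have : Q (size (q %% e)).
    apply/asboolP; exists (q %% e); split=> //.
    have -> : q %% e = q + (- (q %/ e)) * e.
      by rewrite {2}(divp_eq q e); ring.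
    by apply: Jc_add => //; exact: Jc_mul.
  by move/min; rewrite leqNgt -em ltn_modp e0'.
have [[k k0 eE]|[y [e' [e'0 eE se]]]] := XsubC_decomp e0'.
  by case: Jc1; have := Jc_mul _ (k^-1)%:P Je; rewrite eE -polyCM mulVf.
exists y; split; last first.
  move=> q /dvd_e/dvdpP[q' ->]; rewrite eE !hornerM hornerXsubC subrr mul0r.
  by rewrite mulr0.
apply/negP => /factor_theorem[D' D'E].
have : Q (size e').
  apply/asboolP; exists e'; split => //; apply: Jc_sat.
  by rewrite D'E -mulrA -eE; exact: Jc_mul.
by move/min; rewrite -em se ltnn.
Qed.

End SaturatedIdeal.

(** Consider the saturated ideal of those s for which [s * p] lies in (f, g) up to a power of D.
    Were it proper, it would have a zero off D = 0; there f, g and p vanish, and Cramer's rule puts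
    in the ideal a polynomial whose value at that point is the Jacobian determinant, which is
    non-zero. *)
Lemma local_nullstellensatz (f g D p : T) :
  (forall x y, ev2 x y f = 0 -> ev2 x y g = 0 -> ev2 x y D != 0 ->
    ev2 x y p = 0 /\ simple_zero f g x y) ->
  exists m u v, D ^+ m * p = u * f + v * g.
Proof.
move=> simpleZ; pose J s := exists m u v, D ^+ m * s * p = u * f + v * g.
suff : J 1 by move=> [m [u [v e]]]; exists m, u, v; rewrite -e mulr1.
apply: contrapT => J1; have [||||//|x [y [Dxy Jxy]]] := @saturated_ideal_zero D J.
- by exists 0%N, 0, 0; rewrite mulr0 !mul0r addr0.
- move=> s s' [m [u [v e]]] [m' [u' [v' e']]].
  exists (m + m')%N, (D ^+ m' * u + D ^+ m * u'), (D ^+ m' * v + D ^+ m * v').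
  transitivity (D ^+ m' * (D ^+ m * s * p) + D ^+ m * (D ^+ m' * s' * p)).
    by rewrite exprD; ring.
  by rewrite e e'; ring.
- move=> s s' [m [u [v e]]]; exists m, (s' * u), (s' * v).
  by transitivity (s' * (D ^+ m * s * p)); [ring|rewrite e; ring].
- by move=> k s [m [u [v e]]]; exists (m + k)%N, u, v; rewrite -e exprD -!mulrA.
have Jf : J f by exists 0%N, p, 0; rewrite expr0 mul1r mul0r addr0 mulrC.
have Jg : J g by exists 0%N, 0, p; rewrite expr0 mul1r mul0r add0r mulrC.
have [pxy simp] := simpleZ _ _ (Jxy _ Jf) (Jxy _ Jg) Dxy.
have [al [be fE]] := ev2_eq0_decomp (Jxy _ Jf).
have [ga [de gE]] := ev2_eq0_decomp (Jxy _ Jg).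
have [pi [rho pE]] := ev2_eq0_decomp pxy.
apply/negP: (simp _ _ _ _ fE gE); rewrite negbK; apply/eqP/Jxy.
exists 0%N, (de * pi - ga * rho), (al * rho - be * pi).
by rewrite expr0 mul1r {1}fE {1}gE pE; ring.
Qed.

End Nullstellensatz.

(** * Relations over the field of rational functions *)

Section FractionMatrices.
Variable A : idomainType.
Local Open Scope quotient_scope.

Lemma frac_repr (x : {fraction A}) : exists n d : A, d != 0 /\ tofrac d * x = tofrac n.
Proof.
elim/quotW: x => r; exists (frac r).1, (frac r).2; rewrite denom_ratioP; split => //.
rewrite !piE; apply/eqmodP; rewrite /= FracField.equivfE !numden_Ratio ?mulf_neq0 ?denom_ratioP
  ?oner_neq0//.
by rewrite mul1r mulr1 mulrC.
Qed.

Lemma frac_mx_denom m n (M : 'M[{fraction A}]_(m, n)) :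
  exists d (N : 'M[A]_(m, n)), d != 0 /\ tofrac d *: M = map_mx (@tofrac A) N.
Proof.
have /choice[num /choice[den nd]] (ij : prod (ordinal m) (ordinal n)) := frac_repr (M ij.1 ij.2).
exists (\prod_(ij : prod (ordinal m) (ordinal n)) den ij), (\matrix_(i, j) (num (i,
  j) * \prod_(kl : prod (ordinal m) (ordinal n) | kl != (i, j)) den kl)).
split; first by apply/prodf_neq0 => ij _; case: (nd ij).
apply/matrixP => i j; rewrite !mxE (bigD1 (i, j))//= !rmorphM /=.
by rewrite -(nd (i, j)).2 /= mulrAC.
Qed.

(** Over the fraction field, either the rows of E are dependent modulo the row space of H, or some B
    kills H and inverts E on the right; denominators are cleared in both cases. The second
    alternative survives every specialization at which k is non-zero. *)
Lemma relation_or_left_inverse d l n (E : 'M[A]_(d, n)) (H : 'M[A]_(l, n)) :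
  (exists (v : 'rV_d) (w : 'rV_l), v != 0 /\ v *m E + w *m H = 0) \/
  (exists k (B : 'M[A]_(n, d)), [/\ k != 0, E *m B = k%:M & H *m B = 0]).
Proof.
have mapI p q : injective (@map_mx _ _ (@tofrac A) p q).
  move=> X Y /matrixP XY; apply/matrixP => i j; apply/eqP; rewrite -tofrac_eq.
  by have := XY i j; rewrite !mxE => ->.
pose E' := map_mx (@tofrac A) E; pose H' := map_mx (@tofrac A) H.
have [EC|EC] := boolP (row_free (E' *m cokermx H')); [right|left].
  have /row_freeP[B EB] := EC.
  have [k [N [k0 NE]]] := frac_mx_denom (cokermx H' *m B).
  exists k, N; split => //; apply: mapI.
    by rewrite map_mxM -NE -scalemxAr mulmxA EB scalemx1 map_scalar_mx.
  by rewrite map_mxM -NE -scalemxAr mulmxA mulmx_coker mul0mx scaler0 map_mx0.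
move: EC; rewrite -kermx_eq0 => /rowV0Pn[v /sub_kermxP vE v0].
have /submxP[w wE] : (v *m E' <= H')%MS by rewrite submxE -mulmxA vE.
have [k [N [k0 NE]]] := frac_mx_denom (row_mx v (- w)).
exists (lsubmx N), (rsubmx N); split.
  apply: contraNneq v0 => N0.
  have : tofrac k *: v = 0.
    have := congr1 lsubmx NE; rewrite -map_lsubmx N0 map_mx0 => <-.
    by rewrite linearZ /= row_mxKl.
  by move/eqP; rewrite scaler_eq0 tofrac_eq0 (negbTE k0).
apply: mapI; rewrite map_mx0 map_mxD !map_mxM.
rewrite map_lsubmx map_rsubmx -NE !linearZ /= row_mxKl row_mxKr.
by rewrite -!scalemxAl wE mulNmx scalerN subrr.
Qed.

End FractionMatrices.

Notation lift K := (map_poly (fun k : K => k%:P%:P)).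

Section GenericRelation.
Variable K : closedFieldType.
Local Notation T := {poly {poly K}}.
Local Notation cf k l := (map_poly (fun p : T => p`_l`_k)).

Lemma cf0 k l : (0 : T)`_l`_k = 0. Proof. by rewrite !coef0. Qed.

Lemma coef_lift_mul (c : {poly K}) (G : {poly T}) e k l :
  (lift K c * G)`_e`_l`_k = (c * cf k l G)`_e.
Proof.
rewrite !coefM !coef_sum; apply: eq_bigr => i _.
by rewrite coef_map_id0 ?polyC0// !coefCM [(cf k l G)`_(e - i)]coef_map_id0// cf0.
Qed.

Lemma horner_cf (G : {poly T}) k l x : (cf k l G).[x] = G.[x%:P%:P]`_l`_k.
Proof.
have cfs : (size (cf k l G) <= size G)%N by exact: size_poly.
rewrite (horner_coef_wide _ cfs) horner_coef !coef_sum; apply: eq_bigr => i _.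
rewrite coef_map_id0 ?cf0// -!rmorphXn /= !coefMC.
by [].
Qed.

(** With the monomials in x and y as columns, this is a statement about matrices over K[t]. If there
    were no relation over K[t], the certificate of [relation_or_left_inverse] would make k vanish at
    every t that admits a relation, hence at too many t. *)
Lemma generic_relation d l (E : 'I_d -> {poly T}) (H : 'I_l -> {poly T}) :
  many (fun x : K => exists (la : 'I_d -> K) (mu : 'I_l -> K),
    (exists i, la i != 0) /\
    \sum_i (la i)%:P%:P * (E i).[x%:P%:P] + \sum_j (mu j)%:P%:P * (H j).[x%:P%:P] = 0) ->
  exists (c : 'I_d -> {poly K}) (c' : 'I_l -> {poly K}), (exists i, c i != 0) /\
    \sum_i lift K (c i) * E i + \sum_j lift K (c' j) * H j = 0.
Proof.
move=> rel.
have bde (I : finType) (G : I -> {poly T}) : exists n, forall i e, bdeg n (G i)`_e.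
  have /choice[n nP] : forall i, exists n, forall e, bdeg n (G i)`_e.
    move=> i; have [n nP] := bdeg_ex_fam (fun e : 'I_(size (G i)) => (G i)`_e).
    exists n => e; have [es|es] := ltnP e (size (G i)); first exact: (nP (Ordinal es)).
    by rewrite (nth_default 0 es) => ? ? _; rewrite cf0.
  by exists (\max_i n i)%N => i e; apply: bdegW (nP i e); exact: leq_bigmax.
have [n1 n1E] := bde _ E; have [n2 n2H] := bde _ H.
pose n := maxn n1 n2.
have nE i e : bdeg n (E i)`_e by apply: bdegW (n1E i e); exact: leq_maxl.
have nH i e : bdeg n (H i)`_e by apply: bdegW (n2H i e); exact: leq_maxr.
pose ME := \matrix_(i < d, c < n * n) cf (c %/ n)%N (c %% n)%N (E i).
pose MH := \matrix_(i < l, c < n * n) cf (c %/ n)%N (c %% n)%N (H i).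
have [[v [w [v0 vw]]]|[k [B [k0 EB HB]]]] := relation_or_left_inverse ME MH.
  exists (v 0), (w 0); split.
    apply/existsP; apply: contraNT v0; rewrite negb_exists => /forallP v0.
    by apply/eqP/rowP => i; rewrite mxE; move: (v0 i); rewrite negbK => /eqP.
  apply/polyP => e; apply/polyP => j; apply/polyP => i.
  rewrite !coef0 !coefD !coef_sum.
  under eq_bigr do rewrite coef_lift_mul.
  under [X in _ + X]eq_bigr do rewrite coef_lift_mul.
  have [ij|] := boolP ((n <= i) || (n <= j))%N.
    rewrite !big1 ?addr0// => q _.
      rewrite (_ : cf i j (H q) = 0) ?mulr0 ?coef0//.
      by apply/polyP => e'; rewrite coef_map_id0 ?cf0// coef0 nH.
    rewrite (_ : cf i j (E q) = 0) ?mulr0 ?coef0//.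
    by apply/polyP => e'; rewrite coef_map_id0 ?cf0// coef0 nE.
  rewrite negb_or -!ltnNge => /andP[ni nj].
  have cn : (i * n + j < n * n)%N by nia.
  have n0 : (0 < n)%N by apply: leq_trans ni.
  have := congr1 (fun A : 'rV[{poly K}]_(n * n) => (A 0 (Ordinal cn))`_e) vw.
  rewrite /= !mxE coef0 coefD !coef_sum => e0; rewrite -[RHS]e0.
  congr (_ + _); apply: eq_bigr => q _;
  by rewrite mxE /= divnMDl// modnMDl divn_small// addn0 modn_small.
have [s [sinj sP]] := rel (size k).
suff : (size k < size k)%N by rewrite ltnn.
rewrite -[X in (X < _)%N]card_ord -(size_codom s).
apply: max_poly_roots => //; last by rewrite -/(injectiveb s); exact/injectiveP.
apply/allP => _ /codomP[i ->].
have [la [mu [[i0 la0] relE]]] := sP i.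
set x := s i in relE *.
pose ev m m' (M : 'M[{poly K}]_(m, m')) := map_mx (horner_eval x) M.
have rel' : (\row_i la i) *m ev _ _ ME + (\row_i mu i) *m ev _ _ MH = 0.
  apply/rowP => c; rewrite !mxE.
  have := congr1 (fun p : T => p`_(c %% n)%N`_(c %/ n)%N) relE.
  rewrite /= !coefD !coef_sum cf0 => relc; rewrite -[RHS]relc.
  by congr (_ + _); apply: eq_bigr => j _; rewrite !coefCM !mxE; rewrite ?horner_evalE horner_cf.
have : (\row_i la i) *m ev _ _ ME *m ev _ _ B = 0.
  move/eqP: rel'; rewrite addr_eq0 => /eqP ->.
  by rewrite mulNmx -mulmxA -map_mxM HB map_mx0 mulmx0 oppr0.
rewrite -mulmxA -map_mxM EB map_scalar_mx mul_mx_scalar => /rowP/(_ i0).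
rewrite !mxE => /eqP; rewrite mulf_eq0 (negbTE la0) orbF.
by rewrite -rootE.
Qed.

End GenericRelation.

(** * The periodic points as solutions of polynomial equations *)

Section OrbitFractions.
Variable A : comNzRingType.
Variables a b x y : A.

(** Two consecutive terms of the recurrence as fractions. Nothing is cancelled, so [den] keeps track
    of every earlier denominator, and the formulas commute with ring morphisms: they are used for
    numbers, for polynomials in x and y, for the family over t, and along lines through a point. *)
Fixpoint orbit_frac n : (A * A) * (A * A) :=
  if n is m.+1 then
    let: ((p, q), (p', q')) := orbit_frac m in
    ((p', q'), ((a * q' + p') * q, q' * (b * q + p)))
  else ((x, 1), (y, 1)).

Definition num n := (orbit_frac n).1.1.
Definition den n := (orbit_frac n).1.2.
Definition fix1 n := x * den n - num n.
Definition fix2 n := y * den n.+1 - num n.+1.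

Lemma num0 : num 0 = x. Proof. by []. Qed.
Lemma num1 : num 1 = y. Proof. by []. Qed.
Lemma den0 : den 0 = 1. Proof. by []. Qed.
Lemma den1 : den 1 = 1. Proof. by []. Qed.

Lemma numSS n : num n.+2 = (a * den n.+1 + num n.+1) * den n.
Proof. by rewrite /num /den /=; case: (orbit_frac n) => [[p q] [p' q']]. Qed.

Lemma denSS n : den n.+2 = den n.+1 * (b * den n + num n).
Proof. by rewrite /num /den /=; case: (orbit_frac n) => [[p q] [p' q']]. Qed.

End OrbitFractions.

Lemma two_step_ind (P : nat -> Prop) : P 0%N -> P 1%N ->
  (forall n, P n -> P n.+1 -> P n.+2) -> forall n, P n.
Proof.
move=> P0 P1 PSS n; suff : P n /\ P n.+1 by case.
by elim: n => [//|n [IH IH']]; split => //; exact: PSS.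
Qed.

Section OrbitFractionsMorphism.
Variables (A B : comNzRingType) (phi : {rmorphism A -> B}) (a b x y : A).

Lemma num_den_morph n : num (phi a) (phi b) (phi x) (phi y) n = phi (num a b x y n) /\
  den (phi a) (phi b) (phi x) (phi y) n = phi (den a b x y n).
Proof.
elim/two_step_ind: n => [||n [IHn IHd] [IHn' IHd']]; rewrite ?num0 ?num1 ?den0 ?den1 ?rmorph1//.
by rewrite !numSS !denSS IHn IHd IHn' IHd' !(rmorphM, rmorphD).
Qed.

Lemma num_morph n : num (phi a) (phi b) (phi x) (phi y) n = phi (num a b x y n).
Proof. by case: (num_den_morph n). Qed.

Lemma den_morph n : den (phi a) (phi b) (phi x) (phi y) n = phi (den a b x y n).
Proof. by case: (num_den_morph n). Qed.

Lemma fix1_morph n : fix1 (phi a) (phi b) (phi x) (phi y) n = phi (fix1 a b x y n).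
Proof. by rewrite /fix1 !num_morph !den_morph rmorphB rmorphM. Qed.

Lemma fix2_morph n : fix2 (phi a) (phi b) (phi x) (phi y) n = phi (fix2 a b x y n).
Proof. by rewrite /fix2 !num_morph !den_morph rmorphB rmorphM. Qed.

End OrbitFractionsMorphism.

Section OrbitField.
Variable K : fieldType.
Variables a b : K.

Definition step (z : K * K) : K * K := (z.2, (a + z.2) / (b + z.1)).
Definition orb q n := (iter n step q).1.

Lemma iter_step q n : iter n step q = (orb q n, orb q n.+1).
Proof. by rewrite /orb /= -surjective_pairing. Qed.

Lemma orbSS q n : orb q n.+2 = (a + orb q n.+1) / (b + orb q n).
Proof. by []. Qed.

Lemma orb_rec q n : b + orb q n != 0 ->
  orb q n.+2 * (b + orb q n) = a + orb q n.+1.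
Proof. by move=> d0; rewrite orbSS divfK. Qed.

Lemma orb_add q m n : orb q (m + n) = orb (iter n step q) m.
Proof. by rewrite /orb iterD. Qed.

Lemma orb_period q n : iter n step q = q -> forall m, orb q (m + n) = orb q m.
Proof. by move=> qn m; rewrite orb_add qn. Qed.

Lemma orb_period_dom q n : (0 < n)%N -> iter n step q = q ->
  (forall j, (j < n)%N -> b + orb q j != 0) -> forall j, b + orb q j != 0.
Proof.
move=> n0 qn dom j; rewrite (divn_eq j n).
elim: (j %/ n)%N => [|k IH]; first by rewrite mul0n add0n dom// ltn_mod.
by rewrite mulSn -addnA addnC orb_period.
Qed.

Section Fractions.
Variables x y : K.
Let q := (x, y).

(** Rests on [den n.+2 = den n.+1 * den n * (b + orb n)], valid as long as [num] over [den]
    represents the orbit; both facts go through one induction. Terms up to index [n.+1] involve only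
    the divisions at j < n, whence the shift. *)
Lemma den_neq0P n : den a b x y n.+1 != 0 <-> forall j, (j < n)%N -> b + orb q j != 0.
Proof.
suff : (den a b x y n.+1 != 0 <-> forall j, (j < n)%N -> b + orb q j != 0) /\
   (den a b x y n.+1 != 0 -> forall j, (j <= n.+1)%N -> den a b x y j != 0 /\
     num a b x y j = orb q j * den a b x y j) by case.
elim: n => [|n [[IH1 IH1'] IH2]].
  split; first by split => // _; rewrite den1 oner_neq0.
  move=> _ [|[|//]] _; rewrite ?den0 ?den1 ?num0 ?num1 ?oner_neq0 ?mulr1//.
have ds : den a b x y n.+2 != 0 -> den a b x y n.+1 != 0.
  by rewrite denSS mulf_eq0 negb_or => /andP[].
have dE : den a b x y n.+1 != 0 ->
    den a b x y n.+2 = den a b x y n.+1 * den a b x y n * (b + orb q n).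
  by move=> /IH2/(_ n (leqnSn n))[d0 nE]; rewrite denSS nE; ring.
split; [split|].
- move=> d2; have d1 := ds d2; move: d2; rewrite dE// mulf_eq0 negb_or => /andP[_ bn] j.
  by rewrite ltnS leq_eqVlt => /predU1P[->//|]; exact: IH1.
- move=> dom; have d1 : den a b x y n.+1 != 0 by apply: IH1' => j jn; apply: dom; exact: ltnW.
  by rewrite dE// !mulf_neq0// ?dom// (IH2 d1 n (leqnSn n)).1.
- move=> d2 j; have d1 := ds d2; rewrite leq_eqVlt => /predU1P[->|]; last exact: IH2.
  split => //; rewrite dE// numSS orbSS.
  have [dn _] := IH2 d1 n (leqnSn n); have [_ ->] := IH2 d1 n.+1 (leqnn _).
  have bn : b + orb q n != 0.
    by move: d2; rewrite dE// mulf_eq0 negb_or => /andP[].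
  by field.
Qed.

Lemma num_orb n : den a b x y n.+1 != 0 -> forall j, (j <= n.+1)%N ->
  den a b x y j != 0 /\ num a b x y j = orb q j * den a b x y j.
Proof.
move=> dn j jn.
have dom := (den_neq0P n).1 dn.
have dj i : (i <= n)%N -> den a b x y i.+1 != 0.
  by move=> i_n; apply: (den_neq0P i).2 => k ki; apply: dom; exact: leq_trans ki i_n.
split; first by case: j jn => [|j] jn; [rewrite den0 oner_neq0|exact: dj].
elim/two_step_ind: j jn => [||j IH IH'] jn; rewrite ?num0 ?num1 ?den0 ?den1 ?mulr1//.
have bj : b + orb q j != 0 by apply: dom; lia.
rewrite numSS denSS IH' ?IH//; try lia.
by rewrite orbSS; field.
Qed.

Lemma fix_iff n : den a b x y n.+1 != 0 ->
  (fix1 a b x y n = 0 /\ fix2 a b x y n = 0) <-> iter n step q = q.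
Proof.
move=> dn; have [d0 nE] := num_orb dn (leqnSn n); have [d1 nE'] := num_orb dn (leqnn _).
rewrite /fix1 /fix2 nE nE' -!mulrBl iter_step; split.
  move=> [/eqP + /eqP]; rewrite !mulf_eq0 (negbTE d0) (negbTE d1) !orbF !subr_eq0.
  by move=> /eqP <- /eqP <-.
by move=> [-> ->]; rewrite !subrr !mul0r.
Qed.

End Fractions.
End OrbitField.

Section PolynomialOrbit.
Variables (K : closedFieldType) (a b : K).
Local Notation T := {poly {poly K}}.
Local Notation cst c := (c%:P%:P : T).

Definition pfix1 n : T := fix1 (cst a) (cst b) 'X%:P 'X n.
Definition pfix2 n : T := fix2 (cst a) (cst b) 'X%:P 'X n.
Definition pden n : T := den (cst a) (cst b) 'X%:P 'X n.

Lemma ev2_pfix1 x y n : ev2 x y (pfix1 n) = fix1 a b x y n.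
Proof. by rewrite /pfix1 -fix1_morph /= !ev2C ev2X !hornerE. Qed.

Lemma ev2_pfix2 x y n : ev2 x y (pfix2 n) = fix2 a b x y n.
Proof. by rewrite /pfix2 -fix2_morph /= !ev2C ev2X !hornerE. Qed.

Lemma ev2_pden x y n : ev2 x y (pden n) = den a b x y n.
Proof.
rewrite /pden -(den_morph (ev2 x y) (cst a) (cst b) 'X%:P 'X n).
by rewrite /= !ev2C ev2X !hornerE.
Qed.

(* Restricting to a line through (x, y) modulo the square of its parameter turns
   a kernel vector of the Jacobian into a periodic solution of the linearized
   recurrence. *)
Lemma simple_zero_of_linearized n x y : (0 < n)%N ->
  den a b x y n.+1 != 0 -> fix1 a b x y n = 0 -> fix2 a b x y n = 0 ->
  (forall ze : nat -> K,
    (forall k, ze k.+2 * (b + orb a b (x, y) k) + orb a b (x, y) k.+2 * ze k = ze k.+1) ->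
    (forall k, ze (k + n)%N = ze k) -> forall k, ze k = 0) ->
  simple_zero (pfix1 n) (pfix2 n) x y.
Proof.
move=> n0 dn f0 g0 lin al be ga de fE gE; apply/negP => /eqP det0.
set q := (x, y) in lin.
have qn : iter n (step a b) q = q by apply/(fix_iff dn).
have dom j : b + orb a b q j != 0.
  apply: (orb_period_dom n0 qn) => i; exact: (den_neq0P a b x y n).1.
move: det0; rewrite [LHS]/ev2 !(hornerM, hornerD, hornerN) -!/(ev2 x y _).
set al0 := ev2 x y al; set be0 := ev2 x y be; set ga0 := ev2 x y ga; set de0 := ev2 x y de => det0.
(* A kernel vector of the singular Jacobian; it gives the direction of the line. *)
have [xi [eta [nz k1 k2]]] : exists xi eta, [/\ (xi != 0) || (eta != 0),
    al0 * xi + be0 * eta = 0 & ga0 * xi + de0 * eta = 0].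
  have [/andP[/eqP a0 /eqP b0]|] := boolP ((al0 == 0) && (be0 == 0)).
    have [/andP[/eqP c0 /eqP d0]|] := boolP ((ga0 == 0) && (de0 == 0)).
      by exists 1, 0; rewrite oner_neq0 a0 b0 c0 d0 !mul0r addr0.
    rewrite negb_and => cd; exists de0, (- ga0); rewrite oppr_eq0 orbC cd a0 b0.
    by split => //; ring.
  rewrite negb_and => ab; exists be0, (- al0); rewrite oppr_eq0 orbC ab.
  by split => //; [ring|rewrite -[RHS]oppr0 -[in RHS]det0; ring].
pose X' : {poly K} := x%:P + xi%:P * 'X; pose Y' : {poly K} := y%:P + eta%:P * 'X.
pose phi : {rmorphism T -> {poly K}} :=
  [the {rmorphism T -> {poly K}} of horner_eval Y' \o map_poly (comp_poly X')].
have phiC c : phi (cst c) = c%:P.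
  by rewrite /phi /= map_polyC /= comp_polyC horner_evalE hornerC.
have phiX : phi 'X%:P = X'.
  by rewrite /phi /= map_polyC /= comp_polyX horner_evalE hornerC.
have phiY : phi 'X = Y' by rewrite /phi /= map_polyX horner_evalE hornerX.
have phi0 p : (phi p)`_0 = ev2 x y p.
  rewrite -horner_coef0 -[LHS]/(horner_eval 0 (phi p)).
  suff -> : horner_eval 0 (phi p) = (map_poly (horner_eval 0 \o comp_poly X') p).[y].
    rewrite -horner_fib; congr (_.[_]); apply: eq_map_poly => r /=.
    by rewrite !horner_evalE horner_comp /X' !hornerE.
  rewrite /phi /= horner_evalE map_poly_comp.
  have -> : y = horner_eval 0 Y' by rewrite horner_evalE /Y' !hornerE.
  by rewrite horner_map.
have linB (p : T) al' be' : p = ('X - x%:P)%:P * al' + ('X - cst y) * be' ->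
    ev2 x y al' * xi + ev2 x y be' * eta = 0 -> (phi p)`_1 = 0.
  move=> pE k; have -> : phi p = (xi%:P * phi al' + eta%:P * phi be') * 'X.
    rewrite pE polyCB rmorphD !rmorphM !rmorphB phiX phiY !phiC /X' /Y'.
    by ring.
  by rewrite coefMX coefD !coefCM !phi0 -[RHS]k; ring.
(* The solution of the linearized recurrence with initial values [xi], [eta]. *)
pose fix zz k : K * K := if k is m.+1 then
    let: (u, v) := zz m in (v, (v - orb a b q m.+2 * u) / (b + orb a b q m)) else (xi, eta).
pose ze k := (zz k).1.
have zeS k : zz k = (ze k, ze k.+1) by rewrite /ze /=; case: (zz k).
have zeSS k : ze k.+2 = (ze k.+1 - orb a b q k.+2 * ze k) / (b + orb a b q k).
  by rewrite {1}/ze /= zeS.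
have zeR k : ze k.+2 * (b + orb a b q k) + orb a b q k.+2 * ze k = ze k.+1.
  by rewrite zeSS divfK ?subrK.
pose Z k : {poly K} := (orb a b q k)%:P + (ze k)%:P * 'X.
pose N := num a%:P b%:P X' Y'; pose Dn := den a%:P b%:P X' Y'.
(* Along the line, the k-th term of the orbit is [Z k] modulo the square of the parameter; the
   identity is written without division, inside [{poly K}]. *)
have ND k : exists r, N k = Z k * Dn k + 'X ^+ 2 * r.
  elim/two_step_ind: k => [||k [r0 E0] [r1 E1]].
  - by exists 0; rewrite /N /Dn num0 den0 mulr0 addr0 mulr1.
  - by exists 0; rewrite /N /Dn num1 den1 mulr0 addr0 mulr1.
  have zE : (a%:P + Z k.+1) - Z k.+2 * (b%:P + Z k) = - (ze k.+2 * ze k)%:P * 'X ^+ 2.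
    have e1 : (ze k.+2)%:P * (b%:P + (orb a b q k)%:P) + (orb a b q k.+2)%:P * (ze k)%:P
        = (ze k.+1)%:P by rewrite -polyCD -!polyCM -polyCD zeR.
    have e2 : (orb a b q k.+2)%:P * (b%:P + (orb a b q k)%:P) = a%:P + (orb a b q k.+1)%:P.
      by rewrite -!polyCD -polyCM orb_rec.
    have -> : a%:P + Z k.+1 = (orb a b q k.+2)%:P * (b%:P + (orb a b q k)%:P) +
        ((ze k.+2)%:P * (b%:P + (orb a b q k)%:P) + (orb a b q k.+2)%:P * (ze k)%:P) * 'X.
      by rewrite e1 e2 /Z addrA.
    by rewrite /Z (polyCM (ze k.+2)); ring.
  exists (Dn k.+1 * Dn k * - (ze k.+2 * ze k)%:P + r1 * Dn k - Z k.+2 * Dn k.+1 * r0).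
  rewrite /N /Dn numSS denSS -/N -/Dn E1 E0.
  transitivity (Dn k.+1 * Dn k * (a%:P + Z k.+1 - Z k.+2 * (b%:P + Z k)) +
     Z k.+2 * (Dn k.+1 * (b%:P * Dn k + (Z k * Dn k + 'X ^+ 2 * r0))) +
     'X ^+ 2 * (r1 * Dn k - Z k.+2 * Dn k.+1 * r0)); first by ring.
  by rewrite zE; ring.
have D0 k : (Dn k)`_0 = den a b x y k.
  rewrite -horner_coef0 -[LHS]/(horner_eval 0 (Dn k)) /Dn -(den_morph (horner_eval 0) _ _ _ _ k).
  by rewrite /= !horner_evalE /X' /Y' !hornerE.
have per1 k m : (Z k * Dn m - N m)`_1 = 0 -> orb a b q m = orb a b q k ->
    den a b x y m != 0 -> ze m = ze k.
  have [r ->] := ND m; move=> e oE dm.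
  have : (Z k * Dn m - (Z m * Dn m + 'X^2 * r))`_1 = (ze k - ze m) * (Dn m)`_0.
    rewrite (_ : _ - _ = (ze k - ze m)%:P * (Dn m * 'X) - r * 'X^2).
      by rewrite coefB coefCM coefMX coefMXn /= subr0.
    by rewrite /Z oE polyCB; ring.
  rewrite e D0 => /esym/eqP; rewrite mulf_eq0 (negbTE dm) orbF subr_eq0.
  by move/eqP.
have [u0 u1] : orb a b q n = x /\ orb a b q n.+1 = y.
  by move: qn; rewrite iter_step => -[-> ->].
have ze0 : ze n = ze 0%N.
  apply: per1 => //; last by have [] := num_orb dn (leqnSn n).
  transitivity (phi (pfix1 n))`_1; last exact: linB fE k1.
  by rewrite /pfix1 -fix1_morph !phiC phiX phiY.
have ze1 : ze n.+1 = ze 1%N.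
  apply: per1 => //.
  transitivity (phi (pfix2 n))`_1; last exact: linB gE k2.
  by rewrite /pfix2 -fix2_morph !phiC phiX phiY.
have per k : ze (k + n)%N = ze k.
  elim/two_step_ind: k => [||k IH IH']; rewrite ?add0n ?add1n//.
  by rewrite !addSn !zeSS -!addSn IH IH' -[in RHS](orb_period qn) -[in RHS](orb_period qn k).
have z := lin ze zeR per; move: nz.
by rewrite -[xi]/(ze 0%N) -[eta]/(ze 1%N) !z eqxx.
Qed.

End PolynomialOrbit.

(** * Norm and convergence in the complex plane *)

Section ComplexNorm.
Local Open Scope complex_scope.
Variable R : realType.
Implicit Types x y z : R[i].

(** [|z|] is an element of R[i]; the real-valued version makes the estimates accessible to real
    arithmetic. *)
Definition nm z : R := Normc.normc z.

Lemma normE z : `|z| = (nm z)%:C. Proof. by []. Qed.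
Lemma nmM x y : nm (x * y) = nm x * nm y. Proof. exact: Normc.normcM. Qed.
Lemma nmD x y : nm (x + y) <= nm x + nm y. Proof. exact: le_normcD. Qed.
Lemma nmN x : nm (- x) = nm x. Proof. exact: normcN. Qed.
Lemma nm0 : nm 0 = 0. Proof. exact: Normc.normc0. Qed.
Lemma nm1 : nm 1 = 1. Proof. exact: Normc.normc1. Qed.
Lemma nmV x : nm x^-1 = (nm x)^-1. Proof. exact: Normc.normcV. Qed.
Lemma nm_ge0 x : 0 <= nm x. Proof. by rewrite -lecR -normE normr_ge0. Qed.
Lemma nmB x y : nm (x - y) <= nm x + nm y. Proof. by rewrite -(nmN y); exact: nmD. Qed.
Lemma nmX x n : nm (x ^+ n) = nm x ^+ n.
Proof. by elim: n => [|n IH]; rewrite ?nm1// !exprS nmM IH. Qed.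

Lemma nm_eq0 x : (nm x == 0) = (x == 0).
Proof. by apply/eqP/eqP => [/Normc.eq0_normc//|->]; rewrite nm0. Qed.

Lemma nm_gt0 x : (0 < nm x) = (x != 0).
Proof. by rewrite lt_def nm_ge0 andbT nm_eq0. Qed.

Lemma nm_real (r : R) : nm r%:C = `|r|.
Proof. by rewrite /nm /= expr0n /= addr0 sqrtr_sqr. Qed.

Lemma nm_distC x y : nm (x - y) = nm (y - x).
Proof. by rewrite -nmN opprB. Qed.

Lemma nm_geB x y : nm x - nm y <= nm (x - y).
Proof. by rewrite lerBlDr -{1}(subrK y x); exact: nmD. Qed.

Lemma nm_geD x y : nm x - nm y <= nm (x + y).
Proof. by rewrite -[y in x + y]opprK -(nmN y); exact: nm_geB. Qed.

Lemma nm_geDr x y : nm x - nm y <= nm (y + x).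
Proof. by rewrite [y + x]addrC; exact: nm_geD. Qed.

Lemma nm_Re x : `|complex.Re x| <= nm x.
Proof. by rewrite -lecR -normE; exact: normc_ge_Re. Qed.

Lemma nm_Im x : `|complex.Im x| <= nm x.
Proof.
case: x => u v; rewrite /nm /= -sqrtr_sqr ler_wsqrtr// lerDr.
exact: sqr_ge0.
Qed.

Lemma nm_le_ReIm x : nm x <= `|complex.Re x| + `|complex.Im x|.
Proof.
rewrite [x]complexE; apply: le_trans (nmD _ _) _; rewrite nmM !nm_real.
rewrite -[X in X * _]/(Num.sqrt (0 ^+ 2 + 1 ^+ 2)) expr0n add0r expr1n sqrtr1 mul1r.
by case: x => u v /=; rewrite !(mul0r, mulr0, mul1r, subr0, addr0, add0r).
Qed.

(** Both A + y and A - y are non-decreasing and bounded, so y converges as half their difference.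
    The increments of A stand for a geometric bound in one use and for partial sums of absolute
    values in the other. *)
Lemma real_bounded_variation_cvg (y A : nat -> R) :
  (forall m, `|y m.+1 - y m| <= A m.+1 - A m) -> (exists U, forall m, A m <= U) ->
  exists l, forall U, (forall m, A m <= U) -> forall m, `|y m - l| <= U - A m.
Proof.
move=> yA [U0 AU0].
have dist m k : `|y (m + k)%N - y m| <= A (m + k)%N - A m.
  elim: k => [|k IH]; first by rewrite addn0 !subrr normr0.
  rewrite addnS; apply: le_trans (ler_distD (y (m + k)%N) _ _) _.
  by have := yA (m + k)%N; lra.
have mono (s : R) : s ^+ 2 = 1 -> cvgn (fun m => A m + s * y m).
  move=> s1; have s1' : `|s| = 1.
    by apply/eqP; rewrite -sqrp_eq1 ?normr_ge0// -normrX s1 normr1.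
  apply: nondecreasing_is_cvgn.
    apply/nondecreasing_seqP => m; rewrite -subr_ge0.
    have : `|s * (y m.+1 - y m)| <= A m.+1 - A m by rewrite normrM s1' mul1r.
    by rewrite ler_norml => /andP[]; lra.
  exists (U0 + (`|y 0%N| + (U0 - A 0%N))) => _ [m _ <-].
  have := dist 0%N m; rewrite add0n => d.
  have : s * y m <= `|y 0%N| + (U0 - A 0%N).
    apply: le_trans (ler_norm _) _; rewrite normrM s1' mul1r.
    have -> : y m = y 0%N + (y m - y 0%N) by ring.
    by apply: le_trans (ler_normD _ _) _; rewrite lerD2l (le_trans d)// lerD2r.
  by have := AU0 m; lra.
have cy : cvgn y.
  have -> : y = (fun m => ((A m + 1 * y m) - (A m + -1 * y m)) * 2^-1).
    by apply/funext => m; field.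
  by apply: is_cvgMl; apply: is_cvgB; apply: mono; ring.
exists (limn y) => U AU m; rewrite ler_distl; apply/andP; split.
  rewrite lerBlDr; have : limn y <= y m + (U - A m); last by lra.
  apply: limr_le => //; exists m => // k /= mk.
  have := dist m (k - m)%N; rewrite subnKC// ler_norml => /andP[_].
  by have := AU k; lra.
have : y m - (U - A m) <= limn y; last by lra.
apply: limr_ge => //; exists m => // k /= mk.
have := dist m (k - m)%N; rewrite subnKC// ler_norml => /andP[].
by have := AU k; lra.
Qed.

Lemma bounded_variation_cvg (x : nat -> R[i]) (A : nat -> R) :
  (forall m, nm (x m.+1 - x m) <= A m.+1 - A m) -> (exists U, forall m, A m <= U) ->
  exists l, forall U, (forall m, A m <= U) -> forall m, nm (x m - l) <= 2 * (U - A m).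
Proof.
move=> xA bA.
have [|re reP] := @real_bounded_variation_cvg (fun m => complex.Re (x m)) A _ bA.
  by move=> m; apply: le_trans (xA m); rewrite -raddfB; exact: nm_Re.
have [|im imP] := @real_bounded_variation_cvg (fun m => complex.Im (x m)) A _ bA.
  by move=> m; apply: le_trans (xA m); rewrite -raddfB; exact: nm_Im.
exists (re +i* im)%C => U AU m; apply: le_trans (nm_le_ReIm _) _.
have := reP U AU m; have := imP U AU m.
by case: (x m) => u v /=; lra.
Qed.

Lemma le_geometric0 (u c : R) : (forall m, u <= c / 2 ^+ m) -> u <= 0.
Proof.
move=> uc; rewrite leNgt; apply/negP => u0.
have c0 : 0 < c by have := uc 0%N; rewrite expr0 divr1; exact: lt_le_trans.
have [m mP] : exists m : nat, c / u < m%:R.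
  by exists (Num.Def.archi_bound (c / u)); apply: archi_boundP; rewrite divr_ge0 ?ltW.
have := uc m; rewrite ler_pdivlMr ?exprn_gt0//.
apply/negP; rewrite -ltNge mulrC -ltr_pdivrMr//.
apply: lt_le_trans mP _; rewrite -natrX ler_nat ltnW//; exact: ltn_expl.
Qed.

Lemma geometric_cvg (x : nat -> R[i]) (c : R) :
  (forall m, nm (x m.+1 - x m) <= c / 2 ^+ m) ->
  exists l, forall m, nm (x m - l) <= 4 * c / 2 ^+ m.
Proof.
move=> xc.
have c0 : 0 <= c by have := xc 0%N; rewrite expr0 divr1; apply: le_trans; exact: nm_ge0.
have [m||l lP] := @bounded_variation_cvg x (fun m => 2 * c - 2 * c / 2 ^+ m).
- apply: le_trans (xc m) _; rewrite exprS.
  have h : (2 : R) ^+ m != 0 by rewrite expf_neq0.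
  rewrite le_eqVlt; apply/orP; left; apply/eqP; field.
  by rewrite h.
- by exists (2 * c) => m; rewrite gerBl divr_ge0 ?exprn_ge0// mulr_ge0.
exists l => m; have := lP (2 * c); rewrite -mulrA.
move=> /(_ _ m) h; apply: le_trans (h _) _.
  by move=> k; rewrite gerBl divr_ge0 ?exprn_ge0// mulr_ge0.
by rewrite opprB addrCA subrr addr0; lra.
Qed.

End ComplexNorm.

Arguments nm {R} z : simpl never.

(** * Periodic orbits for large |b| *)

(* Along a periodic orbit with |b| large every coordinate is of moderate size
   ([Small0], [Small]), close to -b ([Big0], [Big]), or of order b^2 ([Huge]).
   [Small0] and [Big0] occur only in the two constant itineraries, which belong
   to the two fixed points. *)
Variant coord_type := Small0 | Big0 | Big | Small | Huge.

Definition coord_code t : nat :=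
  match t with Small0 => 0 | Big0 => 1 | Big => 2 | Small => 3 | Huge => 4 end.
Definition coord_decode n : option coord_type :=
  match n with 0 => Some Small0 | 1 => Some Big0 | 2 => Some Big | 3 => Some Small
  | 4 => Some Huge | _ => None end.
Lemma coord_codeK : pcancel coord_code coord_decode. Proof. by case. Qed.
HB.instance Definition _ := Equality.copy coord_type (pcan_type coord_codeK).

(** When z is close to -b and z' is moderate, numerator and denominator of (a + z') / (b + z) are
    both bounded and the size of the quotient is free: this is the only branching, after [Small]. *)
Definition follows (s t : coord_type) : bool :=
  match s, t with
  | Small0, Small0 | Big0, Big0 | Big, Small | Small, Big | Small, Huge | Huge, Big => true
  | _, _ => false
  end.

Section Periodic.
Variable n : nat.
Hypothesis n_gt0 : (0 < n)%N.

Definition periodic (T : Type) (z : nat -> T) := forall k, z (k + n)%N = z k.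

Lemma periodicM (T : Type) (z : nat -> T) : periodic z -> forall m k, z (k + m * n)%N = z k.
Proof.
move=> pz; elim=> [|m IH] k; first by rewrite mul0n addn0.
by rewrite mulSn addnCA addnA [(n + k)%N]addnC IH pz.
Qed.

(** Moving k by 2n gives every index two predecessors, so a property of a coordinate may be derived
    from the two preceding ones. *)
Lemma periodic_shift2 (T : Type) (z : nat -> T) (P : nat -> T -> Prop) :
  periodic z -> (forall k t, P (k + n)%N t -> P k t) ->
  (forall k, P k.+2 (z k.+2)) -> forall k, P k (z k).
Proof.
move=> pz Pn Pz k; rewrite -(periodicM pz 2); apply: (Pn); apply: (Pn).
have -> : (k + n + n = k + 2 * n)%N by lia.
have -> : (k + 2 * n = (k + 2 * n - 2).+2)%N by lia.
exact: Pz.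
Qed.

Lemma pred_shift (T : Type) (z : nat -> T) k : periodic z ->
  (z (k.+2 + n).-1 = z k.+1) * (z (k.+2 + 2 * n - 2)%N = z k).
Proof.
move=> pz; split; first by rewrite -(pz k.+1); congr z; lia.
by rewrite -(periodicM pz 2 k); congr z; lia.
Qed.

End Periodic.

(** * The contraction attached to an itinerary *)

Section LargeB.
Variable R : realType.
Variables (a b : R[i]) (n : nat).
Hypothesis n_gt0 : (0 < n)%N.
Local Notation al := (nm a).
Local Notation be := (nm b).
Hypothesis b_large : 100 * (al + 1) <= be.

Let al_ge0 : 0 <= al. Proof. exact: nm_ge0. Qed.
Let be_ge100 : 100 <= be. Proof. by have := al_ge0; have := b_large; lra. Qed.

Definition itinerary (w : nat -> coord_type) :=
  periodic n w /\ forall k, follows (w k) (w k.+1).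

(** The threshold [al + 1] is the one of [exists_big]: an orbit exceeding it has a coordinate near
    -b. The quantities bounded by 2 and 3 are close to 0, 1 or -1 for large |b|, which leaves a
    margin. *)
Definition in_region (t : coord_type) (z : R[i]) : Prop :=
  match t with
  | Small0 => nm z <= al + 1
  | Big0 | Big => nm (b + z) <= 2
  | Small => nm z <= 3
  | Huge => be ^+ 2 / 2 <= nm z
  end.

Definition fits (w : nat -> coord_type) (z : nat -> R[i]) :=
  forall k, in_region (w k) (z k).

(** The weights of a sup norm. Solving for a huge coordinate loses a factor of about 2 |b|, so a
    weight somewhat above 4 |b| permits halving; 6 |b| is still small against the divisors of about
    50 |b| that huge coordinates supply. *)
Definition weight (t : coord_type) : R := if t is Huge then 6 * be else 1.

(* The three-term relation with centre k+1 is solved for the coordinate which it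
   determines in a contracting way. *)
Definition linked (w : nat -> coord_type) (z v' ze ze' : nat -> R[i]) (z' v : nat -> R[i]) :=
  forall k, match w k.+1 with
  | Small0 | Big => ze' k.+2 * (b + z k) + v' k.+2 * ze k = ze k.+1
  | Big0 | Small => ze k.+2 * (b + z' k) + v k.+2 * ze' k = ze k.+1
  | Huge => ze k.+2 * (b + z k) + v k.+2 * ze k = ze' k.+1
  end.

Lemma big_lower z : nm (b + z) <= 2 -> be - 2 <= nm z.
Proof. by have := nm_geD b z; lra. Qed.

Lemma big_upper z : nm (b + z) <= 2 -> nm z <= be + 2.
Proof. by have := nmB (b + z) b; rewrite addrC addKr; lra. Qed.

Lemma solve_bound (u x y c d : R[i]) (X Y r : R) :
  u * x + y * c = d -> 0 < X -> X <= nm x -> nm d + nm y * nm c <= Y -> Y <= r * X ->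
  nm u <= r.
Proof.
move=> e X0 Xx dY Yr; rewrite -(ler_pM2r X0).
apply: le_trans Yr; apply: le_trans dY; apply: le_trans (_ : nm u * nm x <= _).
  by rewrite ler_wpM2l// nm_ge0.
by rewrite -nmM -nmM -[u * x](addrK (y * c)) e; exact: nmB.
Qed.

Lemma nm_mul_le x y (r s : R) : nm x <= r -> nm y <= s -> nm x * nm y <= r * s.
Proof. by move=> xr ys; rewrite ler_pM ?nm_ge0. Qed.

Let huge_ge : 50 * be <= be ^+ 2 / 2.
Proof. by have := be_ge100; nra. Qed.

(** In each relation the wanted coordinate carries a large factor, except for [Huge], where the
    weight pays for the loss. Input and output are kept apart so that the estimate applies to linear
    equations, to differences of solutions and to successive iterates alike. *)
Lemma contraction w z z' v v' ze ze' d : itinerary w ->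
  fits w z -> fits w z' -> fits w v -> fits w v' -> periodic n ze' ->
  linked w z v' ze ze' z' v -> (forall k, nm (ze k) <= weight (w k) * d) ->
  forall k, nm (ze' k) <= weight (w k) * (d / 2).
Proof.
move=> [pw ew] fz fz' fv fv' pze' lk bd.
have d0 : 0 <= d.
  have := bd 0%N; have := nm_ge0 (ze 0%N); rewrite /weight.
  by have := be_ge100; case: (w 0%N) => *; nra.
apply: (@periodic_shift2 _ n_gt0 _ ze' (fun k t => nm t <= weight (w k) * (d / 2)) pze') => [k
  t|k]; first by rewrite pw.
case wk : (w k.+2).
- have := ew k.+1; rewrite wk; case wk1 : (w k.+1) => // _.
  have := ew k; rewrite wk1; case wk0 : (w k) => // _.
  have := lk k; rewrite wk1 => /solve_bound h; apply: (h (be - (al + 1))).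
  + by have := al_ge0; have := b_large; lra.
  + have := fz k; rewrite wk0 /=; have := nm_geD b (z k); lra.
  + have := bd k.+1; have := bd k; rewrite wk0 wk1 /weight => h0 h1.
    have := fv' k.+2; rewrite wk /= => h2.
    by apply: lerD h1 (nm_mul_le h2 h0).
  + by rewrite /weight; have := al_ge0; have := b_large; nra.
- have := ew k.+2; rewrite wk; case wk1 : (w k.+3) => // _.
  have := ew k.+3; rewrite wk1; case wk2 : (w k.+4) => // _.
  have := lk k.+2; rewrite wk1 addrC [v _ * _]mulrC => /solve_bound h; apply: (h (be - 2)).
  + by have := be_ge100; lra.
  + by have := fv k.+4; rewrite wk2 /= => /big_lower.
  + have := bd k.+3; have := bd k.+4; rewrite wk1 wk2 /weight => h0 h1.
    have := fz' k.+2; rewrite wk /= => h2.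
    by apply: lerD h1 (nm_mul_le h0 h2).
  + by rewrite /weight; have := be_ge100; nra.
- have := ew k.+2; rewrite wk; case wk1 : (w k.+3) => // _.
  have := lk k.+2; rewrite wk1 addrC [v _ * _]mulrC => /solve_bound h.
  have := fz' k.+2; rewrite wk /= => h2.
  have := ew k.+3; rewrite wk1; case wk2 : (w k.+4) => // _.
  + apply: (h (be - 2)).
    * by have := be_ge100; lra.
    * by have := fv k.+4; rewrite wk2 /= => /big_lower.
    * have := bd k.+3; have := bd k.+4; rewrite wk1 wk2 /weight => h0 h1.
      by apply: lerD h1 (nm_mul_le h0 h2).
    * by rewrite /weight; have := be_ge100; nra.
  + apply: (h (50 * be)).
    * by have := be_ge100; lra.
    * by apply: le_trans huge_ge _; have := fv k.+4; rewrite wk2.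
    * have := bd k.+3; have := bd k.+4; rewrite wk1 wk2 /weight => h0 h1.
      by apply: lerD h1 (nm_mul_le h0 h2).
    * by rewrite /weight; have := be_ge100; nra.
- have := ew k.+1; rewrite wk; case wk1 : (w k.+1) => // _.
  have := lk k; rewrite wk1 => /solve_bound h.
  have := fv' k.+2; rewrite wk /= => h2.
  have := ew k; rewrite wk1; case wk0 : (w k) => // _.
  + apply: (h (be - 3)).
    * by have := be_ge100; lra.
    * have := fz k; rewrite wk0 /=; have := nm_geD b (z k); lra.
    * have := bd k.+1; have := bd k; rewrite wk0 wk1 /weight => h0 h1.
      by apply: lerD h1 (nm_mul_le h2 h0).
    * by rewrite /weight; have := be_ge100; nra.
  + apply: (h (49 * be)).
    * by have := be_ge100; lra.
    * have := fz k; rewrite wk0 /=; have := nm_geDr (z k) b.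
      by have := huge_ge; lra.
    * have := bd k.+1; have := bd k; rewrite wk0 wk1 /weight => h0 h1.
      by apply: lerD h1 (nm_mul_le h2 h0).
    * by rewrite /weight; have := be_ge100; nra.
- have := ew k.+1; rewrite wk; case wk1 : (w k.+1) => // _.
  have := ew k.+2; rewrite wk; case wk3 : (w k.+3) => // _.
  have := lk k.+1; rewrite wk => <-.
  apply: le_trans (nmD _ _) _; rewrite !nmM.
  have := bd k.+3; have := bd k.+1; rewrite wk1 wk3 /weight => h1 h3.
  have hz : nm (b + z k.+1) <= be + 3.
    have := fz k.+1; rewrite wk1 /=; have := nmD b (z k.+1); lra.
  have hv : nm (v k.+3) <= be + 2 by have := fv k.+3; rewrite wk3 /= => /big_upper.
  apply: le_trans (lerD (nm_mul_le h3 hz) (nm_mul_le hv h1)) _.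
  by rewrite /weight; have := be_ge100; nra.
Qed.

Definition solution (z : nat -> R[i]) :=
  forall k, z k.+2 * (b + z k) = a + z k.+1.

Lemma weighted_bound (ze : nat -> R[i]) w : periodic n ze -> periodic n w ->
  exists2 c, 0 <= c & forall k, nm (ze k) <= weight (w k) * c.
Proof.
move=> pz pw; exists (\sum_(i < n) nm (ze i)); first by apply: sumr_ge0 => i _; exact: nm_ge0.
move=> k; rewrite (divn_eq k n) addnC !(periodicM pz, periodicM pw).
have kn : (k %% n < n)%N by rewrite ltn_mod.
apply: le_trans (_ : \sum_(i < n) nm (ze i) <= _).
  rewrite (bigD1 (Ordinal kn))//= lerDl; apply: sumr_ge0 => i _; exact: nm_ge0.
rewrite ler_peMl ?sumr_ge0// => [i _|]; first exact: nm_ge0.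
by rewrite /weight; case: (w _) => //; have := be_ge100; lra.
Qed.

(** A periodic solution is its own image under the contraction, so its bound can be halved
    indefinitely. For z = v the equation is the linearized recurrence; for two solutions z and v it
    is satisfied by their difference. *)
Lemma linear_solution_eq0 w z v ze : itinerary w -> fits w z -> fits w v ->
  periodic n ze -> (forall k, ze k.+2 * (b + z k) + v k.+2 * ze k = ze k.+1) ->
  forall k, ze k = 0.
Proof.
move=> iw fz fv pze lin k; have [c c0 bd] := weighted_bound pze iw.1.
have lk : linked w z v ze ze z v by move=> j; case: (w _) => //; exact: lin.
have {}bd m : forall k, nm (ze k) <= weight (w k) * (c / 2 ^+ m).
  elim: m => [|m IH]; first by rewrite expr0 divr1.
  have -> : c / 2 ^+ m.+1 = (c / 2 ^+ m) / 2 by rewrite exprSr invfM mulrA.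
  exact: contraction lk IH.
apply/eqP; rewrite -nm_eq0 eq_le nm_ge0 andbT.
by apply: (@le_geometric0 _ _ (weight (w k) * c)) => m; rewrite -mulrA.
Qed.

Lemma solution_unique w z v : itinerary w -> fits w z -> fits w v ->
  periodic n z -> periodic n v -> solution z -> solution v -> z =1 v.
Proof.
move=> iw fz fv pz pv sz sv k; apply/eqP; rewrite -subr_eq0; apply/eqP.
apply: (@linear_solution_eq0 w z v (fun k => z k - v k)) => // [j|j].
  by rewrite pz pv.
transitivity (z j.+2 * (b + z j) - v j.+2 * (b + v j)); first by ring.
by rewrite sz sv; ring.
Qed.

(** Each coordinate is recomputed from the relation that determines it well: from the preceding two
    for [Small], the following two for [Big], its neighbours for [Huge]. The indices [(k + n).-1]
    and [k + 2 * n - 2] stand for k - 1 and k - 2 modulo the period. *)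
Definition update (w : nat -> coord_type) (z : nat -> R[i]) k : R[i] :=
  match w k with
  | Small0 | Small => (a + z (k + n).-1) / (b + z (k + 2 * n - 2)%N)
  | Big0 | Big => (a + z k.+1) / z k.+2 - b
  | Huge => z k.+1 * (b + z (k + n).-1) - a
  end.

Lemma update_periodic w z : periodic n w -> periodic n z -> periodic n (update w z).
Proof.
move=> pw pz k; rewrite /update pw.
have -> : z (k + n + n).-1 = z (k + n).-1 by rewrite -(pz (k + n).-1); congr z; lia.
have -> : z (k + n + 2 * n - 2)%N = z (k + 2 * n - 2)%N.
  by rewrite -(pz (k + 2 * n - 2)%N); congr z; lia.
by rewrite -!addSn !pz.
Qed.

Lemma nm_div_le (x y : R[i]) (X r : R) : 0 < X -> X <= nm y -> nm x <= r * X -> nm (x / y) <= r.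
Proof.
move=> X0 Xy xr; have y0 : 0 < nm y := lt_le_trans X0 Xy.
have r0 : 0 <= r by rewrite -(pmulr_lge0 _ X0); exact: le_trans (nm_ge0 x) xr.
by rewrite nmM nmV ler_pdivrMr//; apply: le_trans xr _; rewrite ler_wpM2l.
Qed.

Lemma update_fits w z : itinerary w -> periodic n z -> fits w z -> fits w (update w z).
Proof.
move=> [pw ew] pz fz; have pu := update_periodic pw pz.
apply: (@periodic_shift2 _ n_gt0 _ _ (fun k t => in_region (w k) t) pu) => [k t|k];
  first by rewrite pw.
rewrite /update; case wk : (w k.+2).
- have := ew k.+1; rewrite wk; case wk1 : (w k.+1) => // _.
  have := ew k; rewrite wk1; case wk0 : (w k) => // _.
  rewrite !(pred_shift n_gt0 _ pz)//=; apply: (@nm_div_le _ _ (be - (al + 1))).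
  + by have := al_ge0; have := b_large; lra.
  + have := fz k; rewrite wk0 /=; have := nm_geD b (z k); lra.
  + have := fz k.+1; rewrite wk1 /=; have := nmD a (z k.+1).
    by have := al_ge0; have := b_large; nra.
- have := ew k.+2; rewrite wk; case wk1 : (w k.+3) => // _.
  have := ew k.+3; rewrite wk1; case wk2 : (w k.+4) => // _.
  rewrite /= addrC subrK; apply: (@nm_div_le _ _ (be - 2)).
  + by have := be_ge100; lra.
  + by have := fz k.+4; rewrite wk2 /= => /big_lower.
  + have := fz k.+3; rewrite wk1 /= => /big_upper; have := nmD a (z k.+3).
    by have := al_ge0; have := b_large; lra.
- have := ew k.+2; rewrite wk; case wk1 : (w k.+3) => // _.
  have h : nm (a + z k.+3) <= al + 3.
    by have := fz k.+3; rewrite wk1 /=; have := nmD a (z k.+3); lra.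
  have := ew k.+3; rewrite wk1 /= addrC subrK; case wk2 : (w k.+4) => // _.
  + apply: (@nm_div_le _ _ (be - 2)).
    * by have := be_ge100; lra.
    * by have := fz k.+4; rewrite wk2 /= => /big_lower.
    * by have := al_ge0; have := b_large; lra.
  + apply: (@nm_div_le _ _ (50 * be)).
    * by have := be_ge100; lra.
    * by apply: le_trans huge_ge _; have := fz k.+4; rewrite wk2.
    * by have := al_ge0; have := b_large; lra.
- have := ew k.+1; rewrite wk; case wk1 : (w k.+1) => // _.
  rewrite !(pred_shift n_gt0 _ pz)//=.
  have h : nm (a + z k.+1) <= al + be + 2.
    by have := fz k.+1; rewrite wk1 /= => /big_upper; have := nmD a (z k.+1); lra.
  have := ew k; rewrite wk1; case wk0 : (w k) => // _.
  + apply: (@nm_div_le _ _ (be - 3)).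
    * by have := be_ge100; lra.
    * by have := fz k; rewrite wk0 /=; have := nm_geD b (z k); lra.
    * by have := al_ge0; have := b_large; lra.
  + apply: (@nm_div_le _ _ (49 * be)).
    * by have := be_ge100; lra.
    * have := fz k; rewrite wk0 /=; have := nm_geDr (z k) b.
      by have := huge_ge; lra.
    * by have := al_ge0; have := b_large; lra.
- have := ew k.+1; rewrite wk; case wk1 : (w k.+1) => // _.
  have := ew k.+2; rewrite wk; case wk3 : (w k.+3) => // _.
  rewrite (pred_shift n_gt0 _ pz)//=; apply: le_trans (nm_geB _ _); rewrite nmM.
  have h1 : be - 3 <= nm (b + z k.+1).
    by have := fz k.+1; rewrite wk1 /=; have := nm_geD b (z k.+1); lra.
  have h3 : be - 2 <= nm (z k.+3) by have := fz k.+3; rewrite wk3 /= => /big_lower.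
  have : (be - 2) * (be - 3) <= nm (z k.+3) * nm (b + z k.+1).
    by apply: ler_pM => //; have := be_ge100; lra.
  by have := al_ge0; have := b_large; have := be_ge100; nra.
Qed.

(** A difference of products splits as [u * x - u' * x' = (u - u') * x + u' * (x - x')]; this is why
    [linked] mixes old and new sequences. *)
Lemma update_linked w z v : itinerary w -> periodic n z -> periodic n v -> fits w z -> fits w v ->
  linked w z (update w v) (fun k => z k - v k) (fun k => update w z k - update w v k)
    (update w z) v.
Proof.
move=> [pw ew] pz pv fz fv k.
have nzbig u : nm (b + u) <= 2 -> u != 0.
  by move=> /big_lower h; rewrite -nm_gt0; have := be_ge100; lra.
have nzhuge u : be ^+ 2 / 2 <= nm u -> u != 0 /\ b + u != 0.
  move=> h; rewrite -!nm_gt0; have := nm_geDr u b.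
  by have := huge_ge; have := be_ge100; split; lra.
have nzsmall u : nm u <= 3 -> b + u != 0.
  by rewrite -nm_gt0 => h; have := nm_geD b u; have := be_ge100; lra.
have nzsmall0 u : nm u <= al + 1 -> b + u != 0.
  by rewrite -nm_gt0 => h; have := nm_geD b u; have := al_ge0; have := b_large; lra.
have e0 := ew k; have e1 := ew k.+1.
have hz0 := fz k; have hv0 := fv k; have hz2 := fz k.+2; have hv2 := fv k.+2.
case wk1 : (w k.+1) e0 e1 => //; case wk0 : (w k) hz0 hv0 => // hz0 hv0 _;
  case wk2 : (w k.+2) hz2 hv2 => // hz2 hv2 _;
  rewrite /update ?wk0 ?wk1 ?wk2 ?(pred_shift n_gt0 _ pz) ?(pred_shift n_gt0 _ pv) /=.
- by have := nzsmall0 _ hz0; have := nzsmall0 _ hv0 => h1 h2; field; rewrite h1 h2.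
- by have := nzbig _ hz2; have := nzbig _ hv2 => h1 h2; field; rewrite h1 h2.
- by have := nzsmall _ hz0; have := nzsmall _ hv0 => h1 h2; field; rewrite h1 h2.
- by have [_ h1] := nzhuge _ hz0; have [_ h2] := nzhuge _ hv0; field; rewrite h1 h2.
- by have := nzbig _ hz2; have := nzbig _ hv2 => h1 h2; field; rewrite h1 h2.
- by have [h1 _] := nzhuge _ hz2; have [h2 _] := nzhuge _ hv2; field; rewrite h1 h2.
- have sh (u : nat -> R[i]) : periodic n u -> u (k.+1 + n).-1 = u k by move=> pu;
  rewrite -(pu k); congr u; lia.
  by rewrite !sh//; ring.
Qed.

Lemma update_fixed_solution w z : itinerary w -> periodic n z -> fits w z ->
  update w z =1 z -> solution z.
Proof.
move=> iw pz fz uz k.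
have [pw ew] := iw.
have nzbig u : nm (b + u) <= 2 -> u != 0.
  by move=> /big_lower h; rewrite -nm_gt0; have := be_ge100; lra.
have nzhuge u : be ^+ 2 / 2 <= nm u -> u != 0 /\ b + u != 0.
  move=> h; rewrite -!nm_gt0; have := nm_geDr u b.
  by have := huge_ge; have := be_ge100; split; lra.
have nzsmall u : nm u <= 3 -> b + u != 0.
  by rewrite -nm_gt0 => h; have := nm_geD b u; have := be_ge100; lra.
have nzsmall0 u : nm u <= al + 1 -> b + u != 0.
  by rewrite -nm_gt0 => h; have := nm_geD b u; have := al_ge0; have := b_large; lra.
have e0 := ew k; have e1 := ew k.+1; have hz0 := fz k; have hz2 := fz k.+2.
have u0 := uz k; have u1 := uz k.+1; have u2 := uz k.+2.
move: u0 u1 u2; rewrite /update !(pred_shift n_gt0 _ pz).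
have -> : z (k.+1 + n).-1 = z k by rewrite -(pz k); congr z; lia.
case wk1 : (w k.+1) e0 e1 => //; case wk0 : (w k) hz0 => // hz0 _;
  case wk2 : (w k.+2) hz2 => // hz2 _ u0 u1 u2.
- by rewrite -u2 divfK// nzsmall0.
- by rewrite -[X in b + X]u0 addrC subrK mulrC divfK// nzbig.
- by rewrite -u2 divfK// nzsmall.
- by rewrite -u2 divfK// (nzhuge _ hz0).2.
- by rewrite -[X in b + X]u0 addrC subrK mulrC divfK// nzbig.
- by rewrite -[X in b + X]u0 addrC subrK mulrC divfK// (nzhuge _ hz2).1.
- by rewrite -u1; ring.
Qed.

Lemma in_region_closed t (x : nat -> R[i]) l c :
  (forall m, in_region t (x m)) -> (forall m, nm (x m - l) <= c / 2 ^+ m) -> in_region t l.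
Proof.
move=> xt xl; case: t xt => /= xt.
1,4: rewrite -subr_le0; apply: (@le_geometric0 _ _ c) => m; apply: le_trans (xl m);
  by have := xt m; have := nm_geB l (x m); rewrite nm_distC; lra.
1,2: rewrite -subr_le0; apply: (@le_geometric0 _ _ c) => m; apply: le_trans (xl m);
  have := xt m; have := nm_geB (b + l) (b + x m);
  by rewrite (_ : b + l - _ = l - x m) 1?nm_distC; [lra|ring].
rewrite -subr_le0; apply: (@le_geometric0 _ _ c) => m; apply: le_trans (xl m).
by have := xt m; have := nm_geB (x m) l; lra.
Qed.

(** Picard iteration of [update] inside the closed regions; comparing the iterates with the limit by
    [contraction] once more shows that the limit is fixed. *)
Lemma solution_exists w : itinerary w -> exists z, [/\ periodic n z, fits w z & solution z].
Proof.
move=> iw; have [pw ew] := iw.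
pose v : nat -> R[i] := fun k => match w k with
  | Small0 | Small => 0 | Big0 | Big => - b | Huge => b ^+ 2 end.
have pv : periodic n v by move=> k; rewrite /v pw.
have fv : fits w v.
  move=> k; rewrite /v; case: (w k); rewrite /= ?nm0 ?subrr ?nm0//.
  - by have := al_ge0; lra.
  - by rewrite nmX ler_piMr ?sqr_ge0//; lra.
pose x m := iter m (update w) v.
have xS m : update w (x m) = x m.+1 by [].
have px m : periodic n (x m) by elim: m => // m IH; exact: update_periodic.
have fx m : fits w (x m) by elim: m => // m IH; exact: update_fits.
have [c c0 bd] : exists2 c, 0 <= c &
    forall k, nm (x 1%N k - x 0%N k) <= weight (w k) * c.
  by apply: weighted_bound => // k; rewrite !px.
have {}bd m : forall k, nm (x m.+1 k - x m k) <= weight (w k) * (c / 2 ^+ m).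
  elim: m => [|m IH]; first by rewrite expr0 divr1.
  have -> : c / 2 ^+ m.+1 = (c / 2 ^+ m) / 2 by rewrite exprSr invfM mulrA.
  have lk := update_linked iw (px m.+1) (px m) (fx m.+1) (fx m).
  apply: contraction lk IH => //.
  - exact: (fx m.+2).
  - exact: (fx m.+1).
  - by move=> k; rewrite !xS !px.
have /choice[z zP] k : exists l, forall m, nm (x m k - l) <= 4 * (weight (w k) * c) / 2 ^+ m.
  by apply: geometric_cvg => m; rewrite -mulrA; exact: bd.
have pz : periodic n z.
  move=> k; apply/eqP; rewrite -subr_eq0 -nm_eq0 eq_le nm_ge0 andbT.
  apply: (@le_geometric0 _ _ (8 * (weight (w k) * c))) => m.
  have := zP (k + n)%N m; have := zP k m; rewrite px pw.
  rewrite (_ : z (k + n)%N - z k = (x m k - z k) - (x m k - z (k + n)%N)); last by ring.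
  by have := nmB (x m k - z k) (x m k - z (k + n)%N); lra.
have fz : fits w z by move=> k; apply: in_region_closed (zP k) => m; exact: fx.
exists z; split => //; apply: (update_fixed_solution iw pz fz) => k.
apply/eqP; rewrite -subr_eq0 -nm_eq0 eq_le nm_ge0 andbT.
apply: (@le_geometric0 _ _ (weight (w k) * (4 * c))) => m.
have lk := update_linked iw (px m) pz (fx m) fz.
have h : nm (x m.+1 k - update w z k) <= weight (w k) * (4 * c / 2 ^+ m / 2).
  apply: (contraction iw (fx m) (fx m.+1) fz (update_fits iw pz fz) _ lk) => j.
    by rewrite xS px (update_periodic pw pz).
  by apply: le_trans (zP j m) _; rewrite le_eqVlt; apply/orP; left; apply/eqP; ring.
move: h (zP k m.+1); rewrite exprS.
rewrite (_ : update w z k - z k = (x m.+1 k - z k) - (x m.+1 k - update w z k)); last by ring.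
have := nmB (x m.+1 k - z k) (x m.+1 k - update w z k).
have -> : 4 * (weight (w k) * c) / (2 * 2 ^+ m) = weight (w k) * (4 * c) / 2 ^+ m / 2.
  by field; rewrite expf_neq0.
have -> : weight (w k) * (4 * c / 2 ^+ m / 2) = weight (w k) * (4 * c) / 2 ^+ m / 2.
  by rewrite !mulrA.
by lra.
Qed.

End LargeB.

(** * Classification of itineraries *)

Section Words.

Definition successors s : seq coord_type :=
  match s with
  | Small0 => [:: Small0] | Big0 => [:: Big0] | Big => [:: Small]
  | Small => [:: Big; Huge] | Huge => [:: Big]
  end.

Lemma mem_successors s t : (t \in successors s) = follows s t.
Proof. by case: s; case: t. Qed.

Fixpoint walks n x y : seq (seq coord_type) :=
  if n is m.+1 then [seq z :: p | z <- successors x, p <- walks m z y]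
  else if x == y then [:: [::]] else [::].

Lemma mem_walks n x y p :
  (p \in walks n x y) = [&& size p == n, path follows x p & last x p == y].
Proof.
elim: n x p => [|n IH] x p /=.
  case: p => [|t p]; first by case: eqP.
  by case: eqP.
apply/flatten_mapP/idP => [[z zx /mapP[p' p'w ->]]|].
  by move: p'w; rewrite IH /= eqSS -mem_successors zx.
case: p => [//|z p] /= /and3P[sp /andP[xz pz] lp].
exists z; rewrite ?mem_successors//; apply/mapP; exists p => //.
by rewrite IH pz lp -eqSS sp.
Qed.

Lemma uniq_walks n x y : uniq (walks n x y).
Proof.
elim: n x => [|n IH] x /=; first by case: eqP.
apply: allpairs_uniq_dep => [|z _|]; [by case: x|exact: IH|].
by move=> [z p] [z' p'] _ _ /= [-> ->].
Qed.

Definition words n : seq (seq coord_type) :=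
  [seq p | x <- [:: Small0; Big0; Big; Small; Huge], p <- walks n x x].

Lemma mem_words n p : (0 < n)%N -> (p \in words n) = (size p == n) && cycle follows p.
Proof.
move=> n0; apply/flatten_mapP/idP => [[x _]|/andP[/eqP sp cp]].
  rewrite map_id mem_walks => /and3P[-> px /eqP lx].
  by rewrite (cycle_path x) lx.
exists (last Small0 p); first by case: (last _ _).
case: p sp cp => [|t p] sp cp; first by rewrite -sp in n0.
by rewrite map_id mem_walks sp eqxx /= eqxx andbT; rewrite (cycle_path Small0) in cp.
Qed.

Lemma uniq_words n : (0 < n)%N -> uniq (words n).
Proof.
move=> n0; apply: allpairs_uniq_dep => // [x _|]; first exact: uniq_walks.
move=> _ _ /allpairsPdep[x1 [p1 [_ h1 ->]]] /allpairsPdep[x2 [p2 [_ h2 ->]]] /= p12.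
move: h1 h2; rewrite -p12 !mem_walks => /and3P[/eqP sp _ /eqP lx] /and3P[_ _ /eqP ly].
have x12 : x1 = x2.
  by rewrite -lx -ly; case: p1 sp {p12 lx ly} => // sp; rewrite -sp in n0.
by rewrite x12 p12.
Qed.

Lemma size_walksS n x y :
  size (walks n.+1 x y) = sumn [seq size (walks n z y) | z <- successors x].
Proof. by rewrite /= size_allpairs_dep. Qed.

Arguments walks : simpl never.

(** [rec] is the relation A^3 = A + 1 for the adjacency matrix A of the component of [Big], [Small],
    [Huge], multiplied by A^n and read entrywise; taking traces gives the recurrence of [phi], and
    the two loops add 2. *)
Lemma size_words (phi : nat -> nat) :
  phi 1 = 0%N -> phi 2 = 2 -> phi 3 = 3 ->
  (forall n, (1 <= n)%N -> phi (n + 3)%N = (phi n + phi (n + 1))%N) ->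
  forall n, (0 < n)%N -> size (words n) = (phi n + 2)%N.
Proof.
move=> phi1 phi2 phi3 phiS.
have sz0 n x : x \in [:: Small0; Big0] -> size (walks n x x) = 1%N.
  elim: n => [|n IH] xin; first by rewrite /walks eqxx.
  by rewrite size_walksS; case: x xin IH => // _ /(_ isT) /= ->.
have rec n x y : x \in [:: Big; Small; Huge] ->
    size (walks n.+3 x y) = (size (walks n x y) + size (walks n.+1 x y))%N.
  move=> xin; rewrite !size_walksS; case: x xin => // _;
    rewrite /= ?size_walksS /= ?size_walksS /= ?size_walksS /=; lia.
suff main n : (size (walks n.+1 Big Big) + size (walks n.+1 Small Small) +
    size (walks n.+1 Huge Huge))%N = phi n.+1.
  case=> // n _; rewrite -main size_allpairs_dep /= (sz0 n.+1 Small0)// (sz0 n.+1 Big0)//; lia.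
suff [] : [/\ (size (walks n.+1 Big Big) + size (walks n.+1 Small Small) +
    size (walks n.+1 Huge Huge))%N = phi n.+1,
   (size (walks n.+2 Big Big) + size (walks n.+2 Small Small) +
    size (walks n.+2 Huge Huge))%N = phi n.+2 &
   (size (walks n.+3 Big Big) + size (walks n.+3 Small Small) +
    size (walks n.+3 Huge Huge))%N = phi n.+3] by [].
elim: n => [|n [IH1 IH2 IH3]]; first by rewrite phi1 phi2 phi3; vm_compute.
split => //; rewrite !rec//.
have := phiS n.+1 isT; rewrite addn3 addn1 => ->; lia.
Qed.

End Words.

(** * Every periodic orbit follows an itinerary *)

Section Classification.
Variable R : realType.
Variables (a b : R[i]) (n : nat).
Hypothesis n_gt0 : (0 < n)%N.
Local Notation al := (nm a).
Local Notation be := (nm b).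
Hypothesis b_large : 100 * (al + 1) <= be.

Let al_ge0 : 0 <= al. Proof. exact: nm_ge0. Qed.
Let be_ge100 : 100 <= be. Proof. by have := al_ge0; have := b_large; lra. Qed.
Let huge_ge : 50 * be <= be ^+ 2 / 2.
Proof. by have := be_ge100; nra. Qed.

(** Different regions overlap only for [Small0] with [Small] and for [Big0] with [Big], and the
    region of the next coordinate tells these apart. *)
Lemma itinerary_unique w w' z : itinerary n w -> itinerary n w' ->
  fits a b w z -> fits a b w' z -> w =1 w'.
Proof.
move=> [_ ew] [_ ew'] fz fz' k.
have sb k' u : in_region a b (w k') u -> in_region a b (w' k') u ->
  match w k', w' k' with
  | Small0, Small0 | Small0, Small | Small, Small0 | Small, Small
  | Big0, Big0 | Big0, Big | Big, Big0 | Big, Big | Huge, Huge => true | _, _ => false end.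
  have := al_ge0; have := b_large; have := huge_ge; have := @big_lower _ b u.
  have := @big_upper _ b u.
  by case: (w k'); case: (w' k') => //= h h' *; exfalso;
   try (have := h ltac:(by [])); try (have := h' ltac:(by [])); lra.
have h0 := sb k _ (fz k) (fz' k); have h1 := sb k.+1 _ (fz k.+1) (fz' k.+1).
move: h0 h1 (ew k) (ew' k).
by case: (w k); case: (w' k) => //; case: (w k.+1); case: (w' k.+1).
Qed.

Section Orbit.
Variable z : nat -> R[i].
Hypotheses (pz : periodic n z) (sz : solution a b z).

Let isB k := nm (b + z k) <= 2.

Let pB k : isB (k + n)%N = isB k. Proof. by rewrite /isB pz. Qed.

Let quot_le (u x d : R[i]) (X Y : R) : u * x = d -> 0 < X -> X <= nm u ->
  nm d <= Y -> Y <= 2 * X -> nm x <= 2.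
Proof.
move=> e X0 Xu dY YX; rewrite -(ler_pM2l X0).
apply: le_trans (_ : nm u * nm x <= _); first by rewrite ler_wpM2r// nm_ge0.
by rewrite -nmM e mulrC; exact: le_trans dY YX.
Qed.

(** If |z_{k+2}| <= |b|, then b + z_{k+1} = (a + z_{k+2}) / z_{k+3} is small, against the
    hypothesis. Otherwise |z_{k+1}| <= |b| + |z_{k+2}| / 2, and b + z_k = (a + z_{k+1}) / z_{k+2}
    has norm at most 2. *)
Let gap k : isB k.+3 -> ~~ isB k.+1 -> isB k.
Proof.
move=> B3; have := sz k.+1; have := big_lower B3; have := big_upper B3 => u3 l3 e1 nB1.
have [h2|h2] := lerP (nm (z k.+2)) be.
  case/negP: nB1; apply: (quot_le (X := be - 2) (Y := al + be) e1) => //.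
  - by have := be_ge100; lra.
  - by have := nmD a (z k.+2); lra.
  - by have := al_ge0; have := b_large; lra.
have h1 : nm (z k.+1) <= be + nm (z k.+2) / 2.
  have -> : z k.+1 = (a + z k.+2) / z k.+3 - b.
    by rewrite -e1 mulrC mulrA mulVf ?mul1r ?[b + _]addrC ?addrK// -nm_gt0; have := be_ge100; lra.
  apply: le_trans (nmB _ _) _; rewrite addrC lerD2l.
  apply: (@nm_div_le _ _ _ (be - 2)) => //; first by have := be_ge100; lra.
  by have := nmD a (z k.+2); have := al_ge0; have := b_large; nra.
apply: (quot_le (X := nm (z k.+2)) (Y := al + be + nm (z k.+2) / 2) (sz k)) => //.
- by have := be_ge100; lra.
- by have := nmD a (z k.+1); lra.
- by have := al_ge0; have := b_large; lra.
Qed.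

(** Two consecutive coordinates near -b propagate backwards, hence by periodicity to the whole
    orbit. *)
Let adjacent k : isB k.+1 -> isB k.+2 -> isB k.
Proof.
move=> B1 B2; have := big_lower B2; have := big_upper B1 => u1 l2.
apply: (quot_le (X := be - 2) (Y := al + be + 2) (sz k)) => //.
- by have := be_ge100; lra.
- by have := nmD a (z k.+1); lra.
- by have := al_ge0; have := b_large; lra.
Qed.

(** A coordinate z_m of maximal norm satisfies z_m (b + z_{m-2}) = a + z_{m-1}, so |b + z_{m-2}| <=
    1 + |a| / |z_m|, which is at most 2 once |z_m| > |a| + 1. *)
Lemma exists_big : (forall k, nm (z k) <= al + 1) \/ exists k, isB k.
Proof.
have [m mP] : exists m, forall k, nm (z k) <= nm (z m).
  pose i0 := Ordinal n_gt0.
  have [i _ iP] := @Order.TotalTheory.arg_maxP _ _ _ i0 xpredT (fun i : 'I_n => nm (z i)) isT.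
  exists i => k; rewrite (divn_eq k n) addnC (periodicM pz).
  have kn : (k %% n < n)%N by rewrite ltn_mod.
  exact: (iP (Ordinal kn)).
have [h|h] := lerP (nm (z m)) (al + 1).
  by left => k; apply: le_trans (mP k) h.
right; exists (m + 2 * n - 2)%N.
have := sz (m + 2 * n - 2)%N.
have -> : (m + 2 * n - 2).+2 = (m + 2 * n)%N by lia.
rewrite (periodicM pz) => e.
apply: (quot_le (X := nm (z m)) (Y := al + nm (z m)) e) => //.
- by have := al_ge0; lra.
- by apply: le_trans (nmD _ _) _; rewrite lerD2l; exact: mP.
- by have := al_ge0; lra.
Qed.

Lemma classification : exists w, itinerary n w /\ fits a b w z.
Proof.
have [h|[m0 Bm0]] := exists_big.
  by exists (fun=> Small0); split => //; split.
have [[k0 [B0 B1]]|nadj] := pselect (exists k, isB k /\ isB k.+1).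
  have allB k : isB k.
    have [q qP] : exists q, (k + (k0 + q * n - k) = k0 + q * n)%N.
      by exists k; rewrite subnKC// (leq_trans (leq_pmulr k n_gt0))// leq_addl.
    have B01 i : isB (k0 + i * n)%N /\ isB (k0 + i * n).+1.
      by rewrite /isB -addSn !(periodicM pz).
    have all2 j k' : (k' + j = k0 + q * n)%N -> isB k' /\ isB k'.+1.
      elim: j k' => [|j IH] k' e; first by rewrite addn0 in e; rewrite e; exact: B01.
      have [] : isB k'.+1 /\ isB k'.+2 by apply: IH; lia.
      by move=> h1 h2; split => //; exact: adjacent.
    by have [] := all2 _ _ qP.
  by exists (fun=> Big0); split => //; split.
have {}nadj k : isB k -> ~~ isB k.+1.
  by move=> Bk; apply/negP => Bk1; apply: nadj; exists k.
(* By [gap] and [nadj], coordinates near -b recur every two or three steps; their positions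
   determine the itinerary. *)
pose w k := if isB k then Big else if isB (k + n).-1 then Small else Huge.
have pre k : isB (k.+1 + n).-1 = isB k by rewrite addSn /= pB.
have pw : periodic n w.
  move=> k; rewrite /w pB; case: ifP => // _.
  have -> : ((k + n + n).-1 = (k + n).-1 + n)%N by lia.
  by rewrite pB.
have big_after k : exists j, isB (k + j.+1)%N.
  exists (m0 + k.+1 * n - k.+1)%N.
  have -> : (k + (m0 + k.+1 * n - k.+1).+1 = m0 + k.+1 * n)%N by nia.
  by rewrite /isB (periodicM pz).
have gap' k j : isB (k + j.+3)%N -> isB (k + j.+1)%N \/ isB (k + j)%N.
  rewrite !addnS => h; case: (boolP (isB (k + j).+1)); first by left.
  by right; exact: gap.
have huge_next k : ~~ isB k.+1 -> ~~ isB k -> isB k.+2.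
  move=> n1 n0; have := ex_minnP (big_after k.+1) => -[j Bj minj].
  case: j Bj minj => [|[|j]] Bj minj; first by rewrite addn1 in Bj.
    have [] := gap' k 0%N; rewrite ?addn1 ?addn0 ?(negbTE n1) ?(negbTE n0)//.
    by move: Bj; rewrite addSnnS.
  have [h|h] := gap' k.+1 j Bj; first by move: (minj _ h); rewrite ltnNge leqnSn.
  case: j Bj minj h => [|j] Bj minj h; first by rewrite addn0 (negbTE n1) in h.
  by move: (minj _ h); rewrite ltnNge leqW ?leqnSn.
have ew k : follows (w k) (w k.+1).
  rewrite /w pre; case: (boolP (isB k)) => [Bk|nBk]; first by rewrite (negbTE (nadj _ Bk)).
  case: (boolP (isB (k + n).-1)) => [_|nBp]; first by case: ifP.
  suff -> : isB k.+1 by [].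
  have := huge_next (k + n).-1.
  have -> : (k + n).-1.+1 = (k + n)%N by lia.
  by rewrite -addSn !pB => ->.
exists w; split => //.
have wB k : w k = Big -> isB k by rewrite /w; case: ifP => //; case: ifP.
have wnB k : w k <> Big -> ~~ isB k by rewrite /w; case: ifP.
pose PS (r : R) := forall k, w k = Small -> nm (z k) <= r.
have smallP k : w k.+2 = Small -> w k.+1 = Big /\ (w k = Small \/ w k = Huge).
  move=> w2; have := ew k.+1; rewrite w2; case w1 : (w k.+1) => // _.
  split => //; have := ew k; rewrite w1; case w0 : (w k) => // _; tauto.
have to2 (P : nat -> R[i] -> Prop) : (forall k t, P (k + n)%N t -> P k t) ->
  (forall k, P k.+2 (z k.+2)) -> forall k, P k (z k).
  by move=> Pn PSS; exact: (periodic_shift2 n_gt0 pz Pn PSS).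
(* A bootstrap: a crude bound on [Small] from |b + z| > 2, a lower bound on [Huge], then the
   required bounds on [Small] and on [Huge]. *)
have S1 : PS ((al + be + 2) / 2).
  apply: (to2 (fun k t => w k = Small -> nm t <= (al + be + 2) / 2)) => [k t|k w2].
    by rewrite pw.
  have [w1 w0] := smallP _ w2.
  have nB0 : ~~ isB k by apply: wnB; case: w0 => ->.
  have d0 : 2 < nm (b + z k) by rewrite ltNge.
  have x0 : b + z k != 0 by rewrite -nm_gt0; lra.
  have -> : z k.+2 = (a + z k.+1) / (b + z k) by rewrite -sz mulfK.
  apply: (@nm_div_le _ _ _ 2) => //; first exact: ltW.
  by have := big_upper (wB _ w1); have := nmD a (z k.+1); lra.
have hugeP r : r <= (al + be + 2) / 2 -> PS r -> forall k, w k = Huge ->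
    (be - 2) * (be - r) - al <= nm (z k).
  move=> rb Pr.
  apply: (to2 (fun k t => w k = Huge -> (be - 2) * (be - r) - al <= nm t)) => [k t|k w2].
    by rewrite pw.
  have := ew k.+1; rewrite w2; case w1 : (w k.+1) => // _.
  have := ew k.+2; rewrite w2; case w3 : (w k.+3) => // _.
  have e : z k.+2 = z k.+3 * (b + z k.+1) - a by rewrite sz; ring.
  rewrite e; apply: le_trans (nm_geB _ _); rewrite lerD2r nmM.
  have h1 : be - r <= nm (b + z k.+1).
    by have := Pr _ w1; have := nm_geD b (z k.+1); lra.
  by apply: ler_pM h1; [have := be_ge100; lra|have := al_ge0; have := b_large;
    lra|exact: big_lower (wB _ w3)].
have S3 : PS 3.
  apply: (to2 (fun k t => w k = Small -> nm t <= 3)) => [k t|k w2]; first by rewrite pw.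
  have [w1 w0] := smallP _ w2.
  have d0 : (be - al - 2) / 2 <= nm (b + z k).
    case: w0 => w0.
      by have := S1 _ w0; have := nm_geD b (z k); lra.
    have := hugeP _ (lexx _) S1 _ w0; have := nm_geDr (z k) b.
    by have := al_ge0; have := b_large; have := be_ge100; nra.
  have x0 : b + z k != 0 by rewrite -nm_gt0; have := al_ge0; have := b_large; lra.
  have -> : z k.+2 = (a + z k.+1) / (b + z k) by rewrite -sz mulfK.
  apply: (@nm_div_le _ _ _ ((be - al - 2) / 2)) => //.
    by have := al_ge0; have := b_large; lra.
  by have := big_upper (wB _ w1); have := nmD a (z k.+1); have := al_ge0; have := b_large; lra.
have h3 : 3 <= (al + be + 2) / 2 by have := al_ge0; have := b_large; lra.
move=> k; case wk : (w k) => /=.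
- by move: wk; rewrite /w; case: ifP => //; case: ifP.
- by move: wk; rewrite /w; case: ifP => //; case: ifP.
- exact: wB.
- exact: S3.
- apply: le_trans (hugeP _ h3 S3 _ wk).
  by have := al_ge0; have := b_large; have := be_ge100; nra.
Qed.

End Orbit.
End Classification.

(** * Points with a given itinerary *)

Section WordItinerary.
Variable n : nat.
Hypothesis n_gt0 : (0 < n)%N.

Definition word_itinerary (p : seq coord_type) k := nth Small0 p (k %% n).

Lemma word_itineraryP p : p \in words n -> itinerary n (word_itinerary p).
Proof.
rewrite mem_words// (cycle_path Small0) => /andP[/eqP sp /(pathP Small0) pp].
split=> [k|k]; first by rewrite /word_itinerary modnDr.
have kn : (k.+1 %% n < size p)%N by rewrite sp ltn_mod.
have := pp _ kn; rewrite /word_itinerary -addn1 -modnDml addn1.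
have : (k %% n < n)%N by rewrite ltn_mod.
rewrite leq_eqVlt => /orP[/eqP e|h].
  rewrite e modnn /= -nth_last sp.
  by have -> : n.-1 = (k %% n)%N by lia.
by rewrite modn_small.
Qed.

Lemma word_of_itinerary w : itinerary n w ->
  mkseq w n \in words n /\ word_itinerary (mkseq w n) =1 w.
Proof.
move=> [pw ew]; have we : word_itinerary (mkseq w n) =1 w.
  move=> k; have kn : (k %% n < n)%N by rewrite ltn_mod.
  by rewrite /word_itinerary nth_mkseq// [in RHS](divn_eq k n) addnC (periodicM pw).
split => //; rewrite mem_words// size_mkseq eqxx (cycle_path Small0).
apply/(pathP Small0) => i; rewrite size_mkseq => i_n; rewrite nth_mkseq//.
case: i i_n => [|i] i_n /=; last by rewrite nth_mkseq ?ew// ltnW.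
rewrite -nth_last size_mkseq nth_mkseq ?prednK//.
have -> : w 0%N = w n by rewrite -(pw 0%N) add0n.
by have := ew n.-1; rewrite prednK.
Qed.

Lemma word_itinerary_inj p p' : p \in words n -> p' \in words n ->
  word_itinerary p =1 word_itinerary p' -> p = p'.
Proof.
rewrite !mem_words// => /andP[/eqP sp _] /andP[/eqP sp' _] e.
apply: (@eq_from_nth _ Small0) => [|i]; first by rewrite sp sp'.
by rewrite sp => i_n; have := e i; rewrite /word_itinerary modn_small.
Qed.

End WordItinerary.

Definition cycle_point (K : fieldType) (a b : K) n (q : K * K) :=
  iter n (step a b) q = q /\ forall j, (j < n)%N -> b + orb a b q j != 0.

Section CyclePoints.
Variable R : realType.
Variables (a b : R[i]) (n : nat).
Hypothesis n_gt0 : (0 < n)%N.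
Hypothesis b_large : 100 * (nm a + 1) <= nm b.

Lemma cycle_point_orbit q : cycle_point a b n q ->
  periodic n (orb a b q) /\ solution a b (orb a b q).
Proof.
move=> [qn dom]; split=> [k|k]; first exact: orb_period.
by apply: orb_rec; exact: (orb_period_dom n_gt0 qn).
Qed.

Lemma cycle_point_word q : cycle_point a b n q ->
  exists2 p, p \in words n & fits a b (word_itinerary n p) (orb a b q).
Proof.
move=> /cycle_point_orbit[pz sz].
have [w [iw fw]] := classification n_gt0 b_large pz sz.
have [pin pw] := word_of_itinerary n_gt0 iw.
by exists (mkseq w n) => // k; rewrite pw.
Qed.

Lemma cycle_point_unique p q q' : p \in words n ->
  cycle_point a b n q -> cycle_point a b n q' ->
  fits a b (word_itinerary n p) (orb a b q) ->
  fits a b (word_itinerary n p) (orb a b q') -> q = q'.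
Proof.
move=> pin /cycle_point_orbit[pz sz] /cycle_point_orbit[pz' sz'] fz fz'.
have e := solution_unique n_gt0 b_large (word_itineraryP n_gt0 pin) fz fz' pz pz' sz sz'.
by have := e 0%N; have := e 1%N; rewrite /orb /=;
  case: q q' {pz sz pz' sz' fz fz' e} => [? ?] [? ?] /= -> ->.
Qed.

Lemma cycle_point_simple x y : cycle_point a b n (x, y) ->
  [/\ ev2 x y (pden a b n.+1) != 0, ev2 x y (pfix1 a b n) = 0, ev2 x y (pfix2 a b n) = 0
    & simple_zero (pfix1 a b n) (pfix2 a b n) x y].
Proof.
move=> cq; have [qn dom] := cq; have dn := (den_neq0P a b x y n).2 dom.
have [f0 g0] := (fix_iff dn).2 qn.
rewrite ev2_pden ev2_pfix1 ev2_pfix2; split => //.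
have [p pin fz] := cycle_point_word cq.
apply: (simple_zero_of_linearized n_gt0) => // ze lin pze.
exact: (linear_solution_eq0 n_gt0 b_large (word_itineraryP n_gt0 pin) fz fz).
Qed.

Lemma cycle_points_finite : exists s : seq (R[i] * R[i]),
  (size s <= size (words n))%N /\ forall q, cycle_point a b n q <-> q \in s.
Proof.
pose P p q := cycle_point a b n q /\ fits a b (word_itinerary n p) (orb a b q).
pose pt p := if pselect (exists q, P p q) is left e then Some (sval (cid e)) else None.
exists (pmap pt (words n)); split; first by rewrite size_pmap count_size.
move=> q; split=> [cq|].
  have [p pin fz] := cycle_point_word cq.
  rewrite mem_pmap; apply/mapP; exists p => //; rewrite /pt.
  case: pselect => [e|[]]; last by exists q.
  by case: cid => q' /= [cq' fz']; congr Some; exact: (cycle_point_unique pin).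
rewrite mem_pmap => /mapP[p pin]; rewrite /pt; case: pselect => // e [->].
by case: cid => q' /= [].
Qed.

(** A solution of z_{k+2} (b + z_k) = a + z_{k+1} is an orbit only if b + z_k never vanishes. A zero
    would force z_{k+1} = -a; after [Big] this contradicts |z_{k+1}| <= 3 < |a|, the origin of the
    4, and after [Big0] it contradicts |z_{k+1}| >= |b| - 2. *)
Lemma cycle_point_exists p : 4 <= nm a -> p \in words n ->
  exists q, cycle_point a b n q /\ fits a b (word_itinerary n p) (orb a b q).
Proof.
move=> a4 pin; have iw := word_itineraryP n_gt0 pin.
have [z [pz fz sz]] := solution_exists n_gt0 b_large iw.
have [pw ew] := iw; set w := word_itinerary n p in fz pw ew *.
have al0 := nm_ge0 a; have bl := b_large.
have nz (u v x : R[i]) : u * (b + x) = a + v -> nm v < nm a -> b + x != 0.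
  move=> e va; apply/eqP => x0; move: e; rewrite x0 mulr0 => /esym/eqP.
  rewrite addrC addr_eq0 => /eqP v0; by move: va; rewrite v0 nmN ltxx.
have dom k : b + z k != 0.
  have := fz k; have := ew k; case wk : (w k) => /=.
  - by move=> _ h; rewrite -nm_gt0; have := nm_geD b (z k); lra.
  - case wk1 : (w k.+1) => // _ _; have := fz k.+1; rewrite wk1 => /big_lower h.
    apply/eqP => x0; have := sz k; rewrite x0 mulr0 => /esym/eqP.
    rewrite addr_eq0 => /eqP v0; move: h; rewrite -(nmN (z _)) -v0; lra.
  - case wk1 : (w k.+1) => // _ _; have := fz k.+1; rewrite wk1 /= => h.
    by apply: (nz _ _ _ (sz k)); lra.
  - by move=> _ h; rewrite -nm_gt0; have := nm_geD b (z k); lra.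
  - move=> _ h; rewrite -nm_gt0; have := nm_geDr (z k) b; nra.
pose q := (z 0%N, z 1%N).
have qz k : orb a b q k = z k.
  elim/two_step_ind: k => [||k IH IH']//.
  by rewrite orbSS IH IH' -sz mulfK.
exists q; split=> [|k]; last by rewrite qz.
split=> [|j _]; last by rewrite qz.
by rewrite iter_step !qz /q -(pz 0%N) -(pz 1%N) add0n add1n.
Qed.

Lemma cycle_points_exact : 4 <= nm a -> exists s : seq (R[i] * R[i]),
  [/\ uniq s, size s = size (words n) & forall q, cycle_point a b n q <-> q \in s].
Proof.
move=> a4.
have /choice[pt ptP] p : exists q, p \in words n ->
    cycle_point a b n q /\ fits a b (word_itinerary n p) (orb a b q).
  have [pin|_] := boolP (p \in words n); last by exists (0, 0).
  by have [q qP] := cycle_point_exists a4 pin; exists q.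
exists (map pt (words n)); split; rewrite ?size_map//.
  rewrite map_inj_in_uniq ?uniq_words// => p p' pin pin' e.
  have [_ f1] := ptP _ pin; have [_ f2] := ptP _ pin'; rewrite -e in f2.
  apply: (word_itinerary_inj n_gt0) => //.
  exact: (itinerary_unique b_large (word_itineraryP n_gt0 pin) (word_itineraryP n_gt0 pin') f1 f2).
move=> q; split=> [cq|/mapP[p pin ->]]; last by case: (ptP _ pin).
have [p pin fz] := cycle_point_word cq; apply/mapP; exists p => //.
by have [c1 f1] := ptP _ pin; exact: (cycle_point_unique pin).
Qed.

End CyclePoints.

(** * The algebraic bound *)

Section Uncountable.
Variable R : realType.

Lemma many_infinite (T : choiceType) (A : set T) : ~ finite_set A -> many A.
Proof.
move=> infA L.
have [l [ul sl lA]] : exists l : seq T, [/\ uniq l, size l = L & forall x, x \in l -> A x].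
  elim: L => [|L [l [ul sl lA]]]; first by exists [::].
  have [x [Ax xl]] : exists x, A x /\ x \notin l.
    apply: contrapT => /forallNP h; apply: infA.
    apply: (@sub_finite_set _ _ [set` l]); last exact: finite_seq.
    by move=> x Ax /=; apply: contrapT => xl; apply: (h x); split => //; exact/negP.
  exists (x :: l); split; rewrite /= ?xl ?ul ?sl// => y.
  by rewrite inE => /predU1P[->//|]; exact: lA.
case: l ul sl lA => [|x0 l] ul sl lA.
  by subst L; exists (fun i : 'I_0 => match (notF (ltn_ord i)) with end); split => [[]|[]].
exists (fun i : 'I_L => nth x0 (x0 :: l) i); split=> [i j /eqP|i].
  by rewrite nth_uniq ?sl// => /eqP/val_inj.
by apply/lA/mem_nth; rewrite sl.
Qed.

(** A real ray is used so that |b + t| stays large. If all fibres were finite, an interval of length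
    1 would be countable, against its Lebesgue measure. *)
Lemma unctbl_real (B : R) : unctbl (fun x : R[i] => exists2 r : R, B <= r & x = (r%:C)%C).
Proof.
move=> I phi; apply: contrapT => /forallNP h.
pose S i := [set r : R | B <= r /\ phi (r%:C)%C = i].
have finS i : finite_set (S i).
  apply: contrapT => /many_infinite mS; apply: (h i) => L.
  have [s [sinj sS]] := mS L; exists (fun k => (s k)%:C)%C; split=> [k l /complexI/sinj//|k].
  by have [Bs sk] := sS k; split => //; exists (s k).
have ctbl : countable `[B, B + 1]%classic.
  apply: (@sub_countable _ _ _ (\bigcup_(i in [set: I]) S i)).
    apply: subset_card_le => r /=; rewrite in_itv /= => /andP[Br _].
    by exists (phi (r%:C)%C).
  apply: bigcup_countable; first exact: countableP.
  by move=> i _; exact: finite_set_countable.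
have := countable_lebesgue_measure0 ctbl; rewrite lebesgue_measure_itv /= lte_fin ltrDl ltr01.
by rewrite -EFinD addrAC subrr add0r => -[] /eqP; rewrite oner_eq0.
Qed.

End Uncountable.

Lemma unctblS (K : Type) (A B : K -> Prop) : (forall x, A x -> B x) -> unctbl A -> unctbl B.
Proof.
move=> AB uA I phi; have [i mi] := uA I phi; exists i => L.
by have [s [sinj sP]] := mi L; exists s; split => // k; have [/AB] := sP k.
Qed.

Lemma bdeg_expand (K : closedFieldType) k (p : {poly {poly K}}) : bdeg k p ->
  p = \sum_(ij : 'I_k * 'I_k) (p`_ij.2`_ij.1)%:P%:P * ('X%:P ^+ ij.1 * 'X ^+ ij.2).
Proof.
move=> dp; rewrite -(pair_bigA _ (fun i j : 'I_k => (p`_j`_i)%:P%:P * ('X%:P ^+ i * 'X ^+ j))) /=.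
apply/polyP => j; apply/polyP => i; rewrite !coef_sum.
under eq_bigr => i0 _.
  rewrite !coef_sum; under eq_bigr => j0 _.
    rewrite -rmorphXn /= mulrA -!polyCM coefCM coefXn mulr_natr coefMn coefCM coefXn mulr_natr.
    over.
  over.
have [i_k|k_i] := ltnP i k; last first.
  rewrite dp ?k_i// big1// => i0 _; rewrite big1// => j0 _.
  by rewrite (gtn_eqF (leq_trans (ltn_ord i0) k_i)) mulr0n mul0rn.
have [j_k|k_j] := ltnP j k; last first.
  rewrite dp ?k_j ?orbT// big1// => i0 _; rewrite big1// => j0 _.
  by rewrite (gtn_eqF (leq_trans (ltn_ord j0) k_j)) mulr0n.
rewrite (bigD1 (Ordinal i_k))//= (bigD1 (Ordinal j_k))//= !eqxx !mulr1n.
rewrite big1 ?addr0 => [|j0 jj0]; last first.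
  suff /negbTE -> : j != j0 :> nat by rewrite mulr0n.
  by apply: contraNneq jj0 => jj0; apply/eqP/val_inj.
rewrite big1 ?addr0// => i0 ii0; rewrite big1// => j0 _.
suff /negbTE -> : i != i0 :> nat by rewrite mulr0n mul0rn.
by apply: contraNneq ii0 => ii0; apply/eqP/val_inj.
Qed.

Lemma generic_relation_fin (K : closedFieldType) d (J : finType)
    (E : 'I_d -> {poly {poly {poly K}}}) (H : J -> {poly {poly {poly K}}}) :
  many (fun x : K => exists (la : 'I_d -> K) (mu : J -> K),
    (exists i, la i != 0) /\
    \sum_i (la i)%:P%:P * (E i).[x%:P%:P] + \sum_j (mu j)%:P%:P * (H j).[x%:P%:P] = 0) ->
  exists (c : 'I_d -> {poly K}) (c' : J -> {poly K}), (exists i, c i != 0) /\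
    \sum_i lift K (c i) * E i + \sum_j lift K (c' j) * H j = 0.
Proof.
move=> rel; have [|c [c' [cn0 e]]] := @generic_relation K d #|J| E (H \o enum_val).
  move=> L; have [s [sinj sP]] := rel L; exists s; split => // i.
  have [la [mu [la0 e]]] := sP i; exists la, (mu \o enum_val); split => //.
  by rewrite -[RHS]e; congr (_ + _); rewrite [RHS]big_enum_val.
exists c, (c' \o enum_rank); split => //.
rewrite -[RHS]e; congr (_ + _); rewrite [LHS]big_enum_val; apply: eq_bigr => j _ /=.
by rewrite enum_valK.
Qed.

Section AlgebraicBound.
Variable R : realType.
Local Notation T := {poly {poly R[i]}}.
Variables (a b : R[i]) (n : nat).
Hypothesis n_gt0 : (0 < n)%N.

Let cst c : {poly T} := c%:P%:P%:P.
Let F : {poly T} := fix1 (cst a) (cst b + 'X) 'X%:P%:P 'X%:P n.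
Let G : {poly T} := fix2 (cst a) (cst b + 'X) 'X%:P%:P 'X%:P n.
Let Dn : {poly T} := den (cst a) (cst b + 'X) 'X%:P%:P 'X%:P n.+1.

Let horner_F t : F.[t%:P%:P] = pfix1 a (b + t) n.
Proof. by rewrite -[LHS]/(horner_eval _ F) -fix1_morph /= !horner_evalE !hornerC hornerD hornerX
  hornerC -!polyCD. Qed.

Let horner_G t : G.[t%:P%:P] = pfix2 a (b + t) n.
Proof. by rewrite -[LHS]/(horner_eval _ G) -fix2_morph /= !horner_evalE !hornerC hornerD hornerX
  hornerC -!polyCD. Qed.

Let horner_D t : Dn.[t%:P%:P] = pden a (b + t) n.+1.
Proof. by rewrite -[LHS]/(horner_eval _ Dn) -den_morph /= !horner_evalE !hornerC hornerD hornerX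
  hornerC -!polyCD. Qed.

(* For |b + t| large the fibre consists of at most [size (words n)] simple
   points, so any larger family of polynomials is dependent modulo the ideal; by
   uncountability these relations have bounded degree for infinitely many t,
   hence come from a relation over C[t]. *)
Lemma generic_dependence d (P : 'I_d -> T) : (size (words n) < d)%N ->
  exists (c : 'I_d -> {poly R[i]}) m U V, (exists i, c i != 0) /\
    Dn ^+ m * (\sum_j lift R[i] (c j) * (P j)%:P) = U * F + V * G.
Proof.
move=> nd.
pose B : R := 100 * (nm a + 1) + nm b.
have B_large (r : R) : B <= r -> 100 * (nm a + 1) <= nm (b + (r%:C)%C).
  move=> Br; have := nm_geDr (r%:C)%C b; rewrite nm_real ger0_norm; last first.
    by have := nm_ge0 a; have := nm_ge0 b; rewrite /B in Br; lra.
  by rewrite /B in Br; lra.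
have uC : unctbl (fun _ : R[i] => True) by apply: unctblS (unctbl_real B).
have relt t : exists x : nat * nat, (exists2 r : R, B <= r & t = (r%:C)%C) ->
    exists (la : 'I_d -> R[i]) u v, [/\ exists i, la i != 0,
      bdeg x.2 u, bdeg x.2 v &
      pden a (b + t) n.+1 ^+ x.1 * (\sum_j (la j)%:P%:P * P j) =
        u * pfix1 a (b + t) n + v * pfix2 a (b + t) n].
  have [[r Br tr]|nr] := pselect (exists2 r : R, B <= r & t = (r%:C)%C); last first.
    by exists (0%N, 0%N).
  have bl : 100 * (nm a + 1) <= nm (b + t) by rewrite tr; exact: B_large.
  have [s [ss sP]] := cycle_points_finite n_gt0 bl.
  (* More polynomials than points: some combination vanishes at all points of the fibre. *)
  pose M : 'M[R[i]]_(d, size s) := \matrix_(i, j)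
    ev2 (nth (0, 0) s j).1 (nth (0, 0) s j).2 (P i).
  have : kermx M != 0.
    rewrite kermx_eq0 /row_free neq_ltn (leq_ltn_trans _ nd)//.
    by apply: leq_trans ss; exact: rank_leq_col.
  move=> /rowV0Pn[la /sub_kermxP laM la0].
  have [|m [u [v e]]] := local_nullstellensatz uC (f := pfix1 a (b + t) n)
      (g := pfix2 a (b + t) n) (D := pden a (b + t) n.+1) (p := \sum_j (la 0 j)%:P%:P * P j).
    move=> x y fx gx Dx.
    have cq : cycle_point a (b + t) n (x, y).
      move: fx gx Dx; rewrite ev2_pfix1 ev2_pfix2 ev2_pden => fx gx Dx.
      by split; [apply/(fix_iff Dx)|apply/den_neq0P].
    split; last by have [] := cycle_point_simple n_gt0 bl cq.
    have qs := (sP (x, y)).1 cq.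
    have js : (index (x, y) s < size s)%N by rewrite index_mem.
    have := congr1 (fun A : 'rV_(size s) => A 0 (Ordinal js)) laM.
    rewrite /= !mxE => e0; rewrite -[RHS]e0 rmorph_sum; apply: eq_bigr => j _.
    by rewrite rmorphM /= !ev2C hornerC mxE /= nth_index.
  have [k1 k1u] := bdeg_ex u; have [k2 k2v] := bdeg_ex v.
  exists (m, maxn k1 k2) => _; exists (la 0), u, v; split => //.
  - apply/existsP; apply: contraNT la0; rewrite negb_exists => /forallP la0.
    by apply/eqP/rowP => i; rewrite mxE; move: (la0 i); rewrite negbK => /eqP.
  - exact: bdegW (leq_maxl _ _) k1u.
  - exact: bdegW (leq_maxr _ _) k2v.
have [mk mkP] := choice relt.
(* One exponent of the denominator and one degree bound serve infinitely many t, so these relations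
   are specializations of a single linear system with coefficients in C[t]. *)
have [[m k] manyt] := unctbl_real B mk.
pose mon (ij : 'I_k * 'I_k) : {poly T} := ('X%:P ^+ ij.1 * 'X ^+ ij.2)%:P.
have [|c [c' [cn0 e]]] := @generic_relation_fin R[i] d (('I_k * 'I_k) + ('I_k * 'I_k))%type
   (fun j => Dn ^+ m * (P j)%:P)
   (fun x => match x with inl ij => mon ij * F | inr ij => mon ij * G end).
  move=> L; have [s [sinj sP]] := manyt L; exists s; split => // i.
  have [ri mki] := sP i; have := mkP _ ri; rewrite mki /= => -[la [u [v [la0 du dv e]]]].
  exists la, (fun x : ('I_k * 'I_k) + ('I_k * 'I_k) => match x with inl ij => - u`_ij.2`_ij.1 |
    inr ij => - v`_ij.2`_ij.1 end).
  split => //; rewrite big_sumType /=.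
  transitivity (pden a (b + s i) n.+1 ^+ m * (\sum_j (la j)%:P%:P * P j)
    - (u * pfix1 a (b + s i) n + v * pfix2 a (b + s i) n)); last by rewrite e subrr.
  congr (_ + _).
    rewrite mulr_sumr; apply: eq_bigr => j _.
    by rewrite hornerM horner_exp horner_D hornerC mulrCA.
  rewrite opprD -!mulNr [in X in - X * _ + _](bdeg_expand du) [in X in _ + - X * _](bdeg_expand dv).
  rewrite -!sumrN !mulr_suml; congr (_ + _); apply: eq_bigr => ij _.
    by rewrite hornerM /mon hornerC horner_F !polyCN !mulNr !mulrA.
  by rewrite hornerM /mon hornerC horner_G !polyCN !mulNr !mulrA.
exists c, m, (- \sum_ij lift R[i] (c' (inl ij)) * mon ij),
  (- \sum_ij lift R[i] (c' (inr ij)) * mon ij).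
split => //; apply/eqP; rewrite -subr_eq0; apply/eqP; rewrite -[RHS]e big_sumType /=.
rewrite !mulNr opprD !opprK !mulr_suml mulr_sumr; congr (_ + (_ + _)); apply: eq_bigr => j _.
- by rewrite mulrCA.
- by rewrite mulrA.
- by rewrite mulrA.
Qed.

(** S is the set of admissible multipliers, in the application the polynomials that vanish at none
    of the chosen points; it has to contain the denominators and the factor h by which
    [conservation] multiplies. *)
Lemma algebraic_bound (S : T -> Prop) d (P : 'I_d -> T) h f1 g1 :
  pfix1 a b n = h * f1 -> pfix2 a b n = h * g1 -> coprime_data f1 g1 -> S h ->
  S 1 -> S (pden a b n.+1) -> (forall s s', S s -> S s' -> S (s * s')) ->
  (forall s (lam : 'I_d -> R[i]) u v, S s ->
    s * (\sum_j (lam j)%:P%:P * P j) = u * pfix1 a b n + v * pfix2 a b n ->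
    forall j, lam j = 0) ->
  (d <= size (words n))%N.
Proof.
move=> fE gE cop Sh S1 SD SM indep; rewrite leqNgt; apply/negP => nd.
have [c [m [U [V [[i ci] e]]]]] := generic_dependence P nd.
have F0 : F.[0] = pfix1 a b n by have := horner_F 0; rewrite !polyC0 addr0.
have G0 : G.[0] = pfix2 a b n by have := horner_G 0; rewrite !polyC0 addr0.
have D0 : Dn.[0] = pden a b n.+1 by have := horner_D 0; rewrite !polyC0 addr0.
apply/negP: ci; rewrite negbK; apply/eqP.
apply: (@conservation _ S d P F G h f1 g1 _ _ cop Sh SM _ c (Dn ^+ m) U V _ e i).
- by rewrite F0.
- by rewrite G0.
- by rewrite F0 G0.
- by rewrite horner_exp D0; elim: m {e} => // m IH; rewrite exprS; exact: SM.
Qed.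

End AlgebraicBound.

(** * Power series in two variables *)

Section PowerSeries.
Variable R : realType.
Local Notation C := R[i].
Implicit Types (c d : nat -> nat -> C) (u v l : C) (r : R).

Definition absum c r n m : R := \sum_(i < n) \sum_(j < m) nm (c i j) * r ^+ (i + j).
Definition psum c u v n m : C := \sum_(i < n) \sum_(j < m) c i j * u ^+ i * v ^+ j.
(** Limits are taken over rectangles and not only over squares, because multiplication by a monomial
    shifts the two ranges by different amounts. *)
Definition tends2 c u v l := forall e : R, 0 < e ->
  exists N, forall n m, (N <= n)%N -> (N <= m)%N -> nm (psum c u v n m - l) < e.

Lemma nm_sum (I : Type) (s : seq I) (P : pred I) (F : I -> C) :
  nm (\sum_(i <- s | P i) F i) <= \sum_(i <- s | P i) nm (F i).
Proof.
apply: (big_ind2 (fun x y => nm x <= y)) => // [|x1 x2 y1 y2 h1 h2].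
  by rewrite nm0.
by apply: le_trans (nmD _ _) _; exact: lerD.
Qed.

Lemma absum_ge0 c r n m : 0 <= r -> 0 <= absum c r n m.
Proof.
by move=> r0; apply: sumr_ge0 => i _; apply: sumr_ge0 => j _; rewrite mulr_ge0 ?nm_ge0 ?exprn_ge0.
Qed.

Lemma nm_term_le (x : C) u v r i j : nm u <= r -> nm v <= r ->
  nm (x * u ^+ i * v ^+ j) <= nm x * r ^+ (i + j).
Proof.
move=> ur vr; rewrite !nmM !nmX exprD mulrA.
have r0 : 0 <= r := le_trans (nm_ge0 u) ur.
by rewrite ler_pM ?mulr_ge0 ?exprn_ge0 ?nm_ge0 ?ler_wpM2l ?nm_ge0 ?lerXn2r ?nnegrE ?nm_ge0.
Qed.

Lemma absum_rect c r n m n' m' : 0 <= r -> (n <= n')%N -> (m <= m')%N ->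
  absum c r n m <= absum c r n' m'.
Proof.
move=> r0 nn mm.
have t0 i j : 0 <= nm (c i j) * r ^+ (i + j) by rewrite mulr_ge0 ?nm_ge0 ?exprn_ge0.
rewrite /absum (big_ord_widen _ (fun i : nat => \sum_(j < m) nm (c i j) * r ^+ (i + j)) nn)
  big_mkcond.
apply: ler_sum => i _; case: ifP => _; last by apply: sumr_ge0.
rewrite (big_ord_widen _ (fun j : nat => nm (c i j) * r ^+ (i + j)) mm) big_mkcond.
by apply: ler_sum => j _; case: ifP.
Qed.

Lemma psum_rect c u v r n m n' m' : nm u <= r -> nm v <= r ->
  (n <= n')%N -> (m <= m')%N ->
  nm (psum c u v n' m' - psum c u v n m) <= absum c r n' m' - absum c r n m.
Proof.
move=> ur vr nn mm; have r0 : 0 <= r := le_trans (nm_ge0 u) ur.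
suff [h1 h2] : nm (psum c u v n' m' - psum c u v n' m) <= absum c r n' m' - absum c r n' m /\
    nm (psum c u v n' m - psum c u v n m) <= absum c r n' m - absum c r n m.
  rewrite (_ : psum c u v n' m' - _ = (psum c u v n' m' - psum c u v n' m) +
    (psum c u v n' m - psum c u v n m)); last by ring.
  by apply: le_trans (nmD _ _) _; apply: le_trans (lerD h1 h2) _; rewrite le_eqVlt; apply/orP;
    left; apply/eqP; ring.
split.
  rewrite -(subnKC mm); elim: (m' - m)%N => [|k IH]; first by rewrite addn0 !subrr nm0.
  rewrite addnS; have -> : psum c u v n' (m + k).+1 = psum c u v n' (m + k) +
      \sum_(i < n') c i (m + k)%N * u ^+ i * v ^+ (m + k).
    by rewrite /psum -big_split /=; apply: eq_bigr => i _; rewrite big_ord_recr.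
  have -> : absum c r n' (m + k).+1 = absum c r n' (m + k) +
      \sum_(i < n') nm (c i (m + k)%N) * r ^+ (i + (m + k)).
    by rewrite /absum -big_split /=; apply: eq_bigr => i _; rewrite big_ord_recr.
  rewrite addrAC [X in _ <= X]addrAC; apply: le_trans (nmD _ _) _; apply: lerD => //.
  by apply: le_trans (nm_sum _ _ _) _; apply: ler_sum => i _; exact: nm_term_le.
rewrite -(subnKC nn); elim: (n' - n)%N => [|k IH]; first by rewrite addn0 !subrr nm0.
rewrite addnS /psum /absum !big_ord_recr /= -/(psum _ _ _ _ _) -/(absum _ _ _ _).
rewrite addrAC [X in _ <= X]addrAC; apply: le_trans (nmD _ _) _; apply: lerD => //.
by apply: le_trans (nm_sum _ _ _) _; apply: ler_sum => i _; exact: nm_term_le.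
Qed.

Definition bounded c r := exists M, forall N, absum c r N N <= M.

(** Absolute summability compares a rectangle with a square contained in it, so convergence along
    squares suffices. *)
Lemma tends2_of_diag c u v r l : nm u <= r -> nm v <= r -> bounded c r ->
  (forall e : R, 0 < e -> exists N0, forall N, (N0 <= N)%N -> nm (psum c u v N N - l) < e) ->
  tends2 c u v l.
Proof.
move=> ur vr [M AM] diag e e0; have r0 : 0 <= r := le_trans (nm_ge0 u) ur.
pose A := [set absum c r N N | N in [set: nat]].
have supA : has_sup A.
  split; first by exists (absum c r 0 0), 0%N.
  by exists M => _ [N _ <-].
have e2 : 0 < e / 2 by lra.
have [_ [N1 _ <-] hN1] := sup_adherent e2 supA.
have Asup N : absum c r N N <= sup A by apply: sup_upper_bound => //; exists N.
have [N0 hN0] := diag _ e2; pose N := maxn N0 N1; exists N => n m Nn Nm.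
have h1 : nm (psum c u v N N - l) < e / 2 by apply: hN0; exact: leq_maxl.
have h2 := psum_rect c ur vr Nn Nm.
have h3 : absum c r n m <= sup A.
  by apply: le_trans (Asup (maxn n m)); apply: absum_rect; rewrite ?leq_maxl ?leq_maxr.
have h4 : absum c r N1 N1 <= absum c r N N by apply: absum_rect; rewrite ?leq_maxr.
rewrite (_ : _ - l = (psum c u v n m - psum c u v N N) + (psum c u v N N - l)); last by ring.
by apply: le_lt_trans (nmD _ _) _; lra.
Qed.

Lemma tends2_exists c u v r : nm u <= r -> nm v <= r -> bounded c r ->
  exists l, tends2 c u v l.
Proof.
move=> ur vr [M AM]; have r0 : 0 <= r := le_trans (nm_ge0 u) ur.
have [m||l lP] := @bounded_variation_cvg _ (fun N => psum c u v N N) (fun N => absum c r N N).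
- exact: psum_rect.
- by exists M.
exists l; apply: (tends2_of_diag ur vr); first by exists M.
move=> e e0; pose A := [set absum c r N N | N in [set: nat]].
have supA : has_sup A.
  split; first by exists (absum c r 0 0), 0%N.
  by exists M => _ [N _ <-].
have e2 : 0 < e / 4 by lra.
have [_ [N1 _ <-] hN1] := sup_adherent e2 supA.
have Asup N : absum c r N N <= sup A by apply: sup_upper_bound => //; exists N.
exists N1 => N N1N; apply: le_lt_trans (lP _ Asup N) _.
have : absum c r N1 N1 <= absum c r N N by exact: absum_rect.
by lra.
Qed.

Lemma tends2_unique c u v l l' : tends2 c u v l -> tends2 c u v l' -> l = l'.
Proof.
move=> h h'; apply/eqP; rewrite -subr_eq0 -nm_eq0 eq_le nm_ge0 andbT leNgt; apply/negP => e0.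
have e2 : 0 < nm (l - l') / 2 by lra.
have [N hN] := h _ e2; have [N' hN'] := h' _ e2.
have h1 := hN (maxn N N') (maxn N N') (leq_maxl _ _) (leq_maxl _ _).
have h2 := hN' (maxn N N') (maxn N N') (leq_maxr _ _) (leq_maxr _ _).
have := nmB (psum c u v (maxn N N') (maxn N N') - l') (psum c u v (maxn N N') (maxn N N') - l).
by rewrite (_ : _ - _ - _ = l - l'); [lra|ring].
Qed.

Lemma tends2_ext c c' u v l : (forall i j, c i j = c' i j) -> tends2 c u v l -> tends2 c' u v l.
Proof.
move=> cc h e e0; have [N hN] := h e e0; exists N => n m Nn Nm.
rewrite (_ : psum c' u v n m = psum c u v n m); first exact: hN.
by apply: eq_bigr => i _; apply: eq_bigr => j _; rewrite cc.
Qed.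

Lemma tends2D c d u v l l' : tends2 c u v l -> tends2 d u v l' ->
  tends2 (fun i j => c i j + d i j) u v (l + l').
Proof.
move=> h h' e e0; have e2 : 0 < e / 2 by lra.
have [N hN] := h _ e2; have [N' hN'] := h' _ e2.
exists (maxn N N') => n m; rewrite !geq_max => /andP[n1 n2] /andP[m1 m2].
have -> : psum (fun i j => c i j + d i j) u v n m = psum c u v n m + psum d u v n m.
  rewrite -big_split /=; apply: eq_bigr => i _; rewrite -big_split /=.
  by apply: eq_bigr => j _; ring.
rewrite (_ : _ + _ - _ = (psum c u v n m - l) + (psum d u v n m - l')); last by ring.
by apply: le_lt_trans (nmD _ _) _; have := hN n m n1 m1; have := hN' n m n2 m2; lra.
Qed.

Lemma absumD c d r n m : 0 <= r ->
  absum (fun i j => c i j + d i j) r n m <= absum c r n m + absum d r n m.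
Proof.
move=> r0; rewrite -big_split /=; apply: ler_sum => i _; rewrite -big_split /=.
by apply: ler_sum => j _; rewrite -mulrDl ler_wpM2r ?exprn_ge0 ?nmD.
Qed.

Lemma boundedD c d r : 0 <= r -> bounded c r -> bounded d r -> bounded (fun i j => c i j + d i j) r.
Proof.
move=> r0 [M hM] [M' hM']; exists (M + M') => N.
by apply: le_trans (absumD _ _ _ _ r0) _; exact: lerD.
Qed.

Lemma tends2Z k c u v l : tends2 c u v l -> tends2 (fun i j => k * c i j) u v (k * l).
Proof.
move=> h e e0; have k0 : 0 < nm k + 1 by have := nm_ge0 k; lra.
have [N hN] := h (e / (nm k + 1)) (divr_gt0 e0 k0).
exists N => n m Nn Nm; have := hN n m Nn Nm.
have -> : psum (fun i j => k * c i j) u v n m = k * psum c u v n m.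
  rewrite mulr_sumr; apply: eq_bigr => i _; rewrite mulr_sumr.
  by apply: eq_bigr => j _; ring.
rewrite -mulrBr nmM ltr_pdivlMr// => hh; apply: le_lt_trans hh.
by rewrite mulrC ler_wpM2l ?nm_ge0// lerDl.
Qed.

Lemma boundedZ k c r : 0 <= r -> bounded c r -> bounded (fun i j => k * c i j) r.
Proof.
move=> r0 [M hM]; exists (nm k * M) => N.
have -> : absum (fun i j => k * c i j) r N N = nm k * absum c r N N.
  rewrite mulr_sumr; apply: eq_bigr => i _; rewrite mulr_sumr.
  by apply: eq_bigr => j _; rewrite nmM mulrA.
by rewrite ler_wpM2l ?nm_ge0.
Qed.

Definition monomial_shift a b c i j :=
  if (a <= i)%N && (b <= j)%N then c (i - a)%N (j - b)%N else 0.

Lemma sum_shift (V : nmodType) a n (f g : nat -> V) : (forall i, (i < a)%N -> f i = 0) ->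
  (forall i, f (a + i)%N = g i) -> \sum_(i < a + n) f i = \sum_(i < n) g i.
Proof.
move=> f0 fg; rewrite big_split_ord /= big1 ?add0r => [|i _]; last exact: f0.
by apply: eq_bigr => i _; exact: fg.
Qed.

Lemma psum_shift a b c u v n m :
  psum (monomial_shift a b c) u v (a + n) (b + m) = u ^+ a * v ^+ b * psum c u v n m.
Proof.
rewrite /psum mulr_sumr.
apply: (@sum_shift _ a n (fun i => \sum_(j < b + m) monomial_shift a b c i j * u ^+ i * v ^+ j)
  (fun i => u ^+ a * v ^+ b * \sum_(j < m) c i j * u ^+ i * v ^+ j)) => [i ia|i].
  by rewrite big1// => j _; rewrite /monomial_shift leqNgt ia /= !mul0r.
rewrite mulr_sumr; apply: (@sum_shift _ b m (fun j => monomial_shift a b c (a + i) j * u ^+ (a +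
  i) * v ^+ j)
  (fun j => u ^+ a * v ^+ b * (c i j * u ^+ i * v ^+ j))) => [j jb|j].
  by rewrite /monomial_shift [(b <= j)%N]leqNgt jb andbF /= !mul0r.
rewrite /monomial_shift !leq_addr /= !addKn !exprD; ring.
Qed.

Lemma absum_shift a b c r n m :
  absum (monomial_shift a b c) r (a + n) (b + m) = r ^+ (a + b) * absum c r n m.
Proof.
rewrite /absum mulr_sumr.
apply: (@sum_shift _ a n (fun i => \sum_(j < b + m) nm (monomial_shift a b c i j) * r ^+ (i + j))
  (fun i => r ^+ (a + b) * \sum_(j < m) nm (c i j) * r ^+ (i + j))) => [i ia|i].
  by rewrite big1// => j _; rewrite /monomial_shift leqNgt ia /= nm0 mul0r.
rewrite mulr_sumr; apply: (@sum_shift _ b m (fun j => nm (monomial_shift a b c (a + i) j) * r ^+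
  (a + i + j))
  (fun j => r ^+ (a + b) * (nm (c i j) * r ^+ (i + j)))) => [j jb|j].
  by rewrite /monomial_shift [(b <= j)%N]leqNgt jb andbF /= nm0 mul0r.
rewrite /monomial_shift !leq_addr /= !addKn !exprD; ring.
Qed.

Lemma bounded_shift a b c r : 0 <= r -> bounded c r -> bounded (monomial_shift a b c) r.
Proof.
move=> r0 [M hM]; exists (r ^+ (a + b) * M) => N.
apply: le_trans (_ : absum (monomial_shift a b c) r (a + N) (b + N) <= _).
  by apply: absum_rect; rewrite ?leq_addl.
by rewrite absum_shift ler_wpM2l ?exprn_ge0.
Qed.

Lemma tends2_shift a b c u v l : tends2 c u v l ->
  tends2 (monomial_shift a b c) u v (u ^+ a * v ^+ b * l).
Proof.
move=> /(tends2Z (u ^+ a * v ^+ b)) h e e0; have [N hN] := h e e0.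
exists (a + b + N)%N => n m Nn Nm; have := hN (n - a)%N (m - b)%N.
have -> : psum (fun i j => u ^+ a * v ^+ b * c i j) u v (n - a) (m - b) =
    psum (monomial_shift a b c) u v n m.
  have -> : psum (monomial_shift a b c) u v n m =
      psum (monomial_shift a b c) u v (a + (n - a)) (b + (m - b)) by congr psum; lia.
  rewrite psum_shift mulr_sumr; apply: eq_bigr => i _; rewrite mulr_sumr.
  by apply: eq_bigr => j _; ring.
by apply; lia.
Qed.

Lemma tends2_const k u v : tends2 (fun i j => if (i == 0)%N && (j == 0)%N then k else 0) u v k.
Proof.
move=> e e0; exists 1%N => n m n1 m1.
rewrite (_ : psum _ u v n m = k) ?subrr ?nm0//.
case: n m n1 m1 => [|n] [|m] // _ _; rewrite /psum big_ord_recl [X in _ + X]big1 ?addr0 => [|i _].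
  rewrite big_ord_recl [X in _ + X]big1 ?addr0 => [|j _] /=; first by rewrite !expr0 !mulr1.
  by rewrite !mul0r.
by rewrite big1// => j _; rewrite /= !mul0r.
Qed.

Lemma bounded_const k r : bounded (fun i j => if (i == 0)%N && (j == 0)%N then k else 0) r.
Proof.
exists (nm k) => -[|n]; rewrite /absum; first by rewrite big_ord0 nm_ge0.
rewrite big_ord_recl [X in _ + X]big1 ?addr0 => [|i _].
  rewrite big_ord_recl [X in _ + X]big1 ?addr0 => [|j _] /=; first by rewrite addn0 expr0 mulr1.
  by rewrite nm0 mul0r.
by rewrite big1// => j _; rewrite /= nm0 mul0r.
Qed.

Lemma boundedW c r r' : 0 <= r' -> r' <= r -> bounded c r -> bounded c r'.
Proof.
move=> r0 rr [M hM]; exists M => N; apply: le_trans (hM N).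
apply: ler_sum => i _; apply: ler_sum => j _.
by rewrite ler_wpM2l ?nm_ge0 ?lerXn2r ?nnegrE ?(le_trans r0 rr).
Qed.

End PowerSeries.

(** * Germs of holomorphic functions *)

Lemma tends2_sum (R : realType) (u v : R[i]) (I : Type) (s : seq I) (P : pred I)
    (F : I -> nat -> nat -> R[i]) (L : I -> R[i]) :
  (forall k, tends2 (F k) u v (L k)) ->
  tends2 (fun i j => \sum_(k <- s | P k) F k i j) u v (\sum_(k <- s | P k) L k).
Proof.
move=> h; elim: s => [|k s IH].
  by rewrite big_nil; apply: tends2_ext (tends2_const 0 u v) => i j; rewrite big_nil if_same.
rewrite big_cons; case: (boolP (P k)) => Pk.
  by apply: tends2_ext (tends2D (h k) IH) => i j; rewrite big_cons Pk.
by apply: tends2_ext IH => i j; rewrite big_cons (negbTE Pk).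
Qed.

Section Germs.
Variable R : realType.
Local Notation C := R[i].
Local Notation T := {poly {poly C}}.
Variable q : C * C.
Implicit Types (f g e : C * C -> C).

Definition close (r : R) (z : C * C) := nm (z.1 - q.1) < r /\ nm (z.2 - q.2) < r.

Definition hol f := exists c r, [/\ 0 < r, bounded c r &
  forall z, close r z -> tends2 c (z.1 - q.1) (z.2 - q.2) (f z)].

Definition near_eq f g := exists2 r, 0 < r & forall z, close r z -> f z = g z.

Lemma closeW r r' z : r' <= r -> close r' z -> close r z.
Proof. by move=> rr [h1 h2]; split; exact: lt_le_trans rr. Qed.

Lemma near_eq_sym f g : near_eq f g -> near_eq g f.
Proof. by move=> [r r0 h]; exists r => // z /h ->. Qed.

Lemma near_eq_trans f g h : near_eq f g -> near_eq g h -> near_eq f h.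
Proof.
move=> [r r0 h1] [s s0 h2]; exists (Num.min r s); first by rewrite lt_min r0.
move=> z cz; rewrite h1 ?h2//; apply: closeW cz; rewrite ge_min lexx ?orbT//.
Qed.

Lemma near_eq_op2 (op : C -> C -> C) f g f' g' : near_eq f f' -> near_eq g g' ->
  near_eq (fun z => op (f z) (g z)) (fun z => op (f' z) (g' z)).
Proof.
move=> [r r0 h1] [s s0 h2]; exists (Num.min r s); first by rewrite lt_min r0.
move=> z cz; rewrite h1 ?h2//; apply: closeW cz; rewrite ge_min lexx ?orbT//.
Qed.

Lemma near_eqW f g : f =1 g -> near_eq f g.
Proof. by move=> fg; exists 1 => // z _; exact: fg. Qed.

Lemma hol_ext f g : f =1 g -> hol f -> hol g.
Proof. by move=> fg [c [r [r0 bc h]]]; exists c, r; split => // z cz; rewrite -fg; exact: h. Qed.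

Lemma holD f g : hol f -> hol g -> hol (fun z => f z + g z).
Proof.
move=> [c [r [r0 bc hf]]] [d [s [s0 bd hg]]].
have m0 : 0 < Num.min r s by rewrite lt_min r0.
have mr : Num.min r s <= r by rewrite ge_min lexx.
have ms : Num.min r s <= s by rewrite ge_min lexx orbT.
exists (fun i j => c i j + d i j), (Num.min r s); split => //.
  by apply: boundedD; [exact: ltW|apply: boundedW mr bc; exact: ltW|apply: boundedW ms bd;
    exact: ltW].
by move=> z cz; apply: tends2D; [exact: hf (closeW mr cz)|exact: hg (closeW ms cz)].
Qed.

Lemma holZ k f : hol f -> hol (fun z => k * f z).
Proof.
move=> [c [r [r0 bc hf]]]; exists (fun i j => k * c i j), r; split => //.
  by apply: boundedZ => //; exact: ltW.
by move=> z cz; apply: tends2Z; exact: hf.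
Qed.

Lemma hol_const k : hol (fun=> k).
Proof.
eexists; exists 1; split => //; first exact: bounded_const.
by move=> z _; exact: tends2_const.
Qed.

Lemma hol_monomial a b f : hol f -> hol (fun z => (z.1 - q.1) ^+ a * (z.2 - q.2) ^+ b * f z).
Proof.
move=> [c [r [r0 bc hf]]]; exists (monomial_shift a b c), r; split => //.
  by apply: bounded_shift => //; exact: ltW.
by move=> z cz; apply: tends2_shift; exact: hf.
Qed.

Lemma hol_ev2 (p : T) f : hol f -> hol (fun z => ev2 z.1 z.2 p * f z).
Proof.
move=> hf; elim/poly_ind: p => [|p s IH].
  by apply: hol_ext (hol_const 0) => z; rewrite rmorph0 mul0r.
have hs : hol (fun z => s.[z.1] * f z).
  elim/poly_ind: s => [|s k IHs].
    by apply: hol_ext (hol_const 0) => z; rewrite horner0 mul0r.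
  apply: hol_ext (holD (holD (hol_monomial 1 0 IHs) (holZ q.1 IHs)) (holZ k hf)) => z.
  by rewrite hornerMXaddC expr1 expr0; ring.
apply: hol_ext (holD (holD (hol_monomial 0 1 IH) (holZ q.2 IH)) hs) => z.
by rewrite rmorphD rmorphM /= ev2X ev2C expr1 expr0; ring.
Qed.

Lemma ev2_taylor (p : T) : exists K (s : 'I_K * 'I_K -> C), forall z,
  ev2 z.1 z.2 p = \sum_kl s kl * ((z.1 - q.1) ^+ kl.1 * (z.2 - q.2) ^+ kl.2).
Proof.
pose p' : T := map_poly (comp_poly ('X + q.1%:P)) p \Po ('X + q.2%:P%:P).
have [K pK] := bdeg_ex p'; exists K, (fun kl : 'I_K * 'I_K => p'`_kl.2`_kl.1) => z.
have -> : ev2 z.1 z.2 p = ev2 (z.1 - q.1) (z.2 - q.2) p'.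
  rewrite /p' /ev2 horner_comp !hornerE -polyCD subrK.
  rewrite -[LHS]/(ev2 z.1 z.2 p) -[RHS]/(ev2 (z.1 - q.1) z.2 (map_poly _ p)) -!horner_fib.
  rewrite -map_poly_comp; congr (_.[_]).
  apply: eq_map_poly => s /=; rewrite !horner_evalE horner_comp !hornerE.
  by rewrite subrK.
rewrite {1}(bdeg_expand pK) rmorph_sum; apply: eq_bigr => kl _.
by rewrite !rmorphM /= !rmorphXn /= !ev2C ev2X hornerX hornerC.
Qed.

(** N is fuel: each call lowers i + j, so the value no longer changes once N exceeds i + j. The
    divisor is understood to have constant term 1. *)
Fixpoint quotient_coef K (s : 'I_K * 'I_K -> C) (c : nat -> nat -> C) N i j : C :=
  if N is N'.+1 then
    c i j - \sum_(kl : 'I_K * 'I_K | (0 < kl.1 + kl.2)%N)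
      if (kl.1 <= i)%N && (kl.2 <= j)%N
      then s kl * quotient_coef s c N' (i - kl.1)%N (j - kl.2)%N else 0
  else 0.

Lemma quotient_coef_stable K (s : 'I_K * 'I_K -> C) c N M i j :
  (i + j < N)%N -> (i + j < M)%N -> quotient_coef s c N i j = quotient_coef s c M i j.
Proof.
elim: N M i j => // N IH [|M]// i j iN jM /=; congr (_ - _).
apply: eq_bigr => kl kl0; case: ifP => // /andP[ki lj].
by congr (_ * _); apply: IH; lia.
Qed.

(* The coefficients of the quotient are solved for recursively; they are
   absolutely summable for a radius at which the non-constant part of s has norm
   at most 1/2. *)
Lemma hol_div (p : T) f : ev2 q.1 q.2 p != 0 -> hol f -> hol (fun z => f z / ev2 z.1 z.2 p).
Proof.
move=> p0 hf.
(* The divisor is normalized to have constant term 1. *)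
have [K [s sE]] := ev2_taylor ((ev2 q.1 q.2 p)^-1%:P%:P * p).
set k0 := ev2 q.1 q.2 p in p0 sE.
suff : hol (fun z => f z / ev2 z.1 z.2 (k0^-1%:P%:P * p)).
  move=> /(holZ k0^-1); apply: hol_ext => z.
  by rewrite rmorphM /= !ev2C hornerC invfM invrK mulrCA mulKf.
have s1 : \sum_(kl : 'I_K * 'I_K | (kl.1 + kl.2 == 0)%N) s kl = 1.
  transitivity (ev2 q.1 q.2 (k0^-1%:P%:P * p)); last first.
    by rewrite rmorphM /= !ev2C hornerC mulVf.
  rewrite (sE q) big_mkcond; apply: eq_bigr => -[k l] _ /=; rewrite !subrr !expr0n addn_eq0.
  by rewrite -natrM mulnb mulr_natr; case: (_ && _).
have [c [r [r0 bc hfc]]] := hf.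
pose B : R := \sum_kl nm (s kl).
have B0 : 0 <= B by apply: sumr_ge0 => kl _; exact: nm_ge0.
pose r' := Num.min r (1 / (2 * (B + 1))).
have r'0 : 0 < r' by rewrite lt_min r0 divr_gt0//; lra.
have r'r : r' <= r by rewrite ge_min lexx.
have r'1 : r' <= 1 / (2 * (B + 1)) by rewrite ge_min lexx orbT.
have r'B : r' * B <= 1 / 2.
  have : r' * B <= 1 / (2 * (B + 1)) * B by rewrite ler_wpM2r.
  by move/le_trans; apply; rewrite mul1r ler_pdivrMl; have := B0; lra.
have r'le1 : r' <= 1 by apply: le_trans r'1 _; rewrite ler_pdivrMr; lra.
have half (rho : R) : 0 <= rho -> rho <= r' ->
    \sum_(kl : 'I_K * 'I_K | (0 < kl.1 + kl.2)%N) nm (s kl) * rho ^+ (kl.1 + kl.2) <= 1 / 2.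
  move=> rho0 rhor; apply: le_trans (_ : \sum_(kl : 'I_K * 'I_K | (0 < kl.1 + kl.2)%N) nm (s kl)
    * r' <= _).
    apply: ler_sum => kl kl0; rewrite ler_wpM2l ?nm_ge0//.
    rewrite -(prednK kl0) exprS; apply: le_trans (_ : r' * 1 <= _); last by rewrite mulr1.
    by rewrite ler_pM ?exprn_ge0// exprn_ile1// (le_trans rhor).
  rewrite -mulr_suml mulrC; apply: le_trans r'B; rewrite ler_wpM2l ?(ltW r'0)//.
  by rewrite [leLHS]big_mkcond; apply: ler_sum => kl _; case: ifP => // _; exact: nm_ge0.
pose d i j := quotient_coef s c (i + j).+1 i j.
have dE i j : d i j = c i j - \sum_(kl : 'I_K * 'I_K | (0 < kl.1 + kl.2)%N) s kl * monomial_shift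
  kl.1 kl.2 d i j.
  rewrite {1}/d /=; congr (_ - _); apply: eq_bigr => kl kl0.
  rewrite /monomial_shift; case: ifP => [/andP[ki lj]|_]; last by rewrite mulr0.
  by congr (_ * _); apply: quotient_coef_stable; lia.
have cE i j : \sum_kl s kl * monomial_shift kl.1 kl.2 d i j = c i j.
  rewrite (bigID (fun kl : 'I_K * 'I_K => (0 < kl.1 + kl.2)%N)) /=.
  rewrite [X in _ + X](_ : _ = d i j); first by rewrite dE addrC subrK.
  rewrite -[RHS]mul1r -s1 mulr_suml; apply: eq_big => [kl|kl]; first by rewrite -eqn0Ngt.
  rewrite -eqn0Ngt addn_eq0 => /andP[/eqP -> /eqP ->].
  by rewrite /monomial_shift /= !subn0.
have [M hM] : bounded c r' by apply: boundedW r'r bc; exact: ltW.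
(* Each finite sum of the |d i j| is at most M plus half of itself, hence at most 2 M. *)
have bd : bounded d r'.
  exists (2 * M) => N.
  have : absum d r' N N <= M + 1 / 2 * absum d r' N N; last by lra.
  apply: le_trans (_ : absum c r' N N + \sum_(kl : 'I_K * 'I_K | (0 < kl.1 + kl.2)%N)
      nm (s kl) * absum (monomial_shift kl.1 kl.2 d) r' N N <= _).
    rewrite /absum; under [X in _ <= _ + X]eq_bigr do rewrite mulr_sumr.
    rewrite [X in _ <= _ + X]exchange_big /= -big_split /=; apply: ler_sum => i _.
    under [X in _ <= _ + X]eq_bigr do rewrite mulr_sumr.
    rewrite [X in _ <= _ + X]exchange_big /= -big_split /=; apply: ler_sum => j _.
    rewrite dE; under [X in _ <= _ + X]eq_bigr do rewrite mulrA -nmM.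
    rewrite -mulr_suml -mulrDl ler_wpM2r ?exprn_ge0 ?(ltW r'0)//.
    by apply: le_trans (nmB _ _) _; rewrite lerD2l; exact: nm_sum.
  apply: lerD => //.
  apply: le_trans (_ : \sum_(kl : 'I_K * 'I_K | (0 < kl.1 + kl.2)%N) nm (s kl) * r' ^+ (kl.1 +
    kl.2) * absum d r' N N <= _).
    apply: ler_sum => kl _; rewrite -mulrA ler_wpM2l ?nm_ge0// -absum_shift.
    by apply: absum_rect; rewrite ?(ltW r'0) ?leq_addl.
  by rewrite -mulr_suml ler_wpM2r ?absum_ge0 ?(ltW r'0)// half ?(ltW r'0).
exists d, r'; split => // z cz; have [z1 z2] := cz.
have [l dl] := tends2_exists (ltW z1) (ltW z2) bd.
suff -> : f z / ev2 z.1 z.2 (k0^-1%:P%:P * p) = l by [].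
set S := ev2 _ _ _; have SE : S = 1 + \sum_(kl : 'I_K * 'I_K | (0 < kl.1 + kl.2)%N)
    s kl * ((z.1 - q.1) ^+ kl.1 * (z.2 - q.2) ^+ kl.2).
  rewrite /S sE (bigID (fun kl : 'I_K * 'I_K => (0 < kl.1 + kl.2)%N)) /= addrC; congr (_ + _).
  rewrite -s1; apply: eq_big => [kl|kl]; first by rewrite -eqn0Ngt.
  by rewrite -eqn0Ngt addn_eq0 => /andP[/eqP -> /eqP ->]; rewrite !expr0 !mulr1.
have S0 : S != 0.
  pose rho := Num.max (nm (z.1 - q.1)) (nm (z.2 - q.2)).
  have rho1 : nm (z.1 - q.1) <= rho by rewrite le_max lexx.
  have rho2 : nm (z.2 - q.2) <= rho by rewrite le_max lexx orbT.
  have rho0 : 0 <= rho := le_trans (nm_ge0 _) rho1.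
  have rhor : rho <= r' by rewrite ge_max !ltW.
  rewrite -nm_gt0 SE; have := half _ rho0 rhor.
  set X := \sum_(kl : 'I_K * 'I_K | _) _; set Y := \sum_(kl : 'I_K * 'I_K | _) _ => XY.
  have : nm Y <= X.
    apply: le_trans (nm_sum _ _ _) _; apply: ler_sum => kl _.
    by rewrite mulrA; exact: nm_term_le.
  by have := nm_geD 1 Y; rewrite nm1; lra.
suff SL : tends2 c (z.1 - q.1) (z.2 - q.2) (S * l).
  by rewrite (tends2_unique (hfc _ (closeW r'r cz)) SL) mulrC mulKf.
rewrite /S sE mulr_suml; apply: tends2_ext cE _.
apply: tends2_sum => kl; rewrite -mulrA; apply: tends2Z; exact: tends2_shift.
Qed.

(* Split the power series into its constant term, the terms divisible by the
   first variable, and the remaining ones. *)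
Lemma hol_split f : hol f -> exists k f1 f2, [/\ hol f1, hol f2 &
  near_eq f (fun z => k + (z.1 - q.1) * f1 z + (z.2 - q.2) * f2 z)].
Proof.
move=> [c [r [r0 [M hM] hf]]].
pose c1 i j := c i.+1 j; pose c2 i j := if i == 0%N then c 0%N j.+1 else 0.
have r1 : 0 <= r by exact: ltW.
have b1 : bounded c1 r.
  exists (M / r) => N; rewrite ler_pdivlMr//; apply: le_trans (hM N.+1).
  apply: le_trans (_ : absum c r N.+1 N <= _); last exact: absum_rect.
  rewrite /absum big_ord_recl mulr_suml; apply: ler_wpDl; first by apply: sumr_ge0 => j _;
    rewrite mulr_ge0 ?nm_ge0 ?exprn_ge0.
  apply: ler_sum => i _; rewrite mulr_suml; apply: ler_sum => j _.
  by rewrite /c1 lift0 addSn exprSr mulrA.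
have b2 : bounded c2 r.
  exists (M / r) => N; rewrite ler_pdivlMr//; apply: le_trans (hM N.+1).
  apply: le_trans (_ : absum c r N N.+1 <= _); last exact: absum_rect.
  rewrite /absum mulr_suml; apply: ler_sum => i _; rewrite big_ord_recl mulr_suml.
  apply: ler_wpDl; first by rewrite mulr_ge0 ?nm_ge0 ?exprn_ge0.
  apply: ler_sum => j _; rewrite /c2 lift0; case: eqP => [->|_].
    by rewrite !add0n exprSr mulrA.
  by rewrite nm0 !mul0r mulr_ge0 ?nm_ge0 ?exprn_ge0.
have lim (c' : nat -> nat -> C) : bounded c' r -> exists g, forall z, close r z ->
    tends2 c' (z.1 - q.1) (z.2 - q.2) (g z).
  move=> bc'.
  have /choice[g gP] (z : C * C) : exists l, close r z -> tends2 c' (z.1 - q.1) (z.2 - q.2) l.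
    have [cz|nz] := pselect (close r z); last by exists 0.
    by have [l hl] := tends2_exists (ltW cz.1) (ltW cz.2) bc'; exists l.
  by exists g.
have [f1 h1] := lim c1 b1; have [f2 h2] := lim c2 b2.
exists (c 0%N 0%N), f1, f2; split.
- by exists c1, r; split.
- by exists c2, r; split.
exists r => // z cz; apply: tends2_unique (hf z cz) _.
have := tends2D (tends2D (tends2_const (c 0%N 0%N) (z.1 - q.1) (z.2 - q.2))
  (tends2_shift 1 0 (h1 z cz))) (tends2_shift 0 1 (h2 z cz)).
rewrite !expr0 !expr1 !mulr1 !mul1r; apply: tends2_ext => i j.
rewrite /monomial_shift /c1 /c2 subn0; case: i => [|i]; case: j => [|j];
by rewrite /= ?subn1 ?subn0 ?addr0 ?add0r //= ?subSS ?subn0.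
Qed.

End Germs.

(** * The local ideals *)

Section ZeroCurve.
Variable R : realType.
Local Notation C := R[i].

Lemma poly_bounded (p : {poly C}) (x0 : C) :
  exists2 M : R, 0 <= M & forall x, nm (x - x0) <= 1 -> nm p.[x] <= M.
Proof.
elim/poly_ind: p => [|p c [M M0 hM]].
  by exists 0 => // x _; rewrite horner0 nm0.
exists (M * (nm x0 + 1) + nm c) => [|x hx].
  by rewrite addr_ge0 ?nm_ge0 ?mulr_ge0// addr_ge0 ?nm_ge0.
rewrite hornerMXaddC; apply: le_trans (nmD _ _) _; rewrite lerD2r nmM.
apply: nm_mul_le; first exact: hM.
by have := nmD (x - x0) x0; rewrite subrK; lra.
Qed.

Lemma nearby_nonzero (p : {poly C}) (y0 : C) (e : R) : 0 < e -> p != 0 ->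
  exists2 y, nm (y - y0) <= e & p.[y] != 0.
Proof.
move=> e0 p0; apply: contrapT => h.
pose s (i : 'I_(size p)) : C := y0 + (e / i.+1%:R)%:C%C.
have sinj : injective s.
  move=> i j /addrI/complexI/(mulfI (lt0r_neq0 e0))/invr_inj/eqP.
  by rewrite eqr_nat eqSS => /eqP/val_inj.
suff : (size p < size p)%N by rewrite ltnn.
rewrite -[X in (X < _)%N]card_ord -(size_codom s).
apply: max_poly_roots => //; last by rewrite -/(injectiveb s); exact/injectiveP.
apply/allP => _ /codomP[i ->]; apply: contrapT => si; apply: h; exists (s i); last exact/negP.
rewrite /s addrC addKr nm_real ger0_norm; last by rewrite divr_ge0 ?ltW.
by rewrite ler_pdivrMr ?ltr0n// ler_peMr ?ler1n ?ltW.
Qed.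

(** Continuity of roots by hand. Take y1 with |y1 - y0| <= e / 2 and h(x0, y1) non-zero. If h(x, .)
    had no root within e of y0, every root z would satisfy |y1 - z| <= 2 |y0 - z|, so |h(x, y1)|
    would be at most a fixed power of 2 times |h(x, y0)|, which tends to 0 as x tends to x0. *)
Lemma zero_curve (h : {poly {poly C}}) (q : C * C) (e : R) : ev2 q.1 q.2 h = 0 -> 0 < e ->
  exists z, [/\ z != q, close q e z & ev2 z.1 z.2 h = 0].
Proof.
case: q => x0 y0 /= h0 e0.
have [f0|f0] := eqVneq (fib x0 h) 0.
  (* Here the whole line x = x0 consists of zeros. *)
  exists (x0, y0 + (e / 2)%:C%C); split.
  - rewrite xpair_eqE eqxx /= -subr_eq0 addrC addKr -nm_gt0 nm_real normr_gt0.
    by rewrite mulf_neq0 ?lt0r_neq0.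
  - split; rewrite /= ?subrr ?nm0// addrC addKr nm_real ger0_norm; lra.
  - by rewrite -horner_fib f0 horner0.
have e2 : 0 < e / 2 by lra.
have [y1 y1e hy1] := nearby_nonzero y0 e2 f0.
have [p pE] : exists p, h.[y0%:P] = p * ('X - x0%:P) by apply/factor_theorem/rootP.
have [p' p'E] : exists p', h.[y1%:P] = p' * ('X - x0%:P) + (ev2 x0 y1 h)%:P.
  have /factor_theorem[p' p'E] : root (h.[y1%:P] - (ev2 x0 y1 h)%:P) x0.
    by rewrite /root !hornerE subrr.
  by exists p'; rewrite -p'E subrK.
have [M M0 hM] := poly_bounded p x0; have [M' M'0 hM'] := poly_bounded p' x0.
rewrite horner_fib -nm_gt0 in hy1; set c := nm (ev2 x0 y1 h) in hy1.
pose k : R := 2 ^+ size h * M + M' + 1.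
have k0 : 0 < k.
  have : 0 <= 2 ^+ size h * M by rewrite mulr_ge0 ?exprn_ge0.
  by rewrite /k; lra.
pose d : R := Num.min 1 (Num.min (e / 2) (c / k / 2)).
have d0 : 0 < d by rewrite !lt_min ltr01 e2 !divr_gt0.
have d1 : d <= 1 by rewrite ge_min lexx.
have de : d <= e / 2 by rewrite !ge_min lexx orbT.
have dc : d * k <= c / 2.
  have : d <= c / k / 2 by rewrite !ge_min lexx !orbT.
  by rewrite -(ler_pM2r k0) => /le_trans; apply; rewrite le_eqVlt; apply/orP; left; apply/eqP;
    field; rewrite lt0r_neq0.
pose x : C := x0 + d%:C%C.
have xd : nm (x - x0) = d by rewrite /x addrC addKr nm_real ger0_norm// ltW.
have x_x0 : x != x0 by rewrite -subr_eq0 -nm_gt0 xd.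
have hx0 : nm (ev2 x y0 h) <= M * d.
  by rewrite /ev2 pE hornerM hornerXsubC nmM xd ler_wpM2r ?(ltW d0)// hM// xd.
have hx1 : c - M' * d <= nm (ev2 x y1 h).
  rewrite [ev2 x y1 h]/ev2 p'E hornerD hornerM hornerXsubC hornerC.
  apply: le_trans (nm_geDr _ _); rewrite lerD2l lerN2 nmM xd ler_wpM2r ?(ltW d0)//.
  by rewrite hM' ?xd.
have key : 2 ^+ size h * nm (ev2 x y0 h) < nm (ev2 x y1 h).
  apply: le_lt_trans (_ : 2 ^+ size h * (M * d) < _); first by rewrite ler_wpM2l ?exprn_ge0.
  apply: lt_le_trans hx1; rewrite /k in dc.
  have : d * (2 ^+ size h * M + M' + 1) = 2 ^+ size h * (M * d) + M' * d + d by ring.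
  by lra.
have [rs rsE] := closed_field_poly_normal (fib x h).
have r0 : fib x h != 0.
  apply: contraTneq key => r0; rewrite -!horner_fib r0 !horner0 nm0 mulr0 ltxx//.
have srs : (size rs <= size h)%N.
  have sfib : (size (fib x h) <= size h)%N by exact: size_poly.
  apply: leq_trans sfib; rewrite rsE size_scale ?lead_coef_eq0// size_prod_XsubC; exact: leqnSn.
have [[z zrs ze]|noz] := pselect (exists2 z, z \in rs & nm (z - y0) < e).
  exists (x, z); split.
  - by rewrite xpair_eqE (negbTE x_x0).
  - by split => //=; rewrite xd; lra.
  - rewrite -horner_fib rsE hornerZ (_ : _.[z] = 0) ?mulr0//.
    by apply/rootP; rewrite root_prod_XsubC.
suff : nm (ev2 x y1 h) <= 2 ^+ size h * nm (ev2 x y0 h) by rewrite leNgt key.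
apply: le_trans (_ : 2 ^+ size rs * nm (ev2 x y0 h) <= _); last first.
  by rewrite ler_wpM2r ?nm_ge0// ler_weXn2l// ler1n.
rewrite -!horner_fib rsE !hornerZ !nmM mulrCA ler_wpM2l ?nm_ge0//.
have : forall z, z \in rs -> e <= nm (z - y0).
  by move=> z zrs; rewrite leNgt; apply/negP => ze; apply: noz; exists z.
elim: rs {rsE srs noz} => [|z rs IH] hz; first by rewrite !big_nil expr0 mul1r !hornerC.
rewrite !big_cons !hornerM !hornerXsubC !nmM /= exprS mulrACA.
apply: ler_pM; rewrite ?nm_ge0//; last by apply: IH => z' z'rs; apply: hz; rewrite inE z'rs orbT.
have ez := hz z (mem_head _ _); have := nmD (y1 - y0) (y0 - z).
by rewrite addrA subrK [nm (y0 - z)]nm_distC; lra.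
Qed.

End ZeroCurve.

(** The Bezout identity puts h r(x) in (f, g); splitting off the multiplicity of the root in r
    leaves a factor that does not vanish at the point. Exchanging the variables gives the same for
    y. *)
Lemma coprime_swap_power (K : closedFieldType) (f g f1 g1 h : {poly {poly K}}) (x y : K) :
  f = h * f1 -> g = h * g1 -> coprime_data f1 g1 -> ev2 x y h != 0 ->
  exists k s u v, ev2 x y s != 0 /\ s * ('X - x%:P)%:P ^+ k = u * f + v * g.
Proof.
move=> fE gE [al [be [r [r0 rE _]]]] h0.
have [k [r1 r1x rE']] := multiplicity_XsubC r x; rewrite r0 /= in r1x.
exists k, (h * r1%:P), al, be; split.
  by rewrite rmorphM /= ev2C mulf_neq0.
by rewrite -mulrA -rmorphXn -polyCM -rE' -rE fE gE; ring.
Qed.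

Lemma ev2_monomial (K : comNzRingType) (x y c d : K) m n :
  ev2 x y (('X - c%:P)%:P ^+ m * ('X - d%:P%:P) ^+ n) = (x - c) ^+ m * (y - d) ^+ n.
Proof. by rewrite /ev2 !(hornerM, horner_exp, hornerXsubC, hornerC, hornerD, hornerN). Qed.

Section LocalIdeal.
Variable R : realType.
Local Notation C := R[i].
Local Notation T := {poly {poly C}}.
Variables (q : C * C) (f g : C * C -> C) (pf pg A B : T).
Hypothesis fE : near_eq q (fun z => ev2 z.1 z.2 pf) (fun z => ev2 z.1 z.2 A * f z).
Hypothesis gE : near_eq q (fun z => ev2 z.1 z.2 pg) (fun z => ev2 z.1 z.2 B * g z).
Local Notation hol := (hol q).
Local Notation near_eq := (near_eq q).

Definition in_ideal (h : C * C -> C) := exists u v, [/\ hol u, hol v &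
  near_eq h (fun z => u z * f z + v z * g z)].

Lemma in_ideal_eq h h' : near_eq h h' -> in_ideal h -> in_ideal h'.
Proof.
move=> hh [u [v [hu hv e]]]; exists u, v; split => //.
exact: near_eq_trans (near_eq_sym hh) e.
Qed.

Lemma in_idealD h h' : in_ideal h -> in_ideal h' -> in_ideal (fun z => h z + h' z).
Proof.
move=> [u [v [hu hv e]]] [u' [v' [hu' hv' e']]].
exists (fun z => u z + u' z), (fun z => v z + v' z); split; try exact: holD.
apply: near_eq_trans (near_eq_op2 +%R e e') _.
by apply: near_eqW => z; ring.
Qed.

Lemma in_ideal0 : in_ideal (fun=> 0).
Proof.
exists (fun=> 0), (fun=> 0); split; try exact: hol_const.
by apply: near_eqW => z; ring.
Qed.

Lemma in_ideal_sum (I : Type) (s : seq I) (P : pred I) (h : I -> C * C -> C) :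
  (forall i, P i -> in_ideal (h i)) -> in_ideal (fun z => \sum_(i <- s | P i) h i z).
Proof.
move=> hh; elim: s => [|i s IH].
  by apply: in_ideal_eq in_ideal0; apply: near_eqW => z; rewrite big_nil.
have [Pi|Pi] := boolP (P i).
  apply: in_ideal_eq (in_idealD (hh i Pi) IH); apply: near_eqW => z.
  by rewrite big_cons Pi.
by apply: in_ideal_eq IH; apply: near_eqW => z; rewrite big_cons (negbTE Pi).
Qed.

Lemma in_ideal_ev2 p h : in_ideal h -> in_ideal (fun z => ev2 z.1 z.2 p * h z).
Proof.
move=> [u [v [hu hv e]]].
exists (fun z => ev2 z.1 z.2 p * u z), (fun z => ev2 z.1 z.2 p * v z).
split; try exact: hol_ev2.
apply: near_eq_trans (near_eq_op2 *%R (near_eqW q (fun z => erefl (ev2 z.1 z.2 p))) e) _.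
by apply: near_eqW => z /=; ring.
Qed.

Lemma ev2_near_neq0 p : ev2 q.1 q.2 p != 0 ->
  near_eq (fun z => ev2 z.1 z.2 p / ev2 z.1 z.2 p) (fun=> 1).
Proof.
move=> p0; have [M M0 hM] : exists2 M : R, 0 <= M & forall z, close q 1 z ->
    nm (ev2 z.1 z.2 p - ev2 q.1 q.2 p) <= M * (nm (z.1 - q.1) + nm (z.2 - q.2)).
  have [K [s sE]] := ev2_taylor q p.
  exists (\sum_kl nm (s kl)) => [|z [z1 z2]]; first by apply: sumr_ge0 => kl _; exact: nm_ge0.
  rewrite !sE -sumrB mulr_suml; apply: le_trans (nm_sum _ _ _) _; apply: ler_sum => kl _.
  rewrite -mulrBr nmM ler_wpM2l ?nm_ge0// !subrr !expr0n.
  set u := z.1 - q.1 in z1 *; set v := z.2 - q.2 in z2 *.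
  have X1 (w : C) i : nm w < 1 -> nm (w ^+ i) <= 1.
    by move=> w1; rewrite nmX exprn_ile1 ?nm_ge0// ltW.
  have X2 (w : C) i : nm w < 1 -> (0 < i)%N -> nm (w ^+ i) <= nm w.
    by case: i => // i w1 _; rewrite exprS nmM ler_piMr ?nm_ge0 ?X1.
  have u0 := nm_ge0 u; have v0 := nm_ge0 v.
  have [k0|k0] := posnP (kl.1 : nat).
    have [l0|l0] := posnP (kl.2 : nat); first by rewrite k0 l0 !expr0 mulr1 subrr nm0 addr_ge0.
    by rewrite k0 expr0 mul1r /= mulr0n mulr0 subr0; have := X2 v _ z2 l0; lra.
  rewrite /= mulr0n mul0r subr0 nmM.
  apply: le_trans (nm_mul_le (X2 u _ z1 k0) (X1 v _ z2)) _.
  by rewrite mulr1 lerDl.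
have c0 : 0 < nm (ev2 q.1 q.2 p) by rewrite nm_gt0.
set c := nm _ in c0.
exists (Num.min 1 (c / (2 * M + 1))) => [|z cz].
  by rewrite lt_min ltr01 divr_gt0//; lra.
have cz1 : close q 1 z by apply: closeW cz; rewrite ge_min lexx.
have [z1 z2] : close q (c / (2 * M + 1)) z by apply: closeW cz; rewrite ge_min lexx orbT.
rewrite divff// -nm_gt0.
have h1 := hM z cz1; have := nm_geB (ev2 q.1 q.2 p) (ev2 q.1 q.2 p - ev2 z.1 z.2 p).
rewrite subKr [nm (ev2 q.1 q.2 p - _)]nm_distC -/c.
have : M * (nm (z.1 - q.1) + nm (z.2 - q.2)) <= M * (2 * (c / (2 * M + 1))).
  by rewrite ler_wpM2l//; lra.
have : M * (2 * (c / (2 * M + 1))) < c.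
  rewrite mulrA [M * 2]mulrC mulrCA -[X in _ < X]mulr1 ltr_pM2l// ltr_pdivrMr; lra.
by lra.
Qed.

(** A polynomial that is non-zero at q is a unit among the germs, so it can be divided out; [A] and
    [B] relate the polynomial equations to the rational ones. *)
Lemma in_ideal_poly s p u v e : ev2 q.1 q.2 s != 0 -> s * p = u * pf + v * pg -> hol e ->
  in_ideal (fun z => ev2 z.1 z.2 p * e z).
Proof.
move=> s0 sp he.
exists (fun z => ev2 z.1 z.2 (u * A) * e z / ev2 z.1 z.2 s),
  (fun z => ev2 z.1 z.2 (v * B) * e z / ev2 z.1 z.2 s).
split; try by apply: hol_div => //; exact: hol_ev2.
apply: near_eq_trans (_ : near_eq _ (fun z => e z / ev2 z.1 z.2 s *
    (ev2 z.1 z.2 u * ev2 z.1 z.2 pf + ev2 z.1 z.2 v * ev2 z.1 z.2 pg))) _.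
  have [r r0 rP] := ev2_near_neq0 s0; exists r => // z cz.
  rewrite -!rmorphM -rmorphD -sp rmorphM /=.
  transitivity (ev2 z.1 z.2 p * e z * (ev2 z.1 z.2 s / ev2 z.1 z.2 s)).
    by rewrite rP// mulr1.
  by ring.
have [r1 r10 h1] := fE; have [r2 r20 h2] := gE.
exists (Num.min r1 r2) => [|z cz]; first by rewrite lt_min r10.
rewrite h1 ?h2; [|by apply: closeW cz; rewrite ge_min lexx ?orbT..].
by rewrite !rmorphM /=; ring.
Qed.

Section Approximation.
Variables (k1 k2 : nat) (s1 s2 u1 v1 u2 v2 : T).
Hypothesis s1_neq0 : ev2 q.1 q.2 s1 != 0.
Hypothesis s2_neq0 : ev2 q.1 q.2 s2 != 0.
Hypothesis s1E : s1 * ('X - q.1%:P)%:P ^+ k1 = u1 * pf + v1 * pg.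
Hypothesis s2E : s2 * ('X - q.2%:P%:P) ^+ k2 = u2 * pf + v2 * pg.

Lemma in_ideal_monomial a b e : (k1 <= a)%N || (k2 <= b)%N -> hol e ->
  in_ideal (fun z => (z.1 - q.1) ^+ a * (z.2 - q.2) ^+ b * e z).
Proof.
move=> /orP[ka|kb] he.
  apply: in_ideal_eq (in_ideal_poly s1_neq0 s1E (hol_monomial (a - k1) b he)).
  apply: near_eqW => z; rewrite rmorphXn /= ev2C hornerXsubC !mulrA -exprD.
  by rewrite subnKC.
apply: in_ideal_eq (in_ideal_poly s2_neq0 s2E (hol_monomial a (b - k2) he)).
apply: near_eqW => z; rewrite rmorphXn rmorphB /= ev2X ev2C hornerC.
by rewrite mulrCA !mulrA -mulrA mulrA -[_ * _ * e z]mulrA; rewrite -{2}(subnKC kb) exprD; ring.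
Qed.

(** Repeated use of [hol_split] expands e into monomials with germs as coefficients; those of total
    degree at least [k1 + k2] lie in the ideal, so only a polynomial remains. *)
Lemma poly_approx e : hol e -> exists p, in_ideal (fun z => e z - ev2 z.1 z.2 p).
Proof.
suff main m a b e' : hol e' -> (k1 + k2 <= a + b + m)%N -> exists p,
    in_ideal (fun z => (z.1 - q.1) ^+ a * (z.2 - q.2) ^+ b * e' z - ev2 z.1 z.2 p).
  move=> he; have [|p hp] := main (k1 + k2)%N 0%N 0%N e he; first by rewrite add0n.
  by exists p; apply: in_ideal_eq hp; apply: near_eqW => z; rewrite !expr0 !mul1r.
elim: m a b e' => [|m IH] a b e' he' abm.
  exists 0; apply: in_ideal_eq (in_ideal_monomial (a := a) (b := b) _ he'); last by lia.
  by apply: near_eqW => z; rewrite rmorph0 subr0.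
have [k [f1 [f2 [hf1 hf2 e'E]]]] := hol_split he'.
have [|p1 hp1] := IH a.+1 b f1 hf1; first by lia.
have [|p2 hp2] := IH a b.+1 f2 hf2; first by lia.
exists (('X - q.1%:P)%:P ^+ a * ('X - q.2%:P%:P) ^+ b * k%:P%:P + p1 + p2).
apply: in_ideal_eq (in_idealD hp1 hp2); have [r r0 rP] := e'E; exists r => // z cz.
have -> : ev2 z.1 z.2 (('X - q.1%:P)%:P ^+ a * ('X - q.2%:P%:P) ^+ b * k%:P%:P + p1 + p2) =
    (z.1 - q.1) ^+ a * (z.2 - q.2) ^+ b * k + ev2 z.1 z.2 p1 + ev2 z.1 z.2 p2.
  by rewrite 2!rmorphD rmorphM /= ev2_monomial ev2C hornerC.
rewrite rP//; move: (z.1 - q.1) (z.2 - q.2) (ev2 z.1 z.2 p1) (ev2 z.1 z.2 p2) (f1 z) (f2 z).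
by move=> x y c1 c2 g1 g2; rewrite !exprS; ring.
Qed.

End Approximation.
End LocalIdeal.

(** * Periodic points of the map *)

Section Bridge.
Variable R : realType.
Local Open Scope complex_scope.
Local Notation C := R[i].
Implicit Types (q z : CC2 R).

Lemma ball_close (r : R) q z : ball q (r%:C : CC R) z <-> close q r z.
Proof.
rewrite /close [X in X <-> _](_ : _ = (ball q.1 (r%:C : CC R) z.1 /\ ball q.2 (r%:C : CC R) z.2))//.
by rewrite -!ball_normE /ball_ /= !normE !ltcR (nm_distC q.1) (nm_distC q.2).
Qed.

Lemma near_close q (P : CC2 R -> Prop) :
  (\forall z \near q, P z) <-> exists2 r : R, 0 < r & forall z, close q r z -> P z.
Proof.
split.
  move=> /nbhs_ballP[e /= e0 eP].
  have eE : e = (complex.Re e)%:C by rewrite RRe_real// gtr0_real.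
  exists (complex.Re e); first by rewrite -ltcR -eE.
  by move=> z cz; apply: eP; rewrite eE; apply/ball_close.
move=> [r r0 rP]; apply/nbhs_ballP; exists (r%:C) => /=; first by rewrite ltcR.
by move=> z /ball_close; exact: rP.
Qed.

Lemma cvg_tends (x : nat -> CC R) (l : CC R) : x @ \oo --> l <->
  forall e : R, 0 < e -> exists N0, forall N, (N0 <= N)%N -> nm (x N - l) < e.
Proof.
rewrite (cvgrPdist_lt x l); split=> [h e e0|h e e0].
  have /h[N0 _ N0P] : 0 < e%:C by rewrite ltcR.
  by exists N0 => N NN; have := N0P N NN; rewrite /= normE ltcR nm_distC.
have eE : e = (complex.Re e)%:C by rewrite RRe_real// gtr0_real.
have /h[N0 N0P] : 0 < complex.Re e by rewrite -ltcR -eE.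
by exists N0 => // N NN /=; rewrite normE eE ltcR nm_distC; exact: N0P.
Qed.

Lemma absum_complex (c : nat -> nat -> C) (r : R) N :
  \sum_(i < N) \sum_(j < N) `|c i j| * r%:C ^+ (i + j) = (absum c r N N)%:C :> C.
Proof.
rewrite rmorph_sum; apply: eq_bigr => i _; rewrite rmorph_sum; apply: eq_bigr => j _.
by rewrite rmorphM rmorphXn.
Qed.

Lemma holP q f : holomorphic_at q f <-> hol q f.
Proof.
split.
  move=> [c [r [M [r0 hM hf]]]].
  have rE : r = (complex.Re r)%:C by rewrite RRe_real// gtr0_real.
  have r0' : 0 < complex.Re r by rewrite -ltcR -rE.
  have bc : bounded c (complex.Re r).
    exists (complex.Re M) => N; have := hM N; rewrite rE absum_complex lecE => /andP[_].
    by [].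
  exists c, (complex.Re r); split => // z cz.
  apply: (tends2_of_diag (ltW cz.1) (ltW cz.2)) => //.
  by apply/cvg_tends; apply: hf; rewrite rE; apply/ball_close.
move=> [c [r [r0 [M hM] hf]]].
exists c, r%:C, M%:C; split; first by rewrite ltcR.
  by move=> N; rewrite absum_complex lecR.
move=> z /ball_close cz; apply/cvg_tends => e e0.
by have [N0 hN0] := hf z cz e e0; exists N0 => N NN; exact: hN0.
Qed.

Lemma in_idealP q f g h : in_ideal_at q f g h <-> in_ideal q f g h.
Proof.
split=> [[u [v [/holP hu /holP hv /near_close e]]]|[u [v [hu hv e]]]].
  by exists u, v.
by exists u, v; split; [exact/holP|exact/holP|exact/near_close].
Qed.

End Bridge.

Section FixedPoints.
Variable R : realType.
Local Notation C := R[i].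
Variables (a b : CC R).

Lemma FE : F a b = step (a : C) (b : C). Proof. by []. Qed.

Lemma affine_continuous : continuous (@affine R).
Proof.
have -> : @affine R = \pi_(P2 R)%qT \o
    (fun z => exist _ (affine_vec z) (affine_vec_neq0 z) : nzvec R) by [].
move=> z; apply: continuous_comp; last exact: pi_continuous.
apply: (@continuous_comp_initial _ _ _ set_val) z.
move=> z; apply/cvg_ballP => e e0.
have eE : e = (complex.Re e)%:C%C by rewrite RRe_real// gtr0_real.
have e0' : 0 < complex.Re e by rewrite -ltcR -eE.
apply/near_close; exists (complex.Re e) => // y [h1 h2]; split=> // i j.
rewrite !mxE eE -ball_normE /ball_ /= normE ltcR.
by case: j => [[|[|[|//]]] ?]; rewrite /= ?subrr ?nm0// nm_distC.
Qed.

Lemma F_continuous (p : CC2 R) : Fdom b p -> F a b z @[z --> p] --> F a b p.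
Proof.
move=> dp.
have h2 : (z.2 : CC R) @[z --> p] --> p.2 by exact: cvg_snd.
have h1 : (z.1 : CC R) @[z --> p] --> p.1 by exact: cvg_fst.
have hn : ((a + z.2) : CC R) @[z --> p] --> a + p.2 by apply: cvgD h2; exact: cvg_cst.
have hd : ((b + z.1) : CC R) @[z --> p] --> b + p.1 by apply: cvgD h1; exact: cvg_cst.
have hq : ((a + z.2) / (b + z.1) : CC R) @[z --> p] --> (a + p.2) / (b + p.1).
  apply: cvgM hn _; exact: cvgV hd.
exact: cvg_pair h2 hq.
Qed.

Lemma Fdom_notInd (p : CC2 R) : Fdom b p -> ~ Ind a b p.
Proof.
move=> dp; rewrite /Ind /=; apply; exists (affine (F a b p)).
apply: cvg_within_filter; apply: continuous_cvg; first exact: affine_continuous.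
exact: F_continuous.
Qed.

(** All iterates of a periodic point, the n-th included, have non-zero denominators, and F is
    continuous at such points, so none of them is indeterminate. *)
Lemma Fix'P n q : (0 < n)%N -> Fix' a b n q <-> cycle_point (a : C) (b : C) n q.
Proof.
move=> n0; split=> [[dom _ qn]|[qn dom]]; first by split.
split => // j /andP[j1 jn]; apply: Fdom_notInd.
have := orb_period_dom n0 qn dom j.
by rewrite /Fdom /= /orb.
Qed.

End FixedPoints.

(** * The upper bound *)

Section UpperBound.
Variable R : realType.
Local Notation C := R[i].
Local Notation T := {poly {poly C}}.
Variables (a b : CC R) (n : nat).
Hypothesis n_gt0 : (0 < n)%N.

Let f (z : CC2 R) : CC R := z.1 - (iter n (F a b) z).1.
Let g (z : CC2 R) : CC R := z.2 - (iter n (F a b) z).2.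
Local Notation pf := (pfix1 (a : C) (b : C) n).
Local Notation pg := (pfix2 (a : C) (b : C) n).
Local Notation D := (pden (a : C) (b : C) n.+1).

Lemma Fix'_ev2 (q : CC2 R) : Fix' a b n q <->
  [/\ ev2 q.1 q.2 D != 0, ev2 q.1 q.2 pf = 0 & ev2 q.1 q.2 pg = 0].
Proof.
rewrite Fix'P//; case: q => x y; rewrite ev2_pden ev2_pfix1 ev2_pfix2; split.
  move=> [qn dom]; have dn := (den_neq0P (a : C) (b : C) x y n).2 dom.
  by have [] := (fix_iff dn).2 qn.
move=> [dn f0 g0]; split; first exact/(fix_iff dn).
exact/(den_neq0P (a : C) (b : C) x y n).
Qed.

Lemma near_neq0 (q : C * C) (p : T) : ev2 q.1 q.2 p != 0 ->
  exists2 r : R, 0 < r & forall z, close q r z -> ev2 z.1 z.2 p != 0.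
Proof.
move=> /ev2_near_neq0[r r0 rP]; exists r => // z /rP e.
by apply: contra_eq_neq e => ->; rewrite mul0r eq_sym oner_eq0.
Qed.

Lemma pf_near q : ev2 q.1 q.2 D != 0 ->
  near_eq q (fun z => ev2 z.1 z.2 pf) (fun z => ev2 z.1 z.2 (pden (a : C) (b : C) n) * f z).
Proof.
move=> /near_neq0[r r0 rP]; exists r => // -[x y] /rP /=; rewrite !ev2_pden ev2_pfix1.
move=> dn; have [_ nE] := num_orb dn (leqnSn n).
rewrite /fix1 nE /f FE iter_step /=; ring.
Qed.

Lemma pg_near q : ev2 q.1 q.2 D != 0 ->
  near_eq q (fun z => ev2 z.1 z.2 pg) (fun z => ev2 z.1 z.2 D * g z).
Proof.
move=> /near_neq0[r r0 rP]; exists r => // -[x y] /rP /=; rewrite !ev2_pden ev2_pfix2.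
move=> dn; have [_ nE] := num_orb dn (leqnn n.+1).
rewrite /fix2 nE /g FE iter_step /=; ring.
Qed.

Hypothesis isolatedF : forall q, Fix' a b n q -> isolated (Fix' a b n) q.

(** Zeros of h solve both equations. If h vanished at q, [zero_curve] would give such zeros, with
    non-zero denominators, arbitrarily close to q, against isolation. *)
Lemma common_factor_neq0 q h f1 g1 : Fix' a b n q -> pf = h * f1 -> pg = h * g1 ->
  ev2 q.1 q.2 h != 0.
Proof.
move=> Fq fE gE; apply/eqP => h0; have /Fix'_ev2[Dq _ _] := Fq.
have [_ [V Vq VF]] := isolatedF Fq; have [r r0 rV] := (near_close q V).1 Vq.
have [r' r'0 rD] := near_neq0 Dq.
have m0 : 0 < Num.min r r' by rewrite lt_min r0.
have [z [zq cz hz]] := zero_curve h0 m0.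
have Fz : Fix' a b n z.
  apply/Fix'_ev2; split.
  - by apply: rD; apply: closeW cz; rewrite ge_min lexx orbT.
  - by rewrite fE rmorphM /= hz mul0r.
  - by rewrite gE rmorphM /= hz mul0r.
have : (V `&` Fix' a b n) z.
  by split => //; apply: rV; apply: closeW cz; rewrite ge_min lexx.
by rewrite VF /= => zq'; rewrite zq' eqxx in zq.
Qed.

(** The local ideal contains powers of both coordinates centred at q, the second one obtained by
    applying [swapXY]; hence germs modulo the ideal are represented by polynomials. *)
Lemma local_structure q : Fix' a b n q -> exists k,
  (forall e, hol q e -> exists p, in_ideal q f g (fun z => e z - ev2 z.1 z.2 p)) /\
  (forall i j e, (k <= i)%N || (k <= j)%N -> hol q e ->
     in_ideal q f g (fun z => (z.1 - q.1) ^+ i * (z.2 - q.2) ^+ j * e z)).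
Proof.
move=> Fq; have /Fix'_ev2[Dq _ _] := Fq.
have [h [f1 [g1 [fE gE cop]]]] := common_factor pf pg.
have hq := common_factor_neq0 Fq fE gE.
have [k1 [s1 [u1 [v1 [s1q s1E]]]]] := coprime_swap_power fE gE cop hq.
have [h' [f1' [g1' [fE' gE' cop']]]] := common_factor (swapXY pf) (swapXY pg).
have hq' : ev2 q.2 q.1 h' != 0.
  rewrite /ev2 -horner2_swapXY; apply: (common_factor_neq0 (f1 := swapXY f1') (g1 :=
    swapXY g1')) => //.
    by rewrite -[LHS]swapXYK fE' rmorphM.
  by rewrite -[LHS]swapXYK gE' rmorphM.
have [k2 [s2 [u2 [v2 [s2q s2E]]]]] := coprime_swap_power fE' gE' cop' hq'.
have s2q' : ev2 q.1 q.2 (swapXY s2) != 0 by rewrite /ev2 horner2_swapXY.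
have s2E' : swapXY s2 * ('X - q.2%:P%:P) ^+ k2 = swapXY u2 * pf + swapXY v2 * pg.
  have := congr1 swapXY s2E.
  rewrite [swapXY (s2 * _)]rmorphM [swapXY (_ + _)]rmorphD /= !(rmorphM swapXY) /= !swapXYK
    rmorphXn /=.
  by rewrite swapXY_polyC map_polyXsubC.
exists (maxn k1 k2); split=> [e he|i j e ij he].
  exact: (poly_approx (pf_near Dq) (pg_near Dq) s1q s2q' s1E s2E' he).
apply: (in_ideal_monomial (pf_near Dq) (pg_near Dq) s1q s2q' s1E s2E') => //.
by move: ij; rewrite !geq_max => /orP[/andP[-> _]|/andP[_ ->]]; rewrite ?orbT.
Qed.

Section SeveralPoints.
Variables (r : nat) (pts : 'I_r -> CC2 R).
Hypothesis pts_inj : injective pts.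
Hypothesis ptsF : forall i, Fix' a b n (pts i).

(** [th] is a product of powers of linear forms that vanish at the other points but not at [pts i]:
    it lies in the ideal at each of the others and is a unit at [pts i], where e / th is
    approximated by a polynomial. *)
Lemma chinese_remainder i e : hol (pts i) e -> exists P : T,
  in_ideal (pts i) f g (fun z => e z - ev2 z.1 z.2 P) /\
  forall j, j != i -> in_ideal (pts j) f g (fun z => ev2 z.1 z.2 P).
Proof.
move=> he.
have /choice[k kP] j := local_structure (ptsF j).
pose l j : T := if (pts i).1 != (pts j).1 then ('X - (pts j).1%:P)%:P
  else 'X - (pts j).2%:P%:P.
pose th : T := \prod_(j | j != i) l j ^+ k j.
have thi : ev2 (pts i).1 (pts i).2 th != 0.
  rewrite rmorph_prod; apply/prodf_neq0 => j ji; rewrite rmorphXn /= expf_neq0// /l.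
  case: ifP => [h|/negbFE/eqP h]; first by rewrite ev2C hornerXsubC subr_eq0.
  rewrite ev2B ev2X ev2C hornerC subr_eq0; apply: contraNneq ji => h2.
  by apply/eqP/pts_inj; case: (pts j) (pts i) h h2 => [? ?] [? ?] /= -> ->.
have [p hp] := (kP i).1 _ (hol_div thi he).
exists (th * p); split.
  have [/= s s0 sP] := ev2_near_neq0 thi.
  apply: in_ideal_eq (in_ideal_ev2 th hp); exists s => // z /sP th1.
  rewrite rmorphM mulrBr; congr (_ - _).
  by rewrite mulrCA th1 mulr1.
move=> j ji; pose th' : T := \prod_(j' | (j' != i) && (j' != j)) l j' ^+ k j'.
have thE : th = l j ^+ k j * th' by rewrite /th (bigD1 j).
have hol1 : hol (pts j) (fun z => ev2 z.1 z.2 (th' * p)).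
  by apply: hol_ext (hol_ev2 (th' * p) (hol_const _ 1)) => z; rewrite mulr1.
case h: ((pts i).1 != (pts j).1).
  apply: in_ideal_eq ((kP j).2 (k j) 0%N _ _ hol1); last by rewrite leqnn.
  apply: near_eqW => z.
  transitivity (ev2 z.1 z.2 (l j ^+ k j) * ev2 z.1 z.2 (th' * p)); last first.
    by rewrite -rmorphM thE mulrA.
  congr (_ * _); have := ev2_monomial z.1 z.2 (pts j).1 (pts j).2 (k j) 0.
  by rewrite /l h !expr0 !mulr1.
apply: in_ideal_eq ((kP j).2 0%N (k j) _ _ hol1); last by rewrite leqnn orbT.
apply: near_eqW => z.
transitivity (ev2 z.1 z.2 (l j ^+ k j) * ev2 z.1 z.2 (th' * p)); last first.
  by rewrite -rmorphM thE mulrA.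
congr (_ * _); have := ev2_monomial z.1 z.2 (pts j).1 (pts j).2 0 (k j).
by rewrite /l h !expr0 !mul1r.
Qed.

(** Each member of a local family is replaced by a polynomial that represents it at its own point
    and 0 at the others. A global relation then localizes, at each point, to a relation of the
    family there. *)
Lemma sum_free_le (d : 'I_r -> nat) (E : forall i, 'I_(d i) -> CC2 R -> CC R) :
  (forall i, free_mod_ideal_at (pts i) f g (E i)) ->
  (\sum_i d i <= size (words n))%N.
Proof.
move=> freeE.
have /choice[P PP] (x : {i & 'I_(d i)}) : exists P : T,
  in_ideal (pts (tag x)) f g (fun z => E (tag x) (tagged x) z - ev2 z.1 z.2 P) /\
  forall j, j != tag x -> in_ideal (pts j) f g (fun z => ev2 z.1 z.2 P).
  by apply: chinese_remainder; apply/holP; exact: (freeE _).1.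
have -> : (\sum_i d i)%N = #|{: {i & 'I_(d i)}}|.
  by rewrite card_tagged sumnE big_map big_enum; apply: eq_bigr => i _; rewrite card_ord.
have [h [f1 [g1 [fE gE cop]]]] := common_factor pf pg.
pose S (s : T) := forall i, ev2 (pts i).1 (pts i).2 s != 0.
apply: (@algebraic_bound R a b n n_gt0 S _ (P \o enum_val) h f1 g1 fE gE cop).
- by move=> i; exact: common_factor_neq0 (ptsF i) fE gE.
- by move=> i; rewrite rmorph1 oner_neq0.
- by move=> i; have /Fix'_ev2[Di _ _] := ptsF i; exact: Di.
- by move=> s s' hs hs' i; rewrite rmorphM /= mulf_neq0.
move=> s lam u v Ss e x.
pose mu (y : {i & 'I_(d i)}) := lam (enum_rank y).
suff : mu (enum_val x) = 0 by rewrite /mu enum_valK.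
case: (enum_val x) => i l.
have /Fix'_ev2[Dq _ _] := ptsF i.
have sumE : in_ideal (pts i) f g (fun z => \sum_y mu y * ev2 z.1 z.2 (P y)).
  apply: in_ideal_eq (in_ideal_poly (pf_near Dq) (pg_near Dq) (Ss i) e (hol_const _ 1)).
  apply: near_eqW => z; rewrite mulr1 rmorph_sum [RHS]big_enum_val; apply: eq_bigr => j _.
  by rewrite rmorphM /= !ev2C hornerC /mu enum_valK.
apply: ((freeE i).2 (fun l => mu (Tagged _ l)) _ l); apply/in_idealP.
(* Replacing the polynomials by the germs they represent changes the sum by an element of the
   ideal. *)
have corr : in_ideal (pts i) f g (fun z =>
    \sum_(y : {i & 'I_(d i)}) ev2 z.1 z.2 (mu y)%:P%:P *
      ((if tag y == i then E (tag y) (tagged y) z else 0) - ev2 z.1 z.2 (P y))).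
  apply: in_ideal_sum => y _; apply: in_ideal_ev2.
  have [h1 h2] := PP y; case: eqP => [yi|/eqP yi].
    by rewrite -yi.
  apply: in_ideal_eq (in_ideal_ev2 (-1)%:P%:P (h2 i _)); last by rewrite eq_sym.
  by apply: near_eqW => z; rewrite ev2C hornerC sub0r mulN1r.
apply: in_ideal_eq (in_idealD sumE corr); apply: near_eqW => z.
rewrite -big_split /=; transitivity (\sum_(y : {i & 'I_(d i)}) mu y *
    (if tag y == i then E (tag y) (tagged y) z else 0)).
  by apply: eq_bigr => y _; rewrite ev2C hornerC; ring.
transitivity (\sum_i' \sum_(l' : 'I_(d i'))
    mu (Tagged (fun k => 'I_(d k)) l') * (if i' == i then E i' l' z else 0)).
  by rewrite sig_big_dep; apply: eq_bigr => -[i' l'] _.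
rewrite (bigD1 i)//= [X in _ + X]big1 ?addr0.
  by apply: eq_bigr => l' _; rewrite eqxx.
by move=> i' /negbTE ->; apply: big1 => l' _; rewrite mulr0.
Qed.

End SeveralPoints.

(** The bound for a single point makes the supremum finite, hence a maximum over integers. *)
Lemma mult_attained q : Fix' a b n q -> exists d (e : 'I_d -> CC2 R -> CC R),
  free_mod_ideal_at q f g e /\ mult a b n q = d%:R%:E.
Proof.
move=> Fq; pose Q d := `[< exists e : 'I_d -> CC2 R -> CC R, free_mod_ideal_at q f g e >].
have Q0 : Q 0%N.
  apply/asboolP; exists (fun=> fun=> 0); split=> [[]//|lam _ []//].
have Qb d : Q d -> (d <= size (words n))%N.
  move=> /asboolP[e he].
  have := @sum_free_le 1 (fun=> q) _ _ (fun=> d) (fun=> e).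
  rewrite big_ord1; apply => // i j _; by rewrite !ord1.
have exQ : exists d, Q d by exists 0%N.
case: (ex_maxnP exQ Qb) => d /asboolP[e he] dmax.
exists d, e; split => //; apply/eqP; rewrite eq_le; apply/andP; split.
  apply: ub_ereal_sup => _ [m [e' he'] <-].
  by rewrite lee_fin ler_nat; apply: dmax; apply/asboolP; exists e'.
by apply: ereal_sup_ubound; exists d => //; exists e.
Qed.

Lemma numFix'_le : (numFix' a b n <= (size (words n))%:R%:E)%E.
Proof.
apply: ub_ereal_sup => _ [A [finA AF] <-].
rewrite fsbig_finite//=.
pose s : seq (CC2 R) := finmap.enum_fset (fset_set A).
have us : uniq s by exact: finmap.fset_uniq.
have sF (i : 'I_(size s)) : Fix' a b n (nth 0 s i).
  apply: AF; have memE : nth 0 s i \in s = (nth 0 s i \in A) by exact: in_fset_set.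
  by apply/set_mem; rewrite -memE mem_nth.
have /choice[d dE] (i : 'I_(size s)) := mult_attained (sF i).
pose e i := sval (cid (dE i)); have dP i := svalP (cid (dE i)).
have inj : injective (fun i : 'I_(size s) => nth 0 s i).
  by move=> i j /eqP; rewrite nth_uniq// => /eqP/val_inj.
have le := sum_free_le inj sF (fun i => (dP i).1).
rewrite (big_nth 0) big_mkord.
under eq_bigr do rewrite (dP _).2.
by rewrite sumEFin lee_fin -natr_sum ler_nat.
Qed.

End UpperBound.

(** * Quantifier elimination *)

Section QuantifierElimination.
Variable K : closedFieldType.
Local Notation T := {poly {poly K}}.
Local Notation term := (GRing.term K).
Local Notation formula := (GRing.formula K).

(** Variables 0 and 1 are a and b; the others take the default value 0 in [[:: a; b]]. The value at
    [Inv] is a placeholder, as [rterm] excludes inverses. *)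
Fixpoint poly_of_term (t : term) : T :=
  match t with
  | GRing.Var 0 => 'X%:P
  | GRing.Var 1 => 'X
  | GRing.Var _ => 0
  | GRing.Const c => c%:P%:P
  | GRing.NatConst n => n%:R
  | GRing.Add t1 t2 => poly_of_term t1 + poly_of_term t2
  | GRing.Opp t1 => - poly_of_term t1
  | GRing.NatMul t1 n => poly_of_term t1 *+ n
  | GRing.Mul t1 t2 => poly_of_term t1 * poly_of_term t2
  | GRing.Inv _ => 0
  | GRing.Exp t1 n => poly_of_term t1 ^+ n
  end.

Lemma ev2_poly_of_term a b t : GRing.rterm t ->
  ev2 a b (poly_of_term t) = GRing.eval [:: a; b] t.
Proof.
elim: t => //= [n|c|n|t1 IH1 t2 IH2|t1 IH1|t1 IH1 n|t1 IH1 t2 IH2|t1 IH1 n].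
- case: n => [|[|n]] _ /=; first by rewrite ev2C hornerX.
    by rewrite ev2X.
  by rewrite rmorph0 nth_nil.
- by rewrite ev2C hornerC.
- by rewrite rmorph_nat.
- by move=> /andP[/IH1 e1 /IH2 e2]; rewrite rmorphD /= e1 e2.
- by move=> /IH1 e1; rewrite ev2N /= e1.
- by move=> /IH1 e1; rewrite rmorphMn /= e1.
- by move=> /andP[/IH1 e1 /IH2 e2]; rewrite rmorphM /= e1 e2.
- by move=> /IH1 e1; rewrite rmorphXn /= e1.
Qed.

(** A polynomial equation in (a, b) is an identity or fails off its zero set; for Boolean
    combinations the exceptional polynomials are multiplied. *)
Lemma generic_dichotomy_qf (f : formula) : GRing.qf_form f && GRing.rformula f ->
  exists (p : T) (v : bool), p != 0 /\
    forall a b, ev2 a b p != 0 -> GRing.qf_eval [:: a; b] f = v.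
Proof.
have op2 (op : bool -> bool -> bool) (f1 f2 : formula) :
    (GRing.qf_form f1 && GRing.rformula f1 -> exists (p : T) (v : bool), p != 0 /\
      forall a b, ev2 a b p != 0 -> GRing.qf_eval [:: a; b] f1 = v) ->
    (GRing.qf_form f2 && GRing.rformula f2 -> exists (p : T) (v : bool), p != 0 /\
      forall a b, ev2 a b p != 0 -> GRing.qf_eval [:: a; b] f2 = v) ->
    (GRing.qf_form f1 && GRing.qf_form f2) && (GRing.rformula f1 && GRing.rformula f2) ->
    exists (p : T) (v : bool), p != 0 /\ forall a b, ev2 a b p != 0 ->
      op (GRing.qf_eval [:: a; b] f1) (GRing.qf_eval [:: a; b] f2) = v.
  move=> IH1 IH2 /andP[/andP[q1 q2] /andP[r1 r2]].
  have [|p1 [v1 [p10 h1]]] := IH1; first by rewrite q1.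
  have [|p2 [v2 [p20 h2]]] := IH2; first by rewrite q2.
  exists (p1 * p2), (op v1 v2); split=> [|a b]; first by rewrite mulf_neq0.
  by rewrite rmorphM mulf_eq0 negb_or => /andP[/h1 -> /h2 ->].
elim: f => //=.
- by move=> v _; exists 1, v; split=> //; exact: oner_neq0.
- move=> t1 t2 /andP[r1 r2]; pose p := poly_of_term t1 - poly_of_term t2.
  have pE a b : (ev2 a b p == 0) = (GRing.eval [:: a; b] t1 == GRing.eval [:: a; b] t2).
    by rewrite /p ev2B !ev2_poly_of_term// subr_eq0.
  have [p0|p0] := eqVneq p 0.
    exists 1, true; split=> [|a b _]; first exact: oner_neq0.
    by rewrite -pE p0 rmorph0 eqxx.
  by exists p, false; split => // a b /negbTE; rewrite pE.
- by move=> f1 IH1 f2 IH2; exact: (op2 andb).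
- by move=> f1 IH1 f2 IH2; exact: (op2 Datatypes.orb).
- by move=> f1 IH1 f2 IH2; exact: (op2 implb).
- move=> f1 IH1 /IH1[p [v [p0 h]]]; exists p, (~~ v); split => // a b /h ->.
  by [].
Qed.

Lemma generic_dichotomy (f : formula) : GRing.rformula f ->
  exists (p : T) (v : bool), p != 0 /\
    forall a b, ev2 a b p != 0 -> (GRing.holds [:: a; b] f <-> v).
Proof.
move=> rf; pose wf := @ClosedFieldQE.wf_ex_elim K.
have ax : GRing.closed_field_axiom K by exact: solve_monicpoly.
have ok := ClosedFieldQE.holds_ex_elim ax.
have [p [v [p0 h]]] := generic_dichotomy_qf (GRing.quantifier_elim_wf wf rf).
exists p, v; split => // a b /h <-.
by split=> /(GRing.quantifier_elim_rformP wf ok _ rf).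
Qed.

(** [orbit_frac] in the syntax of the first-order language; being free of division, it yields the
    ring formulas that quantifier elimination expects. *)
Fixpoint term_frac (x y : term) n : (term * term) * (term * term) :=
  if n is m.+1 then
    let: ((p, q), (p', q')) := term_frac x y m in
    ((p', q'), (GRing.Mul (GRing.Add (GRing.Mul (GRing.Var K 0) q') p') q,
      GRing.Mul q' (GRing.Add (GRing.Mul (GRing.Var K 1) q) p)))
  else ((x, GRing.NatConst K 1), (y, GRing.NatConst K 1)).

Lemma eval_term_frac (e : seq K) x y n :
  let ev := GRing.eval e in let t := term_frac x y n in
  ((ev t.1.1, ev t.1.2), (ev t.2.1, ev t.2.2)) =
    orbit_frac e`_0 e`_1 (ev x) (ev y) n.
Proof.
elim: n => [|n] //=; case: (term_frac x y n) => [[p q] [p' q']] /=.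
by move=> <-.
Qed.

Lemma rterm_frac x y n : GRing.rterm x -> GRing.rterm y -> let t := term_frac x y n in
  [&& GRing.rterm t.1.1, GRing.rterm t.1.2, GRing.rterm t.2.1 & GRing.rterm t.2.2].
Proof.
move=> rx ry; elim: n => [|n] /=; first by rewrite rx ry.
by case: (term_frac x y n) => [[p q] [p' q']] /= /and4P[-> -> -> ->].
Qed.

Definition cycle_formula n (x y : term) : formula :=
  let t := term_frac x y n in
  GRing.And (GRing.Not (GRing.Equal t.2.2 (GRing.NatConst K 0)))
    (GRing.And (GRing.Equal (GRing.Mul x t.1.2) t.1.1) (GRing.Equal (GRing.Mul y t.2.2) t.2.1)).

Lemma cycle_formulaP e n x y : GRing.holds e (cycle_formula n x y) <->
  cycle_point e`_0 e`_1 n (GRing.eval e x, GRing.eval e y).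
Proof.
have := eval_term_frac e x y n.
rewrite /cycle_formula; case: (term_frac x y n) => [[p q] [p' q']] /= E.
set a := e`_0 in E *; set b := e`_1 in E *; set u := GRing.eval e x in E *;
  set v := GRing.eval e y in E *.
have ES : (orbit_frac a b u v n.+1).1 = (orbit_frac a b u v n).2.
  by rewrite /=; case: (orbit_frac a b u v n) => [[? ?] [? ?]].
have e1 : GRing.eval e p = num a b u v n by rewrite /num -E.
have e2 : GRing.eval e q = den a b u v n by rewrite /den -E.
have e3 : GRing.eval e p' = num a b u v n.+1 by rewrite /num ES -E.
have e4 : GRing.eval e q' = den a b u v n.+1 by rewrite /den ES -E.
rewrite e1 e2 e3 e4; split.
  move=> [/eqP dn [f0 g0]]; split; last exact/den_neq0P.
  by apply/(fix_iff dn); rewrite /fix1 /fix2 f0 g0 !subrr.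
move=> [qn dom]; have dn := (den_neq0P a b u v n).2 dom.
have [/eqP f0 /eqP g0] := (fix_iff dn).2 qn.
by split; [exact/eqP|split; apply/eqP; rewrite -subr_eq0].
Qed.

Lemma rformula_cycle n x y : GRing.rterm x -> GRing.rterm y -> GRing.rformula (cycle_formula n x y).
Proof.
move=> rx ry; have := rterm_frac n rx ry; rewrite /cycle_formula.
by case: (term_frac x y n) => [[p q] [p' q']] /= /and4P[-> -> -> ->]; rewrite rx ry.
Qed.

Definition conjunction (I : Type) (s : seq I) (G : I -> formula) : formula :=
  foldr (fun i => GRing.And (G i)) (@GRing.Bool K true) s.

Lemma conjunctionP (I : eqType) (s : seq I) G e :
  GRing.holds e (conjunction s G) <-> forall i, i \in s -> GRing.holds e (G i).
Proof.
elim: s => [|i s IH] //=; split=> [[Gi /IH Gs] j|h].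
  by rewrite inE => /predU1P[->//|]; exact: Gs.
split; first by apply: h; rewrite mem_head.
by apply/IH => j js; apply: h; rewrite inE js orbT.
Qed.

Lemma rformula_conjunction (I : Type) (s : seq I) G :
  (forall i, GRing.rformula (G i)) -> GRing.rformula (conjunction s G).
Proof. by move=> rG; elim: s => //= i s ->; rewrite rG. Qed.

(** The coordinates of the i-th point, numbered after the parameters a and b. *)
Let X i := GRing.Var K (2 + 2 * i).
Let Y i := GRing.Var K (3 + 2 * i).

Definition many_cycles_formula n k : formula :=
  foldr (@GRing.Exists K) (GRing.And
    (conjunction (iota 0 k) (fun i => cycle_formula n (X i) (Y i)))
    (conjunction (iota 0 k) (fun i => conjunction (iota 0 k) (fun j =>
      if (i < j)%N then
        GRing.Not (GRing.And (GRing.Equal (X i) (X j)) (GRing.Equal (Y i) (Y j)))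
      else @GRing.Bool K true))))
  (iota 2 (2 * k)).

Lemma rformula_many_cycles n k : GRing.rformula (many_cycles_formula n k).
Proof.
rewrite /many_cycles_formula; elim: (iota 2 _) => //=.
rewrite !rformula_conjunction// => i; last exact: rformula_cycle.
by apply: rformula_conjunction => j; case: ifP.
Qed.

Lemma many_cyclesP n k a b : GRing.holds [:: a; b] (many_cycles_formula n k) <->
  exists s : seq (K * K), [/\ uniq s, size s = k & forall q, q \in s -> cycle_point a b n q].
Proof.
split.
  move=> /GRing.foldExistsP[e ea [/conjunctionP cyc /conjunctionP dis]].
  have e0 : e`_0 = a by rewrite -ea// !inE mem_iota.
  have e1 : e`_1 = b by rewrite -ea// !inE mem_iota.
  pose pt i := (e`_(2 + 2 * i), e`_(3 + 2 * i)).
  exists [seq pt i | i <- iota 0 k]; split; rewrite ?size_map ?size_iota//.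
    rewrite map_inj_in_uniq ?iota_uniq// => i j ik jk [ex ey].
    wlog ij : i j ik jk ex ey / (i < j)%N.
      by move=> W; case: (ltngtP i j) => // h; [exact: (W i j)|apply/esym; exact: (W j i)].
    have := dis i ik => /conjunctionP/(_ j jk); rewrite ij /= => h.
    by exfalso; apply: h.
  move=> q /mapP[i ik ->]; have := cyc i ik => /cycle_formulaP.
  by rewrite e0 e1.
move=> [s [us ss sP]]; apply/GRing.foldExistsP.
pose pt i := nth (0, 0) s i.
pose en j := if j == 0%N then a else if j == 1%N then b else
  if odd j then (pt (j./2).-1).2 else (pt (j./2).-1).1.
exists (mkseq en (2 + 2 * k)).
  move=> j; rewrite !inE mem_iota negb_and -ltnNge -leqNgt => jk.
  case: j jk => [|[|j]] jk; [by rewrite nth_mkseq|by rewrite nth_mkseq|].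
  rewrite [RHS]nth_default ?size_mkseq; last by lia.
  by rewrite nth_default.
have eX i : (i < k)%N -> (mkseq en (2 + 2 * k))`_(2 + 2 * i) = (pt i).1.
  move=> ik; rewrite nth_mkseq; last by lia.
  rewrite /en (_ : 2 + 2 * i = (i.*2).+2)%N; last by rewrite -muln2; lia.
  by rewrite /= negbK odd_double /= doubleK.
have eY i : (i < k)%N -> (mkseq en (2 + 2 * k))`_(3 + 2 * i) = (pt i).2.
  move=> ik; rewrite nth_mkseq; last by lia.
  rewrite /en (_ : 3 + 2 * i = (i.*2.+1).+2)%N; last by rewrite -muln2; lia.
  by rewrite /= odd_double /= uphalf_double.
have evX i : (i < k)%N -> GRing.eval (mkseq en (2 + 2 * k)) (X i) = (pt i).1 by exact: eX.
have evY i : (i < k)%N -> GRing.eval (mkseq en (2 + 2 * k)) (Y i) = (pt i).2 by exact: eY.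
have e0 : (mkseq en (2 + 2 * k))`_0 = a by rewrite nth_mkseq.
have e1 : (mkseq en (2 + 2 * k))`_1 = b by rewrite nth_mkseq.
split.
  apply/conjunctionP => i; rewrite mem_iota add0n => /andP[_ ik].
  apply/cycle_formulaP; rewrite e0 e1 evX// evY//.
  by rewrite -surjective_pairing; apply: sP; rewrite mem_nth// ss.
apply/conjunctionP => i; rewrite mem_iota add0n => /andP[_ ik].
apply/conjunctionP => j; rewrite mem_iota add0n => /andP[_ jk].
case: ifP => // ij [hx hy]; move: hx hy.
change (GRing.eval (mkseq en (2 + 2 * k)) (X i) = GRing.eval (mkseq en (2 + 2 * k)) (X j) ->
  GRing.eval (mkseq en (2 + 2 * k)) (Y i) = GRing.eval (mkseq en (2 + 2 * k)) (Y j) -> False).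
rewrite !evX// !evY// => hx hy.
have /eqP : pt i = pt j by rewrite [pt i]surjective_pairing [pt j]surjective_pairing hx hy.
by rewrite nth_uniq ?ss// => /eqP ij'; rewrite ij' ltnn in ij.
Qed.

End QuantifierElimination.

(** * Generic parameters *)

Section Generic.
Variable R : realType.
Local Notation C := R[i].
Local Notation T := {poly {poly C}}.

Lemma large_nonroot (p : {poly C}) (B : R) : p != 0 -> exists2 x, B <= nm x & p.[x] != 0.
Proof.
move=> p0; apply: contrapT => h.
pose s (i : 'I_(size p)) : C := (`|B| + i%:R)%:C%C.
have sinj : injective s.
  by move=> i j /complexI/addrI/eqP; rewrite eqr_nat => /eqP/val_inj.
suff : (size p < size p)%N by rewrite ltnn.
rewrite -[X in (X < _)%N]card_ord -(size_codom s).
apply: max_poly_roots => //; last by rewrite -/(injectiveb s); exact/injectiveP.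
apply/allP => _ /codomP[i ->]; apply: contrapT => si; apply: h; exists (s i); last exact/negP.
rewrite /s nm_real ger0_norm ?addr_ge0//.
by apply: le_trans (ler_norm B) _; rewrite lerDl.
Qed.

(** Parameters with |b| large relative to a are Zariski dense: a is chosen off the zeros of the
    leading coefficient, then b off the finitely many zeros that remain. *)
Lemma large_nonroot2 (p : T) : p != 0 ->
  exists a b, [/\ 4 <= nm a, 100 * (nm a + 1) <= nm b & ev2 a b p != 0].
Proof.
move=> p0; have [a a4 ca] : exists2 a, 4 <= nm a & (lead_coef p).[a] != 0.
  by apply: large_nonroot; rewrite lead_coef_eq0.
have fa : fib a p != 0.
  apply/eqP => /(congr1 (fun q : {poly C} => q`_(size p).-1)).
  by rewrite coef_map coef0 /= horner_evalE => /eqP; rewrite (negbTE ca).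
have [b bB hb] := large_nonroot (100 * (nm a + 1)) fa.
by exists a, b; rewrite -horner_fib.
Qed.

(* Having exactly [size (words n)] points is a first-order property of (a, b), so
   by quantifier elimination it holds generically as soon as it holds on a
   Zariski dense set, here for |b| large. *)
Lemma generic_cycle_points n : (0 < n)%N -> exists2 p : T, p != 0 &
  forall a b, ev2 a b p != 0 -> exists s : seq (C * C),
    [/\ uniq s, size s = size (words n) & forall q, cycle_point a b n q <-> q \in s].
Proof.
move=> n0; pose N := size (words n).
have [p1 [v1 [p10 h1]]] := generic_dichotomy (rformula_many_cycles C n N).
have [p2 [v2 [p20 h2]]] := generic_dichotomy (rformula_many_cycles C n N.+1).
have p0 : p1 * p2 != 0 by rewrite mulf_neq0.
(* One parameter from the dense set decides both truth values: it has [N] points, but not [N.+1]. *)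
have [v1T v2F] : v1 /\ ~~ v2.
  have [a [b [a4 ab]]] := large_nonroot2 p0.
  rewrite rmorphM mulf_eq0 negb_or => /andP[/h1 w1 /h2 w2].
  have [s [us ss sP]] := cycle_points_exact n0 ab a4.
  split; first by apply/w1/many_cyclesP; exists s; split => // q /sP.
  apply/negP => /w2/many_cyclesP[s' [us' ss' s'P]].
  have : (size s' <= size s)%N by apply: uniq_leq_size => // q /s'P/sP.
  by rewrite ss' ss ltnn.
exists (p1 * p2) => // a b; rewrite rmorphM mulf_eq0 negb_or => /andP[/h1 w1 /h2 w2].
have /many_cyclesP[s [us ss sP]] := w1.2 v1T.
exists s; split => // q; split=> [cq|]; last exact: sP.
apply: contrapT => qs; move/negP: v2F; apply; apply/w2/many_cyclesP.
exists (q :: s); split; rewrite /= ?ss// ?us ?andbT; first exact/negP.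
by move=> q'; rewrite inE => /predU1P[->//|]; exact: sP.
Qed.

Lemma separated (s : seq (C * C)) q : exists2 r : R, 0 < r & forall z,
  z \in s -> close q r z -> z = q.
Proof.
elim: s => [|x s [r r0 IH]]; first by exists 1.
have [xq|xq] := eqVneq x q.
  exists r => // z; rewrite inE => /predU1P[->//|]; exact: IH.
pose d := Num.max (nm (x.1 - q.1)) (nm (x.2 - q.2)).
have d0 : 0 < d.
  rewrite lt_max !nm_gt0 !subr_eq0 -negb_and; apply: contra_neqN xq => /andP[/eqP e1 /eqP e2].
  by apply: injective_projections.
exists (Num.min r d) => [|z]; first by rewrite lt_min r0.
rewrite inE => /predU1P[->|zs] cz; last by apply: IH => //; apply: closeW cz; rewrite ge_min lexx.
have [h1 h2] : close q d x by apply: closeW cz; rewrite ge_min lexx orbT.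
by exfalso; have : d < d by [rewrite {1}/d gt_max h1|]; rewrite ltxx.
Qed.

Lemma finite_isolated (A : set (CC2 R)) (s : seq (C * C)) : (forall q, A q <-> q \in s) ->
  forall q, A q -> isolated A q.
Proof.
move=> As q Aq; split; first exact/mem_set.
have [r r0 rP] := separated s q; exists [set z : CC2 R | close q r z].
  by apply/near_close; exists r.
apply/seteqP; split=> [z [cz /As zs]|_ ->] /=; first exact: rP.
by split => //; rewrite /close !subrr nm0.
Qed.

(** Both equations vanish at q, so every element of the ideal does, and the constant 1 is free
    modulo it. *)
Lemma mult_ge1 (a b : CC R) n q : iter n (F a b) q = q -> (1%:E <= mult a b n q)%E.
Proof.
move=> qn; apply: ereal_sup_ubound; exists 1%N => //.
exists (fun _ _ => 1); split=> [i|lam /in_idealP[u [v [_ _ [r r0 rP]]]] i].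
  by apply/holP; exact: hol_const.
have := rP q; rewrite /close !subrr nm0 => /(_ (conj r0 r0)).
rewrite qn !subrr !mulr0 addr0 big_ord1 mulr1 => lam0.
by rewrite (ord1 i).
Qed.

Lemma numFix'_ge (a b : CC R) n (s : seq (C * C)) : (0 < n)%N -> uniq s ->
  (forall q, cycle_point a b n q <-> q \in s) -> ((size s)%:R%:E <= numFix' a b n)%E.
Proof.
move=> n0 us sP; have Fs q : Fix' a b n q <-> q \in s by rewrite Fix'P.
pose A : set (CC2 R) := [set` s].
apply: le_trans (_ : \sum_(q \in A) mult a b n q <= _)%E; last first.
  apply: ereal_sup_ubound; exists A => //; split; first exact: finite_seq.
  by move=> q /Fs.
rewrite /A -fsbig_seq//.
apply: le_trans (_ : \sum_(q <- s) 1%:E <= _)%E.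
  by rewrite sumEFin big_const_seq count_predT iter_addr_0.
rewrite big_seq [leRHS]big_seq; apply: lee_sum => q /Fs [_ _ qn].
exact: mult_ge1.
Qed.

End Generic.

Theorem theorem2 (R : realType) (phi : nat -> nat)
    (phi1 : phi 1%N = 0%N) (phi2 : phi 2%N = 2%N) (phi3 : phi 3%N = 3%N)
    (phi_rec : forall n, (1 <= n)%N -> phi (n + 3)%N = (phi n + phi (n + 1))%N) :
  (forall a b : CC R,
     (forall n, (1 <= n)%N ->
        forall q, Fix' a b n q -> isolated (Fix' a b n) q) ->
     forall n, (1 <= n)%N -> (numFix' a b n <= (phi n + 2)%:R%:E)%E) /\
  generically [set ab : CC2 R | forall n, (1 <= n)%N ->
     numFix' ab.1 ab.2 n = (phi n + 2)%:R%:E].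
Proof.
have szW := size_words phi1 phi2 phi3 phi_rec.
split=> [a b iso n n1|]; first by rewrite -szW//; apply: numFix'_le => // q; exact: iso.
have /choice[p pP] n : exists p : {poly {poly R[i]}}, p != 0 /\
    forall a b, ev2 a b p != 0 -> exists s : seq (R[i] * R[i]),
    [/\ uniq s, size s = size (words n.+1) & forall q, cycle_point a b n.+1 q <-> q \in s].
  by have [p p0 pP] := generic_cycle_points R (ltn0Sn n); exists p.
(* The k-th exceptional set concerns the period k + 1. *)
exists (fun n => [set ab : CC2 R | ev2 ab.1 ab.2 (p n) = 0]); split=> [k|[a b] nV [//|n] _].
  split.
    exists [set p k]; apply/seteqP; split=> [ab h q ->//|ab]; exact.
  have [a [b [_ _ nz]]] := large_nonroot2 (pP k).1.
  by move/seteqP => [_ /(_ (a, b) I)] /= /eqP; rewrite (negbTE nz).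
have nz : ev2 a b (p n) != 0 by apply/eqP => z; apply: nV; exists n.
have [s [us ss sP]] := (pP n).2 a b nz.
(* The points are finitely many, hence isolated, so the upper bound applies at this period; the
   lower bound counts each point at least once. *)
rewrite -szW//; apply/eqP; rewrite eq_le /=; apply/andP; split; last first.
  by rewrite -ss; exact: numFix'_ge.
apply: numFix'_le => // q; apply: (@finite_isolated _ _ s) => {}q.
by rewrite Fix'P.
Qed.
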